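(* Let $K$ be a connected normal filtered face set, of minimal model $(\bigwedge\bigoplus_{\overline p\in\hat{\mathcal P}^n}V_{[\overline p]},d)_\bullet$. Then $(\bigwedge V_{[\overline 0]},d)$ is a minimal model (in Sullivan's sense) of the face set associated to $K$, i.e. of the CDGA $A_{PL}(K)$ of Sullivan polynomial forms on the underlying face set.
   Context: All vector spaces are over $\mathbb Q$. Fix $n$. Filtered face sets: let $\mathbf\Delta^{[n]}_{\mathcal F}$ be the category whose objects are the joins $\Delta=\Delta^{j_0}*\cdots*\Delta^{j_n}$ with $j_i\ge -1$ (conventions $\Delta^{-1}=\emptyset$, $\emptyset*X=X$; not all factors empty) and whose morphisms are joins $*_i\sigma_i$ where each $\sigma_i\colon\Delta^{j_i}\to\Delta^{k_i}$ is induced by an injective order-preserving map of vertices, or is $\emptyset\to\Delta^{k_i}$. A filtered face set is a contravariant functor $K$ from $\mathbf\Delta^{[n]}_{\mathcal F}$ to sets; its elements are simplices $\sigma\colon\Delta^{j_0}*\cdots*\Delta^{j_n}\to K$; $K_+$ denotes the simplices with $j_n\ge0$. Forgetting the join decompositions gives the associated face set (simplicial set without degeneracies). $K$ is connected if its regular part $K^{[0]}$ (simplices with $j_i=-1$ for all $i<n$) is a connected face set. Write $\sigma\vartriangleleft\phi$ if $\sigma$ is a face (any codimension) of $\phi$. $K$ is normal if (a) every $\sigma\in K\setminus K_+$ is a face of some $\phi\in K_+$; (b) for every $\sigma\in K\setminus K_+$ and $\phi,\phi'\in K_+$ with $\sigma\vartriangleleft\phi$, $\sigma\vartriangleleft\phi'$,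 there are $\phi_1,\dots,\phi_m\in K_+$ with $\sigma\vartriangleleft\phi_i$ for all $i$ and $\phi\vartriangleleft\phi_1\vartriangleright\cdots\vartriangleleft\phi_m\vartriangleright\phi'$. Forms: $A_{PL}(\Delta^m)=\bigwedge(t_0,\dots,t_m,dt_0,\dots,dt_m)/(\sum t_i=1,\sum dt_i=0)$; on a face set $T$, $A_{PL}(T)$ is the CDGA of families of forms on the simplices of $T$ compatible with faces. Write $c\Delta^j=\Delta^{j+1}$ for the cone on $\Delta^j$, with cone point the last vertex ($c\emptyset=\Delta^0$), and $\Delta^j\times\{1\}$ for the face opposite to the cone point. $\widetilde A_{PL}(K)$ is the CDGA of families $\omega=(\omega_\sigma)_{\sigma\in K_+}$ with $\omega_\sigma\in A_{PL}(c\Delta^{j_0})\otimes\cdots\otimes A_{PL}(c\Delta^{j_{n-1}})\otimes A_{PL}(\Delta^{j_n})$ compatible with all morphisms between objects with non-empty last factor. For $\ell\in\{1,\dots,n\}$: $\|\omega_\sigma\|_\ell=-\infty$ if $j_{n-\ell}=-1$; otherwise restrict the factor of index $n-\ell$ to $A_{PL}(\Delta^{j_{n-\ell}}\times\{1\})$ and let $\|\omega_\sigma\|_\ell$ be the largest $d$ such that the component of the restriction of total degree $d$ in the last $\ell$ tensor factors is non-zero ($-\infty$ if the restriction is zero). $\|\omega\|_\ell=\sup_\sigma\|\omega_\sigma\|_\ell$. Perversities: a GM-perversity is a map $\overline q$ with $\overline q(0)=\overline q(1)=\overline q(2)=0$ and $\overline q(i)\le\overline q(i+1)\le\overline q(i)+1$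 for $i\ge1$; $\mathcal P^n$ is the lattice of GM-perversities (functions on $\{0,\dots,n\}$); $\hat{\mathcal P}^n=\mathcal P^n\cup\{\overline\infty\}$ with $\overline\infty$ the constant map $\infty$. For $\overline q\in\hat{\mathcal P}^n$, $\mathcal A(K)_{\overline q}=\{\omega\in\widetilde A_{PL}(K):\|\omega\|_\ell,\|d\omega\|_\ell\le\overline q(\ell)\ \forall\ell\}$. Perverse CDGA's: functors $\overline p\mapsto A_{\overline p}$ from the poset $\hat{\mathcal P}^n$ to cochain complexes with compatible associative, unital, graded commutative products $A_{\overline p}\otimes A_{\overline q}\to A_{\overline r}$ for $\overline p+\overline q\le\overline r$; $\mathcal A(K)_\bullet$ is one. A quasi-isomorphism is a morphism inducing isomorphisms in cohomology for each $\overline p$. For graded vector spaces $(V_{[\overline p]})_{\overline p\in\hat{\mathcal P}^n}$, the free perverse CGA $B=\bigwedge(\bigoplus_{\overline p}V_{[\overline p]})$ has $B_{\overline p}$ equal to the span of the products $v_1\cdots v_k$, $v_i\in V_{[\overline p_i]}$, $\overline p_1+\dots+\overline p_k\le\overline p$. A Sullivan minimal perverse CDGA is such a $B$ with a differential $d$ preserving each $B_{\overline p}$, such that $V_{[\overline p]}=\bigoplus_{m\ge1}V^m_{[\overline p]}$, $V^m_{[\overline p]}=\bigcup_{i\ge0}V_{[\overline p]}(i)^m$ with $V_{[\overline p]}(i)^m=V_{[\overline p]}(i-1)^m\oplus V_{[\overline p]}[i]^m$, $V_{[\overline p]}(-1)^m=0$, and $dV^m_{[\overline p]}[i]\subset\big((\bigwedge\bigoplus_{\overline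 r<\overline p}V_{[\overline r]})\otimes(\bigwedge V^{<m}_{[\overline p]})\otimes(\bigwedge V^m_{[\overline p]}(i-1))\big)_{\overline p}$. The minimal model of a connected filtered face set $K$ is the Sullivan minimal perverse CDGA $B_\bullet$ (it exists, unique up to isomorphism) with a quasi-isomorphism $B_\bullet\to\mathcal A(K)_\bullet$.
   Formalization: In normality (b), σ◁φ carries a chosen inclusion of σ into φ, and the zigzags must respect these inclusions; with the bare face relation the claim fails, e.g. for Δ^1*Δ^0 with the two vertices of Δ^1 identified. *)

(* Defs.v *)
From Stdlib Require List.
From HB Require Import structures.
From mathcomp Require Import all_boot all_order all_algebra.
From mathcomp Require Import boolp constructive_ereal.
From mathcomp Require Import generic_quotient.

Set Implicit Arguments.
Unset Strict Implicit.
Unset Printing Implicit Defensive.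

Import Order.TTheory GRing.Theory Num.Theory.
Local Open Scope ring_scope.
Local Open Scope quotient_scope.

Record submod (V : lmodType rat) := Submod {
  smem :> V -> Prop;
  smem0 : smem 0;
  smemP : forall (a : rat) x y, smem x -> smem y -> smem (a *: x + y) }.

Section Submod.
Variables (V : lmodType rat) (S : submod V).

Lemma smemD x y : S x -> S y -> S (x + y).
Proof. by move=> Sx Sy; rewrite -[x]scale1r; apply: smemP. Qed.

Lemma smemZ a x : S x -> S (a *: x).
Proof. by move=> Sx; rewrite -[_ *: _]addr0; apply: smemP => //; apply: smem0. Qed.

Lemma smem_sum (I : Type) (r : seq I) (F : I -> V) :
  (forall i, S (F i)) -> S (\sum_(i <- r) F i).
Proof.
by move=> SF; elim/big_rec: _ => [|i x _ Sx]; [apply: smem0 | apply: smemD].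
Qed.

Definition smem_pred : pred V := fun x => `[< S x >].

Fact smem_pred_closed : subsemimod_closed smem_pred.
Proof.
do 2?split.
- by apply/asboolP; apply: smem0.
- by move=> x y /asboolP Sx /asboolP Sy; apply/asboolP; apply: smemD.
- by move=> a x /asboolP Sx; apply/asboolP; apply: smemZ.
Qed.
HB.instance Definition _ :=
  GRing.isSubmodClosed.Build rat V smem_pred smem_pred_closed.

Record submod_type := SubmodType { submod_val : V; _ : smem_pred submod_val }.
HB.instance Definition _ := [isSub for submod_val].
HB.instance Definition _ := [Choice of submod_type by <:].
HB.instance Definition _ := [SubChoice_isSubLmodule of submod_type by <:].

Definition subspace : lmodType rat := submod_type.

Lemma subspaceP (x : subspace) : S (val x).
Proof. by apply/asboolP; apply: (valP x). Qed.

Definition in_subspace x (Sx : S x) : subspace :=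
  SubmodType (introT (asboolP _) Sx).

Lemma in_subspaceK x (Sx : S x) : val (in_subspace Sx) = x.
Proof. by []. Qed.

End Submod.

Section SubmodOps.
Variable V : lmodType rat.
Implicit Types S : submod V.

Definition sub_cap S1 S2 : submod V.
Proof.
exists (fun x => S1 x /\ S2 x) => [|a x y [? ?] [? ?]].
  by split; apply: smem0.
by split; apply: smemP.
Defined.

Definition sub_span (P : V -> Prop) : submod V.
Proof.
exists (fun x => exists2 r : seq (rat * V),
          List.Forall (fun y => P y.2) r & x = \sum_(y <- r) y.1 *: y.2).
  by exists [::]; rewrite ?big_nil.
move=> a x y [r Pr ->] [s Ps ->].
exists ([seq (a * z.1, z.2) | z <- r] ++ s).
  apply/List.Forall_app; split=> //.
  by elim: Pr => //= z r' Pz _ IH; constructor.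
rewrite big_cat big_map scaler_sumr /=; congr (_ + _).
by apply: eq_bigr => z _; rewrite scalerA.
Defined.

Lemma sub_span_gen (P : V -> Prop) x : P x -> sub_span P x.
Proof.
by move=> Px; exists [:: (1, x)]; rewrite ?big_seq1 ?scale1r //; constructor.
Qed.

Lemma sub_span_ind (P Q : V -> Prop) :
  Q 0 -> (forall a x y, Q x -> Q y -> Q (a *: x + y)) ->
  (forall x, P x -> Q x) -> forall x, sub_span P x -> Q x.
Proof.
move=> Q0 QL PQ x [r Pr ->]; elim: Pr => [|y s Py _ IH]; first by rewrite big_nil.
by rewrite big_cons; apply: QL => //; apply: PQ.
Qed.

End SubmodOps.

Record cochain := Cochain {
  cdeg :> nat -> lmodType rat;
  cdiff : forall k, {linear cdeg k -> cdeg k.+1};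
  cdiffK : forall k (x : cdeg k), cdiff k.+1 (cdiff k x) = 0 }.

Record cochain_map (C D : cochain) := CochainMap {
  cmap :> forall k, {linear C k -> D k};
  cmap_diff : forall k (x : C k), cmap k.+1 (cdiff C k x) = cdiff D k (cmap k x) }.

Definition coboundary (C : cochain) k : C k -> Prop :=
  match k with
  | 0 => fun x => x = 0
  | k'.+1 => fun x => exists y : C k', x = cdiff C k' y
  end.

(* The two clauses say that H^k(f) is injective and surjective. *)
Definition quasi_iso (C D : cochain) (f : cochain_map C D) : Prop :=
  forall k,
    (forall x : C k, cdiff C k x = 0 -> coboundary (f k x) -> coboundary x) /\
    (forall y : D k, cdiff D k y = 0 ->
       exists2 x : C k, cdiff C k x = 0 & coboundary (y - f k x)).

(* The product of degrees i and j lands in degree k for every proof of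
   i + j = k, so that no transport along arithmetic identities is needed. *)
Record cdga := Cdga {
  gcx :> cochain;
  gone : gcx 0;
  gmul : forall i j k, (i + j)%N = k -> gcx i -> gcx j -> gcx k;
  gmulDl : forall i j k (e : (i + j)%N = k) a x x' y,
    gmul e (a *: x + x') y = a *: gmul e x y + gmul e x' y;
  gmulDr : forall i j k (e : (i + j)%N = k) a x y y',
    gmul e x (a *: y + y') = a *: gmul e x y + gmul e x y';
  gmulA : forall i j k ij jk l (e1 : (i + j)%N = ij) (e2 : (ij + k)%N = l)
      (e3 : (j + k)%N = jk) (e4 : (i + jk)%N = l) x y z,
    gmul e2 (gmul e1 x y) z = gmul e4 x (gmul e3 y z);
  gmul1l : forall i (e : (0 + i)%N = i) x, gmul e gone x = x;
  gmulC : forall i j k (e : (i + j)%N = k) (e' : (j + i)%N = k) x y,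
    gmul e x y = (-1) ^+ (i * j) *: gmul e' y x;
  gleibniz : forall i j k (e : (i + j)%N = k) (e1 : (i.+1 + j)%N = k.+1)
      (e2 : (i + j.+1)%N = k.+1) x y,
    cdiff gcx k (gmul e x y) =
      gmul e1 (cdiff gcx i x) y + (-1) ^+ i *: gmul e2 x (cdiff gcx j y) }.

Record cdga_map (A B : cdga) := CdgaMap {
  cdga_fun :> cochain_map A B;
  cdga_map1 : cdga_fun 0 (gone A) = gone B;
  cdga_mapM : forall i j k (e : (i + j)%N = k) x y,
    cdga_fun k (gmul e x y) = gmul e (cdga_fun i x) (cdga_fun j y) }.

Section Perversities.
Variable n : nat.

Definition is_GM (q : {ffun 'I_n.+1 -> nat}) : bool :=
  [forall i : 'I_n.+1, (i <= 2)%N ==> (q i == 0)%N] &&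
  [forall i : 'I_n.+1, forall j : 'I_n.+1,
     (0 < i)%N && (j == i.+1 :> nat) ==> (q i <= q j <= (q i).+1)%N].

Definition gm_perv := {q : {ffun 'I_n.+1 -> nat} | is_GM q}.

(* [None] is the constant perversity oo *)
Definition perv := option gm_perv.

Definition perv_val (p : perv) (i : 'I_n.+1) : \bar int :=
  if p is Some q then (sval q i)%:Z%:E else +oo%E.

(* p_1 + ... + p_k <= r; the sum is a function which need not be a
   perversity *)
Definition perv_sum_le (s : seq perv) (r : perv) : bool :=
  [forall i, (\sum_(p <- s) perv_val p i <= perv_val r i)%E].

Definition perv_le (p q : perv) : bool := perv_sum_le [:: p] q.
Definition perv_add_le (p q r : perv) : bool := perv_sum_le [:: p; q] r.
Definition perv_lt (p q : perv) : bool := (p != q) && perv_le p q.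

Fact is_GM0 : is_GM [ffun=> 0%N].
Proof.
apply/andP; split; first by apply/forallP => i; rewrite ffunE eqxx implybT.
by apply/forallP => i; apply/forallP => j; rewrite !ffunE implybT.
Qed.

Definition perv0 : perv := Some (exist (fun q => is_GM q) _ is_GM0).

Lemma perv_leE p q : perv_le p q -> forall i, (perv_val p i <= perv_val q i)%E.
Proof. by move=> /forallP h i; have := h i; rewrite big_seq1. Qed.

Lemma perv_add_leE p q r : perv_add_le p q r ->
  forall i, (perv_val p i + perv_val q i <= perv_val r i)%E.
Proof. by move=> /forallP h i; have := h i; rewrite big_cons big_seq1. Qed.

Lemma perv_val_ge0 p i : (0 <= perv_val p i)%E.
Proof. by case: p. Qed.

End Perversities.

Record perverse_cdga (n : nat) := PerverseCdga {
  pcx :> perv n -> cochain;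
  pres : forall p q, perv_le p q -> cochain_map (pcx p) (pcx q);
  pres_id : forall p (h : perv_le p p) k (x : pcx p k), pres h k x = x;
  pres_comp : forall p q r (h : perv_le p q) (h' : perv_le q r)
      (h'' : perv_le p r) k (x : pcx p k),
    pres h' k (pres h k x) = pres h'' k x;
  pone : pcx (perv0 n) 0;
  pmul : forall p q r, perv_add_le p q r ->
    forall i j k, (i + j)%N = k -> pcx p i -> pcx q j -> pcx r k;
  pmul_nat : forall p q r p' q' r' (h : perv_add_le p q r)
      (h' : perv_add_le p' q' r') (hp : perv_le p p') (hq : perv_le q q')
      (hr : perv_le r r') i j k (e : (i + j)%N = k) x y,
    pres hr k (pmul h e x y) = pmul h' e (pres hp i x) (pres hq j y);
  pmulDl : forall p q r (h : perv_add_le p q r)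
      i j k (e : (i + j)%N = k) a x x' y,
    pmul h e (a *: x + x') y = a *: pmul h e x y + pmul h e x' y;
  pmulDr : forall p q r (h : perv_add_le p q r)
      i j k (e : (i + j)%N = k) a x y y',
    pmul h e x (a *: y + y') = a *: pmul h e x y + pmul h e x y';
  pmulA : forall p q s pq qs r (h1 : perv_add_le p q pq)
      (h2 : perv_add_le pq s r) (h3 : perv_add_le q s qs)
      (h4 : perv_add_le p qs r)
      i j k ij jk l (e1 : (i + j)%N = ij) (e2 : (ij + k)%N = l)
      (e3 : (j + k)%N = jk) (e4 : (i + jk)%N = l) x y z,
    pmul h2 e2 (pmul h1 e1 x y) z = pmul h4 e4 x (pmul h3 e3 y z);
  pmul1l : forall p (h : perv_add_le (perv0 n) p p) i (e : (0 + i)%N = i) x,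
    pmul h e pone x = x;
  pmulC : forall p q r (h : perv_add_le p q r) (h' : perv_add_le q p r)
      i j k (e : (i + j)%N = k) (e' : (j + i)%N = k) x y,
    pmul h e x y = (-1) ^+ (i * j) *: pmul h' e' y x;
  pleibniz : forall p q r (h : perv_add_le p q r)
      i j k (e : (i + j)%N = k) (e1 : (i.+1 + j)%N = k.+1)
      (e2 : (i + j.+1)%N = k.+1) x y,
    cdiff (pcx r) k (pmul h e x y) =
      pmul h e1 (cdiff (pcx p) i x) y +
      (-1) ^+ i *: pmul h e2 x (cdiff (pcx q) j y) }.

Record perverse_map n (A B : perverse_cdga n) := PerverseMap {
  pfun :> forall p, cochain_map (A p) (B p);
  pfun_nat : forall p q (h : perv_le p q) k (x : A p k),
    pfun q k (pres A h k x) = pres B h k (pfun p k x);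
  pfun1 : pfun (perv0 n) 0 (pone A) = pone B;
  pfunM : forall p q r (h : perv_add_le p q r) i j k (e : (i + j)%N = k) x y,
    pfun r k (pmul h e x y) = pmul h e (pfun p i x) (pfun q j y) }.

Definition perverse_quasi_iso n (A B : perverse_cdga n) (f : perverse_map A B) :=
  forall p, quasi_iso (f p).

(* Associative and unital, possibly zero: the library's [algType rat] excludes
   the zero ring. *)
HB.mixin Record isQAlgebra A of GRing.Lmodule rat A := {
  qmul : A -> A -> A;
  qone : A;
  qmulA : associative qmul;
  qmul1r : left_id qone qmul;
  qmulr1 : right_id qone qmul;
  qmulDl : left_distributive qmul +%R;
  qmulDr : right_distributive qmul +%R;
  qscaleAl : forall (a : rat) (x y : A), a *: qmul x y = qmul (a *: x) y;
  qscaleAr : forall (a : rat) (x y : A), a *: qmul x y = qmul x (a *: y) }.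
#[short(type="qalgType")]
HB.structure Definition QAlgebra := {A of GRing.Lmodule rat A & isQAlgebra A}.

Reserved Notation "x ** y" (at level 40, left associativity).
Notation "x ** y" := (qmul x y) : ring_scope.

Section QAlgebraTheory.
Variable A : qalgType.
Implicit Types x y : A.

HB.instance Definition _ :=
  Monoid.isLaw.Build A qone qmul qmulA qmul1r qmulr1.

Lemma qmul0r x : 0 ** x = 0.
Proof. by have := qscaleAl 0 0 x; rewrite !scale0r. Qed.
Lemma qmulr0 x : x ** 0 = 0.
Proof. by have := qscaleAr 0 x 0; rewrite !scale0r. Qed.
Lemma qmul_suml (I : Type) (r : seq I) (P : pred I) (F : I -> A) x :
  (\sum_(i <- r | P i) F i) ** x = \sum_(i <- r | P i) (F i ** x).
Proof. by apply: (big_morph (qmul^~ x)) => [y z|]; [apply: qmulDl | apply: qmul0r]. Qed.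
Lemma qmul_sumr (I : Type) (r : seq I) (P : pred I) (F : I -> A) x :
  x ** (\sum_(i <- r | P i) F i) = \sum_(i <- r | P i) (x ** F i).
Proof. by apply: (big_morph (qmul x)) => [y z|]; [apply: qmulDr | apply: qmulr0]. Qed.

End QAlgebraTheory.

Definition family (I : Type) (A : I -> qalgType) : Type := forall i, A i.

Section Family.
Variables (I : Type) (A : I -> qalgType).
Local Notation F := (family A).

HB.instance Definition _ := gen_eqMixin F.
HB.instance Definition _ := gen_choiceMixin F.

Let zero : F := fun=> 0.
Let one : F := fun=> qone.
Let opp (f : F) : F := fun i => - f i.
Let add (f g : F) : F := fun i => f i + g i.
Let mul (f g : F) : F := fun i => f i ** g i.
Let scale (a : rat) (f : F) : F := fun i => a *: f i.

Fact fam_addA : associative add.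
Proof. by move=> f g h; apply/functional_extensionality_dep => i; apply: addrA. Qed.
Fact fam_addC : commutative add.
Proof. by move=> f g; apply/functional_extensionality_dep => i; apply: addrC. Qed.
Fact fam_add0 : left_id zero add.
Proof. by move=> f; apply/functional_extensionality_dep => i; apply: add0r. Qed.
Fact fam_addN : left_inverse zero opp add.
Proof. by move=> f; apply/functional_extensionality_dep => i; apply: addNr. Qed.
HB.instance Definition _ :=
  GRing.isZmodule.Build F fam_addA fam_addC fam_add0 fam_addN.

Fact fam_mulA : associative mul.
Proof. by move=> f g h; apply/functional_extensionality_dep => i; apply: qmulA. Qed.
Fact fam_mul1r : left_id one mul.
Proof. by move=> f; apply/functional_extensionality_dep => i; apply: qmul1r. Qed.
Fact fam_mulr1 : right_id one mul.
Proof. by move=> f; apply/functional_extensionality_dep => i; apply: qmulr1. Qed.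
Fact fam_mulDl : left_distributive mul add.
Proof. by move=> f g h; apply/functional_extensionality_dep => i; apply: qmulDl. Qed.
Fact fam_mulDr : right_distributive mul add.
Proof. by move=> f g h; apply/functional_extensionality_dep => i; apply: qmulDr. Qed.
Fact fam_scaleA a b f : scale a (scale b f) = scale (a * b) f.
Proof. by apply/functional_extensionality_dep => i; apply: scalerA. Qed.
Fact fam_scale1 : left_id 1 scale.
Proof. by move=> f; apply/functional_extensionality_dep => i; apply: scale1r. Qed.
Fact fam_scaleDr : right_distributive scale add.
Proof. by move=> a f g; apply/functional_extensionality_dep => i; apply: scalerDr. Qed.
Fact fam_scaleDl f : {morph scale^~ f : a b / a + b >-> add a b}.
Proof. by move=> a b; apply/functional_extensionality_dep => i; apply: scalerDl. Qed.
HB.instance Definition _ := GRing.Zmodule_isLmodule.Build rat F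
  fam_scaleA fam_scale1 fam_scaleDr fam_scaleDl.

Fact fam_scaleAl (a : rat) (f g : F) : a *: mul f g = mul (a *: f) g.
Proof. by apply/functional_extensionality_dep => i; apply: qscaleAl. Qed.
Fact fam_scaleAr (a : rat) (f g : F) : a *: mul f g = mul f (a *: g).
Proof. by apply/functional_extensionality_dep => i; apply: qscaleAr. Qed.
HB.instance Definition _ := isQAlgebra.Build F fam_mulA fam_mul1r fam_mulr1
  fam_mulDl fam_mulDr fam_scaleAl fam_scaleAr.

End Family.

Definition pser (A : qalgType) : Type := nat -> A.

Section PowerSeries.
Variable A : qalgType.
Local Notation F := (pser A).

HB.instance Definition _ := gen_eqMixin F.
HB.instance Definition _ := gen_choiceMixin F.

Let zero : F := fun=> 0.
Let opp (f : F) : F := fun i => - f i.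
Let add (f g : F) : F := fun i => f i + g i.
Let scale (a : rat) (f : F) : F := fun i => a *: f i.

Definition pser_one : F := fun i => if i == 0%N then qone else 0.
Definition pser_mul (f g : F) : F :=
  fun k => \sum_(i < k.+1) f i ** g (k - i)%N.

Fact ps_addA : associative add.
Proof. by move=> f g h; apply/funext => i; apply: addrA. Qed.
Fact ps_addC : commutative add.
Proof. by move=> f g; apply/funext => i; apply: addrC. Qed.
Fact ps_add0 : left_id zero add.
Proof. by move=> f; apply/funext => i; apply: add0r. Qed.
Fact ps_addN : left_inverse zero opp add.
Proof. by move=> f; apply/funext => i; apply: addNr. Qed.
HB.instance Definition _ :=
  GRing.isZmodule.Build F ps_addA ps_addC ps_add0 ps_addN.

Fact pser_mul_rev (f g : F) k :
  pser_mul f g k = \sum_(i < k.+1) f (k - i)%N ** g i.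
Proof.
rewrite /pser_mul (reindex_inj rev_ord_inj) /=.
by apply: eq_bigr => i _; rewrite (sub_ordK i).
Qed.

Fact ps_mulA : associative pser_mul.
Proof.
move=> p q r; apply/funext => i; rewrite [LHS]/pser_mul [RHS]pser_mul_rev.
pose c j k := p j ** (q (i - j - k)%N ** r k).
transitivity (\sum_(j < i.+1) \sum_(k < i.+1 | (k <= i - j)%N) c j k).
  apply: eq_bigr => /= j _; rewrite pser_mul_rev qmul_sumr.
  by rewrite (big_ord_narrow_leq (leq_subr _ _)).
rewrite (exchange_big_dep predT) //=; apply: eq_bigr => k _.
transitivity (\sum_(j < i.+1 | (j <= i - k)%N) c j k).
  apply: eq_bigl => j; rewrite -ltnS -(ltnS j) -!subSn ?leq_ord //.
  by rewrite -subn_gt0 -(subn_gt0 j) -!subnDA addnC.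
rewrite (big_ord_narrow_leq (leq_subr _ _)) /pser_mul qmul_suml.
by apply: eq_bigr => j _; rewrite /c -!subnDA addnC qmulA.
Qed.
Fact ps_mul1r : left_id pser_one pser_mul.
Proof.
move=> f; apply/funext => k; rewrite /pser_mul big_ord_recl /= qmul1r subn0.
by rewrite big1 ?addr0 // => i _; rewrite qmul0r.
Qed.
Fact ps_mulr1 : right_id pser_one pser_mul.
Proof.
move=> f; apply/funext => k; rewrite pser_mul_rev big_ord_recl /= qmulr1 subn0.
by rewrite big1 ?addr0 // => i _; rewrite qmulr0.
Qed.
Fact ps_mulDl : left_distributive pser_mul add.
Proof.
move=> f g h; apply/funext => k; rewrite /pser_mul /add -big_split /=.
by apply: eq_bigr => i _; rewrite qmulDl.
Qed.
Fact ps_mulDr : right_distributive pser_mul add.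
Proof.
move=> f g h; apply/funext => k; rewrite /pser_mul /add -big_split /=.
by apply: eq_bigr => i _; rewrite qmulDr.
Qed.
Fact ps_scaleA a b f : scale a (scale b f) = scale (a * b) f.
Proof. by apply/funext => i; apply: scalerA. Qed.
Fact ps_scale1 : left_id 1 scale.
Proof. by move=> f; apply/funext => i; apply: scale1r. Qed.
Fact ps_scaleDr : right_distributive scale add.
Proof. by move=> a f g; apply/funext => i; apply: scalerDr. Qed.
Fact ps_scaleDl f : {morph scale^~ f : a b / a + b >-> add a b}.
Proof. by move=> a b; apply/funext => i; apply: scalerDl. Qed.
HB.instance Definition _ := GRing.Zmodule_isLmodule.Build rat F
  ps_scaleA ps_scale1 ps_scaleDr ps_scaleDl.

Fact ps_scaleAl (a : rat) (f g : F) : a *: pser_mul f g = pser_mul (a *: f) g.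
Proof.
apply/funext => k; transitivity (a *: pser_mul f g k) => //.
by rewrite scaler_sumr; apply: eq_bigr => i _; rewrite qscaleAl.
Qed.
Fact ps_scaleAr (a : rat) (f g : F) : a *: pser_mul f g = pser_mul f (a *: g).
Proof.
apply/funext => k; transitivity (a *: pser_mul f g k) => //.
by rewrite scaler_sumr; apply: eq_bigr => i _; rewrite qscaleAr.
Qed.
HB.instance Definition _ := isQAlgebra.Build F ps_mulA ps_mul1r ps_mulr1
  ps_mulDl ps_mulDr ps_scaleAl ps_scaleAr.

End PowerSeries.

Inductive term (X : Type) : Type :=
| Gen of X | TZero | TOne | TOpp of term X
| TAdd of term X & term X | TMul of term X & term X | TScale of rat & term X.
Arguments TZero {X}.
Arguments TOne {X}.

Definition tsum (X : Type) (s : seq (term X)) : term X := foldr (@TAdd X) TZero s.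

Section Presentation.
Variables (X : Type) (dg : X -> nat) (rels : term X -> Prop).

(* Smallest congruence for which the quotient is an associative unital algebra,
   generators commute in the graded sense and the terms in [rels] vanish. *)
Inductive tcong : term X -> term X -> Prop :=
| tc_refl t : tcong t t
| tc_sym t u : tcong t u -> tcong u t
| tc_trans t u v : tcong t u -> tcong u v -> tcong t v
| tc_opp t t' : tcong t t' -> tcong (TOpp t) (TOpp t')
| tc_add t t' u u' : tcong t t' -> tcong u u' -> tcong (TAdd t u) (TAdd t' u')
| tc_mul t t' u u' : tcong t t' -> tcong u u' -> tcong (TMul t u) (TMul t' u')
| tc_scale a t t' : tcong t t' -> tcong (TScale a t) (TScale a t')
| tc_addA t u v : tcong (TAdd t (TAdd u v)) (TAdd (TAdd t u) v)
| tc_addC t u : tcong (TAdd t u) (TAdd u t)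
| tc_add0 t : tcong (TAdd TZero t) t
| tc_addN t : tcong (TAdd (TOpp t) t) TZero
| tc_mulA t u v : tcong (TMul t (TMul u v)) (TMul (TMul t u) v)
| tc_mul1r t : tcong (TMul TOne t) t
| tc_mulr1 t : tcong (TMul t TOne) t
| tc_mulDl t u v : tcong (TMul (TAdd t u) v) (TAdd (TMul t v) (TMul u v))
| tc_mulDr t u v : tcong (TMul t (TAdd u v)) (TAdd (TMul t u) (TMul t v))
| tc_scaleA a b t : tcong (TScale a (TScale b t)) (TScale (a * b) t)
| tc_scale1 t : tcong (TScale 1 t) t
| tc_scaleDr a t u : tcong (TScale a (TAdd t u)) (TAdd (TScale a t) (TScale a u))
| tc_scaleDl a b t : tcong (TScale (a + b) t) (TAdd (TScale a t) (TScale b t))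
| tc_scaleAl a t u : tcong (TScale a (TMul t u)) (TMul (TScale a t) u)
| tc_scaleAr a t u : tcong (TScale a (TMul t u)) (TMul t (TScale a u))
| tc_comm x y :
    tcong (TMul (Gen x) (Gen y))
      (TScale ((-1) ^+ (dg x * dg y)) (TMul (Gen y) (Gen x)))
| tc_rel t : rels t -> tcong t TZero.

HB.instance Definition _ := gen_eqMixin (term X).
HB.instance Definition _ := gen_choiceMixin (term X).

Definition tcongb : rel (term X) := fun t u => `[< tcong t u >].

Fact tcongb_equiv : equiv_class_of tcongb.
Proof.
split.
- by move=> t; apply/asboolP; apply: tc_refl.
- by move=> t u; apply/asboolP/asboolP; apply: tc_sym.
- move=> u t v /asboolP tu /asboolP uv.
  by apply/asboolP; apply: tc_trans tu uv.
Qed.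
Canonical tcong_equiv := EquivRelPack tcongb_equiv.

Definition cga : Type := {eq_quot tcongb}.
HB.instance Definition _ := Choice.on cga.
HB.instance Definition _ := Quotient.on cga.
HB.instance Definition _ := EqQuotient.on cga.

Lemma cga_eqP (t u : term X) : tcong t u <-> \pi_cga t = \pi_cga u.
Proof.
split=> [tu|/eqquotP /asboolP //].
by apply/eqquotP/asboolP.
Qed.

Definition cga_opp := lift_op1 cga (@TOpp X).
Definition cga_add := lift_op2 cga (@TAdd X).
Definition cga_mul := lift_op2 cga (@TMul X).
Definition cga_scale (a : rat) := lift_op1 cga (@TScale X a).

Lemma tcong_repr t : tcong (repr (\pi_cga t)) t.
Proof. by apply/cga_eqP; rewrite reprK. Qed.

Lemma piN t : cga_opp (\pi_cga t) = \pi_cga (TOpp t).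
Proof. by unlock cga_opp; apply/cga_eqP; apply: tc_opp; apply: tcong_repr. Qed.
Lemma piD t u : cga_add (\pi_cga t) (\pi_cga u) = \pi_cga (TAdd t u).
Proof. by unlock cga_add; apply/cga_eqP; apply: tc_add; apply: tcong_repr. Qed.
Lemma piM t u : cga_mul (\pi_cga t) (\pi_cga u) = \pi_cga (TMul t u).
Proof. by unlock cga_mul; apply/cga_eqP; apply: tc_mul; apply: tcong_repr. Qed.
Lemma piZ a t : cga_scale a (\pi_cga t) = \pi_cga (TScale a t).
Proof. by unlock cga_scale; apply/cga_eqP; apply: tc_scale; apply: tcong_repr. Qed.

Let piE := (piN, piD, piM, piZ).

Fact cga_addA : associative cga_add.
Proof.
by move=> x y z; rewrite -[x]reprK -[y]reprK -[z]reprK !piE; apply/cga_eqP; apply: tc_addA.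
Qed.
Fact cga_addC : commutative cga_add.
Proof. by move=> x y; rewrite -[x]reprK -[y]reprK !piE; apply/cga_eqP; apply: tc_addC. Qed.
Fact cga_add0 : left_id (\pi_cga TZero) cga_add.
Proof. by move=> x; rewrite -[x]reprK !piE; apply/cga_eqP; apply: tc_add0. Qed.
Fact cga_addN : left_inverse (\pi_cga TZero) cga_opp cga_add.
Proof. by move=> x; rewrite -[x]reprK !piE; apply/cga_eqP; apply: tc_addN. Qed.
HB.instance Definition _ :=
  GRing.isZmodule.Build cga cga_addA cga_addC cga_add0 cga_addN.

Fact cga_mulA : associative cga_mul.
Proof.
by move=> x y z; rewrite -[x]reprK -[y]reprK -[z]reprK !piE; apply/cga_eqP; apply: tc_mulA.
Qed.
Fact cga_mul1r : left_id (\pi_cga TOne) cga_mul.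
Proof. by move=> x; rewrite -[x]reprK !piE; apply/cga_eqP; apply: tc_mul1r. Qed.
Fact cga_mulr1 : right_id (\pi_cga TOne) cga_mul.
Proof. by move=> x; rewrite -[x]reprK !piE; apply/cga_eqP; apply: tc_mulr1. Qed.
Fact cga_mulDl : left_distributive cga_mul cga_add.
Proof.
by move=> x y z; rewrite -[x]reprK -[y]reprK -[z]reprK !piE; apply/cga_eqP; apply: tc_mulDl.
Qed.
Fact cga_mulDr : right_distributive cga_mul cga_add.
Proof.
by move=> x y z; rewrite -[x]reprK -[y]reprK -[z]reprK !piE; apply/cga_eqP; apply: tc_mulDr.
Qed.
Fact cga_scaleA a b x : cga_scale a (cga_scale b x) = cga_scale (a * b) x.
Proof. by rewrite -[x]reprK !piE; apply/cga_eqP; apply: tc_scaleA. Qed.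
Fact cga_scale1 : left_id 1 cga_scale.
Proof. by move=> x; rewrite -[x]reprK !piE; apply/cga_eqP; apply: tc_scale1. Qed.
Fact cga_scaleDr : right_distributive cga_scale cga_add.
Proof.
by move=> a x y; rewrite -[x]reprK -[y]reprK !piE; apply/cga_eqP; apply: tc_scaleDr.
Qed.
Fact cga_scaleDl x : {morph cga_scale^~ x : a b / a + b >-> cga_add a b}.
Proof. by move=> a b; rewrite -[x]reprK !piE; apply/cga_eqP; apply: tc_scaleDl. Qed.
HB.instance Definition _ := GRing.Zmodule_isLmodule.Build rat cga
  cga_scaleA cga_scale1 cga_scaleDr cga_scaleDl.

Fact cga_scaleAl (a : rat) (x y : cga) : a *: cga_mul x y = cga_mul (a *: x) y.
Proof.
rewrite /GRing.scale /= -[x]reprK -[y]reprK !piE.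
apply/cga_eqP; apply: tc_scaleAl.
Qed.
Fact cga_scaleAr (a : rat) (x y : cga) : a *: cga_mul x y = cga_mul x (a *: y).
Proof.
rewrite /GRing.scale /= -[x]reprK -[y]reprK !piE.
apply/cga_eqP; apply: tc_scaleAr.
Qed.
HB.instance Definition _ := isQAlgebra.Build cga cga_mulA cga_mul1r cga_mulr1
  cga_mulDl cga_mulDr cga_scaleAl cga_scaleAr.

Definition gen (x : X) : cga := \pi_cga (Gen x).

Lemma cga_pi0 : \pi_cga TZero = 0. Proof. by []. Qed.
Lemma cga_pi1 : \pi_cga TOne = qone. Proof. by []. Qed.
Lemma cga_piN t : \pi_cga (TOpp t) = - \pi_cga t. Proof. by rewrite -piE. Qed.
Lemma cga_piD t u : \pi_cga (TAdd t u) = \pi_cga t + \pi_cga u.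
Proof. by rewrite -piE. Qed.
Lemma cga_piM t u : \pi_cga (TMul t u) = \pi_cga t ** \pi_cga u.
Proof. by rewrite -piE. Qed.
Lemma cga_piZ a t : \pi_cga (TScale a t) = a *: \pi_cga t.
Proof. by rewrite -piE. Qed.

Definition cga_piE := (cga_pi0, cga_pi1, cga_piN, cga_piD, cga_piM, cga_piZ).

Lemma gen_comm x y : gen x ** gen y = (-1) ^+ (dg x * dg y) *: (gen y ** gen x).
Proof. by rewrite /gen -!cga_piE; apply/cga_eqP; apply: tc_comm. Qed.

Lemma cga_rel t : rels t -> \pi_cga t = 0.
Proof. by move=> rt; rewrite -cga_piE; apply/cga_eqP; apply: tc_rel. Qed.

Definition monom (s : seq X) : cga := \big[qmul/qone]_(x <- s) gen x.

Lemma monom_cat s s' : monom (s ++ s') = monom s ** monom s'.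
Proof. by rewrite /monom big_cat. Qed.

Definition mspan (P : seq X -> Prop) : submod cga :=
  sub_span (fun x => exists2 s, P s & x = monom s).

Lemma mspan_monom (P : seq X -> Prop) s : P s -> mspan P (monom s).
Proof. by move=> Ps; apply: sub_span_gen; exists s. Qed.

Lemma mspan_ind (P : seq X -> Prop) (Q : cga -> Prop) :
  Q 0 -> (forall a x y, Q x -> Q y -> Q (a *: x + y)) ->
  (forall s, P s -> Q (monom s)) -> forall x, mspan P x -> Q x.
Proof.
by move=> Q0 QL PQ; apply: sub_span_ind => // _ [s Ps ->]; apply: PQ.
Qed.

Lemma mspan_sub (P Q : seq X -> Prop) :
  (forall s, P s -> Q s) -> forall x, mspan P x -> mspan Q x.
Proof.
move=> PQ; apply: mspan_ind => [||s /PQ]; [exact: smem0 | exact: smemP |].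
exact: mspan_monom.
Qed.

Lemma mspan_mul (P Q R : seq X -> Prop) :
  (forall s s', P s -> Q s' -> R (s ++ s')) ->
  forall x y, mspan P x -> mspan Q y -> mspan R (x ** y).
Proof.
move=> PQR x y Px; move: y; apply: mspan_ind => [|a u v Su Sv|s' Qs'].
- by rewrite qmulr0; apply: smem0.
- by rewrite qmulDr -qscaleAr; apply: smemP.
move: x Px; apply: mspan_ind => [|a u v Su Sv|s Ps].
- by rewrite qmul0r; apply: smem0.
- by rewrite qmulDl -qscaleAl; apply: smemP.
by rewrite -monom_cat; apply: mspan_monom; apply: PQR.
Qed.

Lemma monom_cons x s : monom (x :: s) = gen x ** monom s.
Proof. exact: big_cons. Qed.
Lemma monom_nil : monom [::] = qone.
Proof. exact: big_nil. Qed.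
Lemma monom_seq1 x : monom [:: x] = gen x.
Proof. exact: big_seq1. Qed.

Lemma mspan_all x : mspan (fun=> True) x.
Proof.
rewrite -[x]reprK; elim: (repr x) => [y|||t|t IHt u IHu|t IHt u IHu|a t];
  rewrite ?cga_piE.
- by rewrite -/(gen y) -monom_seq1; apply: mspan_monom.
- exact: smem0.
- by rewrite -monom_nil; apply: mspan_monom.
- by move=> ?; rewrite -scaleN1r; apply: smemZ.
- exact: smemD.
- exact: (mspan_mul _ IHt IHu).
- by move=> ?; apply: smemZ.
Qed.

Lemma cga_ind (Q : cga -> Prop) :
  Q 0 -> (forall a x y, Q x -> Q y -> Q (a *: x + y)) ->
  Q qone -> (forall x y, Q y -> Q (gen x ** y)) -> forall y, Q y.
Proof.
move=> Q0 QL Q1 QM y; move: y (mspan_all y); apply: mspan_ind => // s _.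
by elim: s => [|x s IH]; rewrite ?monom_nil ?monom_cons //; apply: QM.
Qed.

Definition wt (w : X -> nat) (s : seq X) : nat := \sum_(x <- s) w x.

(* linear combinations of products v_1 ... v_k with |v_1| + ... + |v_k| = k *)
Definition homog (k : nat) : submod cga := mspan (fun s => wt dg s = k).

Lemma wt_nil w : wt w [::] = 0%N.
Proof. exact: big_nil. Qed.
Lemma wt_cons w x s : wt w (x :: s) = (w x + wt w s)%N.
Proof. exact: big_cons. Qed.
Lemma wt_cat w s s' : wt w (s ++ s') = (wt w s + wt w s')%N.
Proof. exact: big_cat. Qed.

Lemma homog1 : homog 0 qone.
Proof. by rewrite -monom_nil; apply: mspan_monom; rewrite wt_nil. Qed.

Lemma homog_gen x : homog (dg x) (gen x).
Proof.
by rewrite -monom_seq1; apply: mspan_monom; rewrite wt_cons wt_nil addn0.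
Qed.

Lemma homogM i j x y : homog i x -> homog j y -> homog (i + j) (x ** y).
Proof. by apply: mspan_mul => s s' <- <-; rewrite wt_cat. Qed.

Lemma gen_monom_comm z s :
  gen z ** monom s = (-1) ^+ (dg z * wt dg s) *: (monom s ** gen z).
Proof.
elim: s => [|u s IH].
  by rewrite monom_nil wt_nil muln0 qmulr1 qmul1r scale1r.
rewrite monom_cons wt_cons qmulA gen_comm -qscaleAl -qmulA IH -qscaleAr scalerA.
by rewrite qmulA -exprD -mulnDr.
Qed.

Lemma monom_comm s s' :
  monom s ** monom s' = (-1) ^+ (wt dg s * wt dg s') *: (monom s' ** monom s).
Proof.
elim: s => [|u s IH].
  by rewrite monom_nil wt_nil mul0n qmulr1 qmul1r scale1r.
rewrite monom_cons wt_cons -qmulA IH -qscaleAr qmulA gen_monom_comm.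
by rewrite -qscaleAl scalerA qmulA -exprD mulnDl addnC.
Qed.

Lemma homog_comm i j x y : homog i x -> homog j y ->
  x ** y = (-1) ^+ (i * j) *: (y ** x).
Proof.
move=> hx; move: y; apply: mspan_ind => [|a u v Su Sv|s' <-].
- by rewrite qmulr0 qmul0r scaler0.
- rewrite qmulDr qmulDl -qscaleAr Su Sv scalerDr -qscaleAl !scalerA.
  by rewrite [a * _]mulrC.
move: x hx; apply: mspan_ind => [|a u v Su Sv|s <-].
- by rewrite qmulr0 qmul0r scaler0.
- rewrite qmulDr qmulDl -qscaleAl Su Sv scalerDr -qscaleAr !scalerA.
  by rewrite [a * _]mulrC.
exact: monom_comm.
Qed.

Section Eval.
Variables (A : qalgType) (f : X -> A).

Fixpoint teval (t : term X) : A :=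
  match t with
  | Gen x => f x
  | TZero => 0
  | TOne => qone
  | TOpp t => - teval t
  | TAdd t u => teval t + teval u
  | TMul t u => teval t ** teval u
  | TScale a t => a *: teval t
  end.

Lemma teval_sum (J : Type) (r : seq J) (F : J -> term X) :
  teval (tsum [seq F j | j <- r]) = \sum_(j <- r) teval (F j).
Proof. by elim: r => [|j r /= ->]; rewrite ?big_nil ?big_cons. Qed.

Definition respects_rel : Prop :=
  (forall x y, f x ** f y = (-1) ^+ (dg x * dg y) *: (f y ** f x)) /\
  (forall t, rels t -> teval t = 0).

Definition cga_map (x : cga) : A := teval (repr x).

Hypothesis fP : respects_rel.

Lemma teval_cong t u : tcong t u -> teval t = teval u.
Proof.
case: fP => fC fR; elim=> //=.
- by move=> ? ? ? _ -> _ ->.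
- by move=> ? ? _ ->.
- by move=> ? ? ? ? _ -> _ ->.
- by move=> ? ? ? ? _ -> _ ->.
- by move=> ? ? ? _ ->.
- by move=> *; apply: addrA.
- by move=> *; apply: addrC.
- by move=> *; apply: add0r.
- by move=> *; apply: addNr.
- by move=> *; apply: qmulA.
- by move=> *; apply: qmul1r.
- by move=> *; apply: qmulr1.
- by move=> *; apply: qmulDl.
- by move=> *; apply: qmulDr.
- by move=> *; apply: scalerA.
- by move=> *; apply: scale1r.
- by move=> *; apply: scalerDr.
- by move=> *; apply: scalerDl.
- by move=> *; apply: qscaleAl.
- by move=> *; apply: qscaleAr.
Qed.

Lemma cga_mapE t : cga_map (\pi_cga t) = teval t.
Proof. exact/teval_cong/tcong_repr. Qed.

Lemma cga_map_gen x : cga_map (gen x) = f x.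
Proof. exact: cga_mapE. Qed.
Lemma cga_map0 : cga_map 0 = 0.
Proof. by rewrite -cga_piE cga_mapE. Qed.
Lemma cga_map1 : cga_map qone = qone.
Proof. by rewrite -cga_piE cga_mapE. Qed.
Lemma cga_mapD x y : cga_map (x + y) = cga_map x + cga_map y.
Proof. by rewrite -[x]reprK -[y]reprK -cga_piE !cga_mapE. Qed.
Lemma cga_mapM x y : cga_map (x ** y) = cga_map x ** cga_map y.
Proof. by rewrite -[x]reprK -[y]reprK -cga_piE !cga_mapE. Qed.
Lemma cga_mapZ a x : cga_map (a *: x) = a *: cga_map x.
Proof. by rewrite -[x]reprK -cga_piE !cga_mapE. Qed.
Lemma cga_map_linear : linear cga_map.
Proof. by move=> a x y; rewrite cga_mapD cga_mapZ. Qed.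

End Eval.

Definition grade_inv : cga -> cga := cga_map (fun x => (-1) ^+ dg x *: gen x).

Section Derivation.
Variable (f : X -> cga).

Fixpoint tder (t : term X) : cga :=
  match t with
  | Gen x => f x
  | TZero => 0
  | TOne => 0
  | TOpp t => - tder t
  | TAdd t u => tder t + tder u
  | TMul t u => tder t ** \pi_cga u + grade_inv (\pi_cga t) ** tder u
  | TScale a t => a *: tder t
  end.

(* the degree one derivation with value [f x] on the generator [x] *)
Definition cga_der (x : cga) : cga := tder (repr x).

Hypothesis inv_rel : forall t, rels t ->
  teval (fun x => (-1) ^+ dg x *: gen x) t = 0.

Lemma grade_invP : respects_rel (fun x => (-1) ^+ dg x *: gen x).
Proof.
split=> // x y; rewrite -!(qscaleAl, qscaleAr) gen_comm !scalerA.
by rewrite [in LHS]mulrC [in LHS](mulrC (_ ^+ dg x)).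
Qed.

Lemma grade_inv_homog k x : homog k x -> grade_inv x = (-1) ^+ k *: x.
Proof.
move: x; apply: mspan_ind => [|a u v Su Sv|s <-].
- by rewrite /grade_inv (cga_map0 grade_invP) scaler0.
- rewrite /grade_inv (cga_map_linear grade_invP) -!/(grade_inv _) Su Sv.
  by rewrite scalerDr !scalerA mulrC.
elim: s => [|y s IH].
  by rewrite monom_nil wt_nil scale1r /grade_inv (cga_map1 grade_invP).
rewrite monom_cons wt_cons /grade_inv (cga_mapM grade_invP) -!/(grade_inv _) IH.
rewrite /grade_inv (cga_map_gen grade_invP).
by rewrite -qscaleAl -qscaleAr scalerA -exprD.
Qed.

Hypothesis f_deg : forall x, homog (dg x).+1 (f x).
Hypothesis f_rel : forall t, rels t -> tder t = 0.

Lemma tder_cong t u : tcong t u -> tder t = tder u.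
Proof.
have iD x y : grade_inv (x + y) = grade_inv x + grade_inv y.
  exact: (cga_mapD grade_invP).
have iM x y : grade_inv (x ** y) = grade_inv x ** grade_inv y.
  exact: (cga_mapM grade_invP).
have iZ a x : grade_inv (a *: x) = a *: grade_inv x.
  exact: (cga_mapZ grade_invP).
have i1 : grade_inv qone = qone by exact: (cga_map1 grade_invP).
elim=> //=.
- by move=> ? ? ? _ -> _ ->.
- by move=> ? ? _ ->.
- by move=> ? ? ? ? _ -> _ ->.
- by move=> ? ? ? ? /cga_eqP -> -> /cga_eqP -> ->.
- by move=> ? ? ? _ ->.
- by move=> *; apply: addrA.
- by move=> *; apply: addrC.
- by move=> *; apply: add0r.
- by move=> *; apply: addNr.
- move=> {}t {}u v; rewrite !cga_piE iM !qmulDr qmulDl !qmulA addrA.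
  by [].
- by move=> *; rewrite cga_piE i1 qmul0r add0r qmul1r.
- by move=> *; rewrite cga_piE qmulr1 qmulr0 addr0.
- by move=> *; rewrite !cga_piE iD !qmulDl addrACA.
- by move=> *; rewrite !cga_piE !qmulDr addrACA.
- by move=> *; apply: scalerA.
- by move=> *; apply: scale1r.
- by move=> *; apply: scalerDr.
- by move=> *; apply: scalerDl.
- by move=> *; rewrite !cga_piE iZ scalerDr !qscaleAl.
- by move=> *; rewrite !cga_piE scalerDr !qscaleAr.
move=> x y; rewrite -!/(gen _).
rewrite !(grade_inv_homog (homog_gen _)) scalerDr.
rewrite (homog_comm (f_deg x) (homog_gen y)) -!qscaleAl.
rewrite (homog_comm (homog_gen x) (f_deg y)) !scalerA addrC -!exprD.
congr (_ *: _ + _ *: _).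
  by rewrite mulnS addnA addnn exprD -mul2n exprM sqrrN expr1n mul1r.
by rewrite mulSn addnC.
Qed.

Lemma cga_derE t : cga_der (\pi_cga t) = tder t.
Proof. exact/tder_cong/tcong_repr. Qed.

Lemma cga_der_gen x : cga_der (gen x) = f x.
Proof. exact: cga_derE. Qed.
Lemma cga_der1 : cga_der qone = 0.
Proof. by rewrite -cga_piE cga_derE. Qed.
Lemma cga_der_linear : linear cga_der.
Proof.
by move=> a x y; rewrite -[x]reprK -[y]reprK -!cga_piE !cga_derE.
Qed.
Lemma cga_derM_inv x y :
  cga_der (x ** y) = cga_der x ** y + grade_inv x ** cga_der y.
Proof. by rewrite -[x]reprK -[y]reprK -cga_piE !cga_derE. Qed.
Lemma cga_derM k x y : homog k x ->
  cga_der (x ** y) = cga_der x ** y + (-1) ^+ k *: (x ** cga_der y).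
Proof. by move=> hx; rewrite cga_derM_inv (grade_inv_homog hx) -qscaleAl. Qed.

Lemma cga_der_homog k x : homog k x -> homog k.+1 (cga_der x).
Proof.
have der0 : cga_der 0 = 0 by rewrite -cga_piE cga_derE.
move: x; apply: mspan_ind => [|a u v Su Sv|s].
- by rewrite der0; apply: smem0.
- by rewrite cga_der_linear; apply: smemP.
elim: s k => [|y s IH] k.
  by move=> _; rewrite monom_nil cga_der1; apply: smem0.
rewrite monom_cons wt_cons => <-.
rewrite (cga_derM _ (homog_gen y)) cga_der_gen.
apply: smemD; first by rewrite -addSn; apply: homogM => //; apply: mspan_monom.
by apply: smemZ; rewrite -addnS; apply: homogM; [apply: homog_gen | apply: IH].
Qed.

End Derivation.

End Presentation.

(* An algebra with subspaces of homogeneous elements on which the axioms of a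
   CDGA hold.  The algebra may be larger than the sum of these subspaces (as a
   product of graded algebras is), so only homogeneous elements are part of the
   CDGA's defined from it below. *)
Record gdalg := Gdalg {
  gd_alg :> qalgType;
  gd_hom : nat -> submod gd_alg;
  gd_diff : {linear gd_alg -> gd_alg};
  gd_hom1 : gd_hom 0 qone;
  gd_homM : forall i j x y,
    gd_hom i x -> gd_hom j y -> gd_hom (i + j) (x ** y);
  gd_hom_diff : forall k x, gd_hom k x -> gd_hom k.+1 (gd_diff x);
  gd_comm : forall i j x y, gd_hom i x -> gd_hom j y ->
    x ** y = (-1) ^+ (i * j) *: (y ** x);
  gd_leibniz : forall i x y, gd_hom i x ->
    gd_diff (x ** y) = gd_diff x ** y + (-1) ^+ i *: (x ** gd_diff y);
  gd_diffK : forall x, gd_diff (gd_diff x) = 0 }.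

Section SubCochain.
Variables (A : gdalg) (S : submod A).
Hypothesis SD : forall x, S x -> S (gd_diff A x).

Definition sub_deg k : lmodType rat := subspace (sub_cap (gd_hom A k) S).

Fact sub_diff_subproof k (x : sub_deg k) :
  sub_cap (gd_hom A k.+1) S (gd_diff A (val x)).
Proof. by have [hx Sx] := subspaceP x; split; [apply: gd_hom_diff | apply: SD]. Qed.

Definition sub_diff k (x : sub_deg k) : sub_deg k.+1 :=
  in_subspace (sub_diff_subproof x).

Fact sub_diff_linear k : linear (@sub_diff k).
Proof. by move=> a x y; apply: val_inj; rewrite /= linearP. Qed.
HB.instance Definition _ k :=
  GRing.isLinear.Build rat _ _ _ (@sub_diff k) (@sub_diff_linear k).

Fact sub_diffK k (x : sub_deg k) : sub_diff (sub_diff x) = 0.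
Proof. by apply: val_inj; apply: gd_diffK. Qed.

Definition sub_cochain : cochain :=
  @Cochain sub_deg (fun k => @sub_diff k) sub_diffK.

End SubCochain.

Section SubIncl.
Variables (A : gdalg) (S T : submod A).
Hypothesis ST : forall x, S x -> T x.

Fact sub_incl_subproof k (x : sub_deg S k) : sub_cap (gd_hom A k) T (val x).
Proof. by have [hx Sx] := subspaceP x; split=> //; apply: ST. Qed.

Definition sub_incl k (x : sub_deg S k) : sub_deg T k :=
  in_subspace (sub_incl_subproof x).

Fact sub_incl_linear k : linear (@sub_incl k).
Proof. by move=> a x y; apply: val_inj. Qed.
HB.instance Definition _ k :=
  GRing.isLinear.Build rat _ _ _ (@sub_incl k) (@sub_incl_linear k).

Variables (SD : forall x, S x -> S (gd_diff A x)).
Variables (TD : forall x, T x -> T (gd_diff A x)).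

Fact sub_incl_diff k (x : sub_deg S k) :
  sub_incl (sub_diff SD x) = sub_diff TD (sub_incl x).
Proof. exact: val_inj. Qed.

Definition sub_incl_map : cochain_map (sub_cochain SD) (sub_cochain TD) :=
  @CochainMap (sub_cochain SD) (sub_cochain TD) (fun k => @sub_incl k)
    sub_incl_diff.

End SubIncl.

Section SubMul.
Variables (A : gdalg) (S T U : submod A).
Hypothesis STU : forall i j x y, gd_hom A i x -> gd_hom A j y ->
  S x -> T y -> U (x ** y).

Fact sub_mul_subproof i j k (e : (i + j)%N = k)
    (x : sub_deg S i) (y : sub_deg T j) :
  sub_cap (gd_hom A k) U (val x ** val y).
Proof.
have [[hx Sx] [hy Ty]] := (subspaceP x, subspaceP y).
by split; [rewrite -e; apply: gd_homM | apply: STU hx hy _ _].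
Qed.

Definition sub_mul i j k (e : (i + j)%N = k) x y : sub_deg U k :=
  in_subspace (sub_mul_subproof e x y).

End SubMul.

Fact sub_one_subproof (A : gdalg) (S : submod A) (S1 : S qone) :
  sub_cap (gd_hom A 0) S qone.
Proof. by split=> //; apply: gd_hom1. Qed.

Definition sub_one (A : gdalg) (S : submod A) (S1 : S qone) : sub_deg S 0 :=
  in_subspace (sub_one_subproof S1).

Section SubCdga.
Variables (A : gdalg) (S : submod A).
Hypothesis S1 : S qone.
Hypothesis SM : forall i j x y, gd_hom A i x -> gd_hom A j y ->
  S x -> S y -> S (x ** y).
Hypothesis SD : forall x, S x -> S (gd_diff A x).

Definition sub_cdga : cdga.
Proof.
refine (@Cdga (sub_cochain SD) (sub_one S1) (sub_mul SM) _ _ _ _ _ _).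
- by move=> *; apply: val_inj; rewrite /= qmulDl qscaleAl.
- by move=> *; apply: val_inj; rewrite /= qmulDr qscaleAr.
- by move=> *; apply: val_inj; rewrite /= qmulA.
- by move=> *; apply: val_inj; rewrite /= qmul1r.
- move=> i j k e e' x y; apply: val_inj => /=.
  by have [[hx _] [hy _]] := (subspaceP x, subspaceP y); apply: gd_comm.
- move=> i j k e e1 e2 x y; apply: val_inj => /=.
  by have [hx _] := subspaceP x; apply: gd_leibniz.
Defined.

End SubCdga.

Section SubPerverse.
Variables (n : nat) (A : gdalg) (S : perv n -> submod A).
Hypothesis S_le : forall p q, perv_le p q -> forall x, S p x -> S q x.
Hypothesis S1 : S (perv0 n) qone.
Hypothesis SM : forall p q r, perv_add_le p q r -> forall i j x y,
  gd_hom A i x -> gd_hom A j y -> S p x -> S q y -> S r (x ** y).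
Hypothesis SD : forall p x, S p x -> S p (gd_diff A x).

Definition sub_perverse : perverse_cdga n.
Proof.
refine (@PerverseCdga n (fun p => sub_cochain (SD (p := p)))
  (fun p q h => sub_incl_map (S_le h) (SD (p := p)) (SD (p := q))) _ _
  (sub_one S1) (fun p q r h => sub_mul (SM h)) _ _ _ _ _ _ _).
- by move=> *; apply: val_inj.
- by move=> *; apply: val_inj.
- by move=> *; apply: val_inj.
- by move=> *; apply: val_inj; rewrite /= qmulDl qscaleAl.
- by move=> *; apply: val_inj; rewrite /= qmulDr qscaleAr.
- by move=> *; apply: val_inj; rewrite /= qmulA.
- by move=> *; apply: val_inj; rewrite /= qmul1r.
- move=> p q r h h' i j k e e' x y; apply: val_inj => /=.
  by have [[hx _] [hy _]] := (subspaceP x, subspaceP y); apply: gd_comm.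
- move=> p q r h i j k e e1 e2 x y; apply: val_inj => /=.
  by have [hx _] := subspaceP x; apply: gd_leibniz.
Defined.

End SubPerverse.

Section FamilyGdalg.
Variables (I : Type) (A : I -> gdalg).

Definition fam_hom (k : nat) : submod (family A).
Proof.
exists (fun w => forall i, gd_hom (A i) k (w i)) => [i|a x y hx hy i].
  exact: smem0.
exact: smemP.
Defined.

Definition fam_diff (w : family A) : family A := fun i => gd_diff (A i) (w i).

Fact fam_diff_linear : linear fam_diff.
Proof.
by move=> a x y; apply: functional_extensionality_dep => i; apply: linearP.
Qed.
HB.instance Definition _ :=
  GRing.isLinear.Build rat (family A) (family A) _ fam_diff fam_diff_linear.

Definition fam_gdalg : gdalg.
Proof.
refine (@Gdalg (family A) fam_hom fam_diff _ _ _ _ _ _).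
- by move=> i; apply: gd_hom1.
- by move=> i j x y hx hy t; apply: gd_homM.
- by move=> k x hx t; apply: gd_hom_diff.
- move=> i j x y hx hy; apply: functional_extensionality_dep => t.
  exact: gd_comm.
- move=> i x y hx; apply: functional_extensionality_dep => t.
  exact: gd_leibniz.
- by move=> x; apply: functional_extensionality_dep => t; apply: gd_diffK.
Defined.

End FamilyGdalg.

Section FreeCGA.
Variables (J : Type) (dgJ : J -> nat) (V : J -> lmodType rat).

Definition fgen : Type := {j : J & V j}.
Definition fdeg (g : fgen) : nat := dgJ (tag g).

Inductive flin : term fgen -> Prop :=
| Flin j a (v w : V j) : flin
    (TAdd (Gen (Tagged V (a *: v + w)))
       (TOpp (TAdd (TScale a (Gen (Tagged V v))) (Gen (Tagged V w))))).

(* The free CGA on the direct sum of the V j, with V j in degree dgJ j: one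
   generator for each vector, subject to linearity. *)
Definition free_cga : Type := cga fdeg flin.
HB.instance Definition _ := QAlgebra.on free_cga.

Definition fvec j (v : V j) : free_cga := gen fdeg flin (Tagged V v).

Record differential := Differential {
  dfun :> {linear free_cga -> free_cga};
  dfun_deg : forall k (x : free_cga),
    homog fdeg flin k x -> homog fdeg flin k.+1 (dfun x);
  dfun_leibniz : forall k (x y : free_cga), homog fdeg flin k x ->
    dfun (x ** y) = dfun x ** y + (-1) ^+ k *: (x ** dfun y);
  dfun_K : forall x, dfun (dfun x) = 0 }.

Definition free_gdalg (d : differential) : gdalg :=
  @Gdalg free_cga (homog fdeg flin) d (homog1 fdeg flin)
    (fun _ _ _ _ => @homogM _ _ _ _ _ _ _) (@dfun_deg d)
    (fun _ _ _ _ => @homog_comm _ _ _ _ _ _ _) (@dfun_leibniz d) (@dfun_K d).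

Definition sub_full (W : lmodType rat) : submod W :=
  @Submod W (fun=> True) I (fun _ _ _ _ _ => I).

Definition free_cdga (d : differential) : cdga :=
  @sub_cdga (free_gdalg d) (sub_full _) I (fun _ _ _ _ _ _ _ _ => I)
    (fun _ _ => I).

End FreeCGA.

Definition free_incl (J0 J : Type) (h : J0 -> J) (dgJ : J -> nat)
    (V : J -> lmodType rat) :
    free_cga (dgJ \o h) (V \o h) -> free_cga dgJ V :=
  cga_map (fun g : fgen (V \o h) => fvec dgJ (tagged g : V (h (tag g)))).

Lemma free_incl_respects (J0 J : Type) (h : J0 -> J) (dgJ : J -> nat)
    (V : J -> lmodType rat) :
  respects_rel (fdeg (dgJ \o h) (V := V \o h)) (@flin _ (V \o h))
    (fun g : fgen (V \o h) => fvec dgJ (tagged g : V (h (tag g)))).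
Proof.
split=> [x y|_ [j a v w] /=]; first exact: gen_comm.
have := cga_rel (fdeg dgJ (V := V)) (@Flin J V (h j) a v w).
by rewrite !cga_piE.
Qed.

(* Sullivan minimal algebras: V lives in degrees >= 1, has an exhausting
   filtration with d V(0) = 0 and d V(k+1) contained in the algebra generated
   by V(k), and d is decomposable. *)
Definition sullivan_minimal (V : nat -> lmodType rat) (d : differential id V) :
    Prop :=
  (forall v : V 0, v = 0) /\
  (exists F : nat -> forall m, submod (V m),
     [/\ forall k m v, F k m v -> F k.+1 m v,
         forall m v, exists k, F k m v,
         forall m v, F 0 m v -> d (fvec id v) = 0 &
         forall k m v, F k.+1 m v ->
           mspan (fdeg id (V := V)) (@flin _ V)
             (List.Forall (fun g => F k (tag g) (tagged g))) (d (fvec id v))]) /\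
  (forall m (v : V m),
     mspan (fdeg id (V := V)) (@flin _ V) (fun s => 2 <= size s)%N
       (d (fvec id v))).

Definition is_minimal_model (V : nat -> lmodType rat) (d : differential id V)
    (A : cdga) : Prop :=
  sullivan_minimal d /\
  exists f : cdga_map (free_cdga d) A, quasi_iso f.

Section PerverseModel.
Variable n : nat.

Definition pdeg (j : perv n * nat) : nat := j.2.

Variable V : perv n * nat -> lmodType rat.
Local Notation gens := (fgen V).
Local Notation B := (free_cga pdeg V).
Local Notation span := (mspan (fdeg pdeg (V := V)) (@flin _ V)).

(* products v_1 ... v_k with p_1 + ... + p_k <= p *)
Definition perv_bound (p : perv n) (s : seq gens) : Prop :=
  perv_sum_le [seq (tag g).1 | g <- s] p.

Definition perv_part (p : perv n) : submod B := span (perv_bound p).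

Lemma perv_part_le p q : perv_le p q -> forall x, perv_part p x -> perv_part q x.
Proof.
move=> pq; apply: mspan_sub => s /forallP h; apply/forallP => i.
exact: le_trans (h i) (perv_leE pq i).
Qed.

Lemma perv_part1 : perv_part (perv0 n) qone.
Proof.
rewrite -(@monom_nil _ (fdeg pdeg (V := V)) (@flin _ V)); apply: mspan_monom.
by apply/forallP => i; rewrite big_nil; apply: perv_val_ge0.
Qed.

Lemma perv_partM p q r : perv_add_le p q r ->
  forall x y, perv_part p x -> perv_part q y -> perv_part r (x ** y).
Proof.
move=> pqr; apply: mspan_mul => s s' /forallP hs /forallP hs'.
apply/forallP => i; rewrite map_cat big_cat.
exact: le_trans (leeD (hs i) (hs' i)) (perv_add_leE pqr i).
Qed.

(* Generators of perversity < p, or of perversity p and degree < m, or in the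
   subspace F of the generators of perversity p and degree m. *)
Definition lower_gen p m (F : submod (V (p, m))) (g : gens) : Prop :=
  perv_lt (tag g).1 p \/
  ((tag g).1 = p /\ ((tag g).2 < m)%N) \/
  exists2 v : V (p, m), F v & g = Tagged V v.

Record perverse_minimal (d : differential pdeg V) : Prop := PerverseMinimal {
  pm_part : forall p x, perv_part p x -> perv_part p (d x);
  pm_deg0 : forall p (v : V (p, 0)), v = 0;
  (* F p m i is V_[p](i-1)^m and W p m i is V_[p][i]^m *)
  pm_filtration : exists F W : forall p m, nat -> submod (V (p, m)),
    [/\ forall p m v, F p m 0 v <-> v = 0,
        forall p m i v, F p m i.+1 v <->
          exists x y, [/\ F p m i x, W p m i y & v = x + y],
        forall p m i v, F p m i v -> W p m i v -> v = 0,
        forall p m v, exists i, F p m i v &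
        forall p m i v, W p m i v ->
          span (fun s => List.Forall (lower_gen (F p m i)) s /\ perv_bound p s)
            (d (fvec pdeg v))] }.

(* V_[0], and the inclusion of its free CGA *)
Definition zero_part (m : nat) : lmodType rat := V (perv0 n, m).

Definition zero_incl : free_cga id zero_part -> B :=
  @free_incl _ _ (fun m => (perv0 n, m)) pdeg V.

Definition perverse_model (d : differential pdeg V) (dP : perverse_minimal d) :
    perverse_cdga n :=
  @sub_perverse n (free_gdalg d) perv_part perv_part_le perv_part1
    (fun p q r h _ _ x y _ _ => perv_partM h (x := x) (y := y)) (pm_part dP).

End PerverseModel.

Record incr (a b : nat) := Incr {
  incr_fun :> 'I_a -> 'I_b;
  incr_lt : forall x y : 'I_a, (x < y)%N -> (incr_fun x < incr_fun y)%N }.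

Lemma incr_ext a b (f g : incr a b) : (forall x, f x = g x) -> f = g.
Proof.
case: f g => [f fP] [g gP] /= fg; have {}fg : f = g by apply/funext.
by case: _ / fg gP => gP; congr Incr; apply: Prop_irrelevance.
Qed.

Definition incr_id a : incr a a := @Incr a a id (fun _ _ h => h).

Definition incr_comp a b c (f : incr a b) (g : incr b c) : incr a c :=
  @Incr a c (fun x => g (f x)) (fun _ _ h => incr_lt g (incr_lt f h)).

(* simplicial sets without degeneracies; [fs m] is the set of m-simplices *)
Record face_set := FaceSet {
  fs_simp :> nat -> Type;
  fs_face : forall k m, incr k.+1 m.+1 -> fs_simp m -> fs_simp k;
  fs_id : forall m (s : fs_simp m), fs_face (incr_id m.+1) s = s;
  fs_comp : forall k l m (f : incr k.+1 l.+1) (g : incr l.+1 m.+1)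
      (s : fs_simp m), fs_face (incr_comp f g) s = fs_face f (fs_face g s) }.

(* x <| x_1 |> x_2 <| ... <| x_m |> y *)
Inductive zigzag (T : Type) (R : T -> T -> Prop) : T -> T -> Prop :=
| zigzag1 x x1 y : R x x1 -> R y x1 -> zigzag R x y
| zigzag2 x x1 x2 y : R x x1 -> R x2 x1 -> zigzag R x2 y -> zigzag R x y.

Definition fs_simplices (T : face_set) : Type := {m : nat & T m}.

Definition fs_le (T : face_set) (s t : fs_simplices T) : Prop :=
  exists f : incr (tag s).+1 (tag t).+1, fs_face f (tagged t) = tagged s.

Definition fs_connected (T : face_set) : Prop :=
  inhabited (fs_simplices T) /\
  forall s t : fs_simplices T, zigzag (@fs_le T) s t.

Section SubFaceSet.
Variables (T : face_set) (P : forall m, T m -> Prop).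
Hypothesis PF : forall k m (f : incr k.+1 m.+1) (s : T m), P s -> P (fs_face f s).

Definition sub_face_set : face_set.
Proof.
refine (@FaceSet (fun m => {s : T m | P s})
  (fun k m f s => exist _ (fs_face f (sval s)) (PF f (proj2_sig s))) _ _).
- by move=> m [s Ps]; apply: eq_exist; apply: fs_id.
- by move=> k l m f g [s Ps]; apply: eq_exist; apply: fs_comp.
Defined.

End SubFaceSet.

(* The i-th component of a morphism from Delta^(u 0 - 1) * ... *
   Delta^(u (r-1) - 1) to Delta^(w 0 - 1) * ... is a strictly increasing map
   between the u i and the w i vertices of the i-th factors; if u i = 0 it is
   the empty map. *)
Definition mor r (u w : 'I_r -> nat) : Type := forall i, incr (u i) (w i).

Definition mor_id r (u : 'I_r -> nat) : mor u u := fun i => incr_id (u i).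

Definition mor_comp r (u v w : 'I_r -> nat) (f : mor u v) (g : mor v w) :
  mor u w := fun i => incr_comp (f i) (g i).

Lemma mor_ext r (u w : 'I_r -> nat) (f g : mor u w) :
  (forall i x, f i x = g i x) -> f = g.
Proof.
move=> fg; apply: functional_extensionality_dep => i.
by apply: incr_ext; apply: fg.
Qed.

(* the join with i-th factor Delta^(jv i - 1) *)
Record join_obj (n : nat) := JoinObj {
  jv :> 'I_n.+1 -> nat;
  jv_neq0 : exists i, (0 < jv i)%N }.

Record filtered_face_set (n : nat) := FilteredFaceSet {
  ff_simp :> join_obj n -> Type;
  ff_face : forall v w : join_obj n, mor v w -> ff_simp w -> ff_simp v;
  ff_id : forall v (s : ff_simp v), ff_face (mor_id v) s = s;
  ff_comp : forall (u v w : join_obj n) (f : mor u v) (g : mor v w)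
      (s : ff_simp w), ff_face (mor_comp f g) s = ff_face f (ff_face g s) }.

Section FilteredFaceSets.
Variables (n : nat) (K : filtered_face_set n).

(* the simplices of type v are in K_+ *)
Definition regular_obj (v : join_obj n) : Prop := (0 < v ord_max)%N.

(* The join with m+1 vertices in which vertex a belongs to the factor of index
   c a. *)
Definition join_of m (c : 'I_m.+1 -> 'I_n.+1) : join_obj n.
Proof.
exists (fun i => #|[pred a | c a == i]|); exists (c ord0).
by apply/card_gt0P; exists ord0; rewrite inE.
Defined.

Fact join_of_face_subproof k m (f : incr k.+1 m.+1) (c : 'I_m.+1 -> 'I_n.+1) i
    (x : 'I_#|[pred a | c (f a) == i]|) :
  f (enum_val x) \in [pred a | c a == i].
Proof. by have := enum_valP x; rewrite !inE. Qed.

Definition join_of_face_fun k m (f : incr k.+1 m.+1) (c : 'I_m.+1 -> 'I_n.+1) i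
    (x : 'I_#|[pred a | c (f a) == i]|) : 'I_#|[pred a | c a == i]| :=
  enum_rank_in (join_of_face_subproof x) (f (enum_val x)).

Lemma enum_val_join_of_face k m (f : incr k.+1 m.+1) (c : 'I_m.+1 -> 'I_n.+1) i
    (x : 'I_#|[pred a | c (f a) == i]|) :
  enum_val (join_of_face_fun x) = f (enum_val x).
Proof. by rewrite enum_rankK_in //; apply: join_of_face_subproof. Qed.

Lemma enum_val_ltn m (A : {pred 'I_m}) (x y : 'I_#|A|) :
  (enum_val x < enum_val y)%N = (x < y)%N.
Proof.
have lt_sorted : sorted (fun a b : 'I_m => a < b)%N (enum A).
  rewrite /enum_mem; apply: sorted_filter => [a b c|]; first exact: ltn_trans.
  rewrite -enumT; have := iota_ltn_sorted 0 m.
  by rewrite -val_enum_ord sorted_map.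
have mono (a b : 'I_#|A|) : (a < b)%N -> (enum_val a < enum_val b)%N.
  move=> ab; rewrite (enum_val_nth (enum_val a) a) (enum_val_nth (enum_val a) b).
  apply: (sorted_ltn_nth (leT := fun a b : 'I_m => (a < b)%N)) => //.
  - exact: ltn_trans.
  - by rewrite inE -cardE.
  - by rewrite inE -cardE.
case: (ltngtP x y) => [/mono -> //|/mono /ltnW|/val_inj ->].
  by rewrite leqNgt => /negbTE.
exact: ltnn.
Qed.

Definition join_of_face k m (f : incr k.+1 m.+1) (c : 'I_m.+1 -> 'I_n.+1) :
  mor (join_of (fun a => c (f a))) (join_of c).
Proof.
move=> i; exists (@join_of_face_fun k m f c i) => x y xy.
by rewrite -enum_val_ltn !enum_val_join_of_face; apply: incr_lt; rewrite enum_val_ltn.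
Defined.

(* An m-simplex is a simplex of K whose join has m+1 vertices; numbering these
   in the order of the join, [as_factor] sends a vertex to the index of its
   factor. *)
Record assoc_simplex (m : nat) := AssocSimplex {
  as_factor : 'I_m.+1 -> 'I_n.+1;
  as_simp : K (join_of as_factor);
  as_mono : forall x y : 'I_m.+1, (x <= y)%N -> (as_factor x <= as_factor y)%N }.

Lemma incr_le a b (f : incr a b) (x y : 'I_a) : (x <= y)%N -> (f x <= f y)%N.
Proof.
by rewrite leq_eqVlt => /predU1P[/val_inj -> //|/(incr_lt f)]; apply: ltnW.
Qed.

Definition assoc_face k m (f : incr k.+1 m.+1) (s : assoc_simplex m) :
    assoc_simplex k :=
  @AssocSimplex k (fun a => as_factor s (f a))
    (ff_face (join_of_face f (as_factor s)) (as_simp s))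
    (fun _ _ h => as_mono s (incr_le f h)).

Definition assoc : face_set.
Proof.
refine (@FaceSet assoc_simplex assoc_face _ _) => [m|k l m f g] [c s cP].
  rewrite /assoc_face /=.
  have -> : join_of_face (incr_id m.+1) c = mor_id (join_of c).
    apply: mor_ext => i x; apply: enum_val_inj.
    by rewrite enum_val_join_of_face.
  by rewrite ff_id; congr AssocSimplex; apply: Prop_irrelevance.
rewrite /assoc_face /= -ff_comp; congr AssocSimplex; last exact: Prop_irrelevance.
congr (ff_face _ s); apply: mor_ext => i x; apply: enum_val_inj.
by rewrite !enum_val_join_of_face.
Defined.

(* the regular part K^[0] *)
Definition regular_part : face_set :=
  @sub_face_set assoc (fun m s => forall a, as_factor s a = ord_max)
    (fun k m f s h a => h (f a)).

Definition ff_connected : Prop := fs_connected regular_part.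

Record coface (v : join_obj n) (s : K v) := Coface {
  cf_obj : join_obj n;
  cf_incl : mor v cf_obj;
  cf_simp : K cf_obj;
  cf_face : ff_face cf_incl cf_simp = s;
  cf_regular : regular_obj cf_obj }.

Definition coface_le v (s : K v) (x y : coface s) : Prop :=
  exists2 f : mor (cf_obj x) (cf_obj y),
    ff_face f (cf_simp y) = cf_simp x & mor_comp (cf_incl x) f = cf_incl y.

(* Every simplex s outside K_+ has a coface in K_+, and any two of them are
   related by a zigzag of simplices of K_+ having s as a face.  A simplex may be
   a face of another one in several ways; the cofaces come with an inclusion of
   s and the zigzags are compatible with these inclusions.  If the inclusions
   were forgotten, the following K (n = 1) would be normal although the link of
   s is disconnected: Delta^1 * Delta^0 with the two vertices of Delta^1
   identified to one vertex s, all other faces remaining distinct. *)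
Definition ff_normal : Prop :=
  (forall v (s : K v), ~ regular_obj v -> inhabited (coface s)) /\
  (forall v (s : K v), ~ regular_obj v ->
     forall x y : coface s, zigzag (@coface_le v s) x y).

End FilteredFaceSets.

Section Forms.
Variables (r : nat) (u : 'I_r -> nat).

Definition vert : Type := {i : 'I_r & 'I_(u i)}.

(* (a, false) is t_a and (a, true) is dt_a *)
Definition form_gen : Type := (vert * bool)%type.
Definition form_deg (g : form_gen) : nat := g.2.

Definition form_vert (b : bool) i (a : 'I_(u i)) : form_gen :=
  (Tagged (fun i => 'I_(u i)) a, b).

Inductive form_rel : term form_gen -> Prop :=
| form_rel_t i : form_rel
    (TAdd (tsum [seq Gen (form_vert false a) | a <- enum 'I_(u i)]) (TOpp TOne))
| form_rel_dt i : form_rel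
    (tsum [seq Gen (form_vert true a) | a <- enum 'I_(u i)]).

(* A_PL(Delta^(u 0 - 1)) (x) ... (x) A_PL(Delta^(u (r-1) - 1)): the tensor
   product of CGA's is presented by the generators and relations of all the
   factors. *)
Definition forms : Type := cga form_deg form_rel.
HB.instance Definition _ := QAlgebra.on forms.

Definition fg b i (a : 'I_(u i)) : forms := gen form_deg form_rel (form_vert b a).

Lemma forms_rel (b : bool) i : \sum_(a : 'I_(u i)) fg b a = if b then 0 else qone.
Proof.
have piS (s : seq 'I_(u i)) :
    \pi_(cga form_deg form_rel) (tsum [seq Gen (form_vert b a) | a <- s]) =
    \sum_(a <- s) fg b a.
  by elim: s => [|a s IH]; rewrite ?big_nil ?big_cons //= cga_piE IH.
rewrite -big_enum -piS; case: b piS => piS.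
  by apply: cga_rel; apply: form_rel_dt.
have := cga_rel form_deg (form_rel_t i); rewrite !cga_piE => /eqP.
by rewrite subr_eq0 => /eqP.
Qed.

Definition form_der_gen (g : form_gen) : forms :=
  if g.2 then 0 else gen form_deg form_rel (g.1, true).

(* d t_a = dt_a and d dt_a = 0 *)
Definition form_diff : forms -> forms := cga_der (rels := form_rel) form_der_gen.

Fact form_inv_rel t : form_rel t ->
  teval (fun g => (-1) ^+ form_deg g *: gen form_deg form_rel g) t = 0.
Proof.
case=> i /=; rewrite teval_sum big_enum /=.
  rewrite (eq_bigr (fun a => fg false a)) => [|a _]; last by rewrite /= scale1r.
  by rewrite forms_rel subrr.
rewrite (eq_bigr (fun a => - fg true a)) => [|a _]; last first.
  by rewrite /= expr1 scaleN1r.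
by rewrite sumrN forms_rel oppr0.
Qed.

Fact form_der_deg g : homog form_deg form_rel (form_deg g).+1 (form_der_gen g).
Proof.
case: g => a []; first exact: (smem0 (homog form_deg form_rel 2)).
exact: (homog_gen form_deg form_rel (a, true)).
Qed.

Fact tder_sum (J : Type) (s : seq J) (F : J -> form_gen) :
  tder form_der_gen (tsum [seq Gen (F j) | j <- s]) =
  \sum_(j <- s) form_der_gen (F j).
Proof. by elim: s => [|j s /= ->]; rewrite ?big_nil ?big_cons. Qed.

Fact form_der_rel t : form_rel t -> tder form_der_gen t = 0.
Proof.
case=> i /=; rewrite tder_sum big_enum /= /form_der_gen /=.
  by rewrite oppr0 addr0 (forms_rel true).
by rewrite big1.
Qed.

Fact form_diff_linear : linear form_diff.
Proof. exact: cga_der_linear form_inv_rel form_der_deg form_der_rel. Qed.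
HB.instance Definition _ :=
  GRing.isLinear.Build rat forms forms _ form_diff form_diff_linear.

Fact form_diff_gen g : form_diff (gen form_deg form_rel g) = form_der_gen g.
Proof. exact: cga_der_gen form_inv_rel form_der_deg form_der_rel g. Qed.

Fact form_diff_fg b i (a : 'I_(u i)) :
  form_diff (fg b a) = if b then 0 else fg true a.
Proof. exact: form_diff_gen. Qed.

Fact form_diff1 : form_diff qone = 0.
Proof. exact: cga_der1 form_inv_rel form_der_deg form_der_rel. Qed.

Fact form_diff0 : form_diff 0 = 0.
Proof. exact: linear0 form_diff. Qed.

Fact form_diffM k x y : homog form_deg form_rel k x ->
  form_diff (x ** y) = form_diff x ** y + (-1) ^+ k *: (x ** form_diff y).
Proof. exact: (cga_derM form_inv_rel form_der_deg form_der_rel). Qed.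

Fact form_diff_homog k x : homog form_deg form_rel k x ->
  homog form_deg form_rel k.+1 (form_diff x).
Proof. exact: (cga_der_homog form_inv_rel form_der_deg form_der_rel). Qed.

Fact form_diffK x : form_diff (form_diff x) = 0.
Proof.
move: x; apply: cga_ind => [|a x y hx hy||g x hx].
- by rewrite !form_diff0.
- by rewrite !form_diff_linear hx hy scaler0 addr0.
- by rewrite form_diff1 form_diff0.
have ddg : form_diff (form_der_gen g) = 0.
  rewrite /form_der_gen; case: ifP => _; first exact: form_diff0.
  by rewrite form_diff_gen.
have hg := homog_gen form_deg form_rel g; have hdg := form_der_deg g.
rewrite (form_diffM _ hg) form_diff_gen addrC form_diff_linear.
rewrite (form_diffM _ hg) (form_diffM _ hdg) hx ddg form_diff_gen.
rewrite qmul0r qmulr0 add0r scaler0 addr0 exprS mulN1r scaleNr.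
exact: subrr.
Qed.

Definition forms_gdalg : gdalg :=
  @Gdalg forms (homog form_deg form_rel) form_diff (homog1 _ _)
    (fun _ _ _ _ => @homogM _ _ _ _ _ _ _)
    form_diff_homog (fun _ _ _ _ => @homog_comm _ _ _ _ _ _ _)
    form_diffM form_diffK.

End Forms.

Section Pullback.
Variables (r : nat) (u w : 'I_r -> nat) (f : mor u w).

Definition pull_gen (g : form_gen w) : forms u :=
  \sum_(a : 'I_(u (tag g.1)) | f (tag g.1) a == tagged g.1) fg g.2 a.

(* t_b is sent to t_a if b = f a, and to 0 if b is not in the image of f *)
Definition pull : forms w -> forms u := cga_map pull_gen.

Fact pull_gen_homog g : homog (@form_deg r u) (@form_rel r u) (form_deg g) (pull_gen g).
Proof.
rewrite /pull_gen; elim/big_rec: _ => [|a x _ hx]; first exact: smem0.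
by apply: smemD hx; apply: (homog_gen _ _ (form_vert g.2 a)).
Qed.

Fact pull_respects : respects_rel (@form_deg r w) (@form_rel r w) pull_gen.
Proof.
split=> [x y|t]; first exact: homog_comm (pull_gen_homog x) (pull_gen_homog y).
have sumE b i : \sum_(a : 'I_(w i)) pull_gen (form_vert b a : form_gen w) =
    \sum_(a : 'I_(u i)) fg b a.
  by rewrite [RHS](partition_big (f i) predT).
by case=> i /=; rewrite teval_sum big_enum /= sumE forms_rel ?subrr.
Qed.

Lemma pull0 : pull 0 = 0. Proof. exact: cga_map0 pull_respects. Qed.
Lemma pull1 : pull qone = qone. Proof. exact: cga_map1 pull_respects. Qed.
Lemma pullM x y : pull (x ** y) = pull x ** pull y.
Proof. exact: cga_mapM pull_respects x y. Qed.
Lemma pull_linear : linear pull.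
Proof. exact: cga_map_linear pull_respects. Qed.
Lemma pull_genE g : pull (gen (@form_deg r w) (@form_rel r w) g) = pull_gen g.
Proof. exact: cga_map_gen pull_respects g. Qed.

Lemma pull_diff x : pull (form_diff x) = form_diff (pull x).
Proof.
have dgen g : form_diff (pull_gen g) = pull (form_der_gen g).
  rewrite /pull_gen (raddf_sum (@form_diff r u)) /form_der_gen; case: ifP => [g2|g2].
    rewrite pull0 big1 // => a _.
    exact: form_diff_fg.
  rewrite pull_genE; apply: eq_bigr => a _.
  exact: form_diff_fg.
move: x; apply: cga_ind => [|a x y hx hy||g x hx].
- by rewrite form_diff0 pull0 form_diff0.
- by rewrite form_diff_linear !pull_linear form_diff_linear hx hy.
- by rewrite form_diff1 pull1 form_diff1 pull0.
rewrite (form_diffM _ (homog_gen _ _ g)) addrC pull_linear !pullM.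
rewrite form_diff_gen pull_genE (form_diffM _ (pull_gen_homog g)) dgen hx.
exact: addrC.
Qed.

End Pullback.

Section Components.
Variables (r : nat) (u : 'I_r -> nat) (c : pred 'I_r).

Definition comp_wt (g : form_gen u) : nat := c (tag g.1) && g.2.

Definition pser_mono (A : qalgType) (d : nat) (x : A) : pser A :=
  fun k => if k == d then x else 0.

Definition comp_gen (g : form_gen u) : pser (forms u) :=
  pser_mono (comp_wt g) (gen (@form_deg r u) (@form_rel r u) g).

(* The component of degree d in the tensor factors of index in c, a form being
   split by means of the algebra map t_a |-> t_a, dt_a |-> dt_a T (for a in a
   factor of index in c), dt_a |-> dt_a (otherwise) to power series in T. *)
Definition component (d : nat) (x : forms u) : forms u := cga_map comp_gen x d.

Fact pser_monoM (A : qalgType) d e (x y : A) :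
  pser_mono d x ** pser_mono e y = pser_mono (d + e) (x ** y).
Proof.
apply/funext => k; rewrite /qmul /= /pser_mul /pser_mono.
under eq_bigr => i _ do rewrite (fun_if (fun z => z ** _)) qmul0r.
rewrite -big_mkcond /=; case: (ltnP d k.+1) => [dk|kd].
  rewrite (big_pred1 (Ordinal dk)) //= -(eqn_add2l d) subnKC //.
  by case: ifP; rewrite ?qmulr0.
rewrite big_pred0 => [|i]; last first.
  by apply/negbTE; rewrite neq_ltn (leq_trans (ltn_ord i)).
by rewrite ifN // neq_ltn (leq_trans kd) ?leq_addr.
Qed.

Fact pser_monoZ (A : qalgType) d a (x : A) :
  a *: pser_mono d x = pser_mono d (a *: x).
Proof.
by apply/funext => k; rewrite /GRing.scale /= /pser_mono; case: ifP; rewrite ?scaler0.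
Qed.

Fact pser_mono_sum (A : qalgType) (J : Type) (s : seq J) (F : J -> A) d :
  \sum_(j <- s) pser_mono d (F j) = pser_mono d (\sum_(j <- s) F j).
Proof.
elim: s => [|j s IH]; rewrite ?big_nil ?big_cons.
  by apply/funext => k; rewrite /pser_mono; case: ifP.
rewrite IH; apply/funext => k; rewrite /GRing.add /= /pser_mono.
by case: ifP; rewrite ?addr0.
Qed.

Fact comp_respects : respects_rel (@form_deg r u) (@form_rel r u) comp_gen.
Proof.
have mono0 d : pser_mono d 0 = 0 :> pser (forms u).
  by apply/funext => k; rewrite /pser_mono; case: ifP.
split=> [x y|t]; first by rewrite !pser_monoM addnC gen_comm pser_monoZ.
case=> i /=; rewrite teval_sum big_enum /= /comp_gen /comp_wt /=.
  rewrite andbF pser_mono_sum -/(fg _ _) (forms_rel _ false).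
  exact: subrr.
by rewrite pser_mono_sum (forms_rel _ true) mono0.
Qed.

Lemma component_linear d : linear (component d).
Proof.
by move=> a x y; rewrite /component (cga_map_linear comp_respects).
Qed.

Lemma component0 d : component d 0 = 0.
Proof. by rewrite /component (cga_map0 comp_respects). Qed.

Lemma component1 d : component d qone = if d == 0%N then qone else 0.
Proof. by rewrite /component (cga_map1 comp_respects). Qed.

Lemma componentM d x y : component d (x ** y) =
  \sum_(i < d.+1) component i x ** component (d - i) y.
Proof. by rewrite /component (cga_mapM comp_respects). Qed.

End Components.

Section APL.
Variable T : face_set.

(* A_PL(Delta^m) *)
Definition simplex_forms (m : nat) : gdalg := forms_gdalg (fun _ : 'I_1 => m.+1).

Definition simplex_mor k m (f : incr k.+1 m.+1) :
  mor (fun _ : 'I_1 => k.+1) (fun _ : 'I_1 => m.+1) := fun=> f.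

Definition apl_families : gdalg :=
  fam_gdalg (fun s : fs_simplices T => simplex_forms (tag s)).

Definition apl_compatible : submod apl_families.
Proof.
exists (fun w => forall k m (f : incr k.+1 m.+1) (s : T m),
  w (Tagged T (fs_face f s)) = pull (simplex_mor f) (w (Tagged T s))) => [k m f s|].
  exact/esym/pull0.
move=> a x y hx hy k m f s.
transitivity (a *: x (Tagged T (fs_face f s)) + y (Tagged T (fs_face f s))) => //.
by rewrite hx hy -pull_linear.
Defined.

Fact apl_compatible1 : apl_compatible qone.
Proof. by move=> k m f s; apply/esym/pull1. Qed.

Fact apl_compatibleM (x y : apl_families) :
  apl_compatible x -> apl_compatible y -> apl_compatible (x ** y).
Proof.
move=> hx hy k m f s.
transitivity (x (Tagged T (fs_face f s)) ** y (Tagged T (fs_face f s))) => //.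
by rewrite hx hy -pullM.
Qed.

Fact apl_compatible_diff (x : apl_families) :
  apl_compatible x -> apl_compatible (gd_diff apl_families x).
Proof.
move=> hx k m f s; transitivity (form_diff (x (Tagged T (fs_face f s)))) => //.
by rewrite hx -pull_diff.
Qed.

Definition APL : cdga :=
  @sub_cdga apl_families apl_compatible apl_compatible1
    (fun _ _ x y _ _ => @apl_compatibleM x y) apl_compatible_diff.

End APL.

Section BlowUp.
Variable n : nat.

(* f join the identity of Delta^(e-1) *)
Definition incr_join_fun a b (f : incr a b) e (x : 'I_(a + e)) : 'I_(b + e) :=
  match split x with inl y => lshift e (f y) | inr y => rshift b y end.

Fact incr_join_lt a b (f : incr a b) e (x y : 'I_(a + e)) :
  (x < y)%N -> (incr_join_fun f x < incr_join_fun f y)%N.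
Proof.
rewrite /incr_join_fun; case: (splitP x) => x' ->; case: (splitP y) => y' -> /=.
- exact: incr_lt.
- by move=> _; apply: leq_trans (ltn_ord _) (leq_addr _ _).
- by move=> h; have := ltn_trans h (ltn_ord y'); rewrite ltnNge leq_addr.
- by rewrite !ltn_add2l.
Qed.

Definition incr_join a b (f : incr a b) e : incr (a + e) (b + e) :=
  Incr (@incr_join_lt a b f e).

(* cDelta^(v 0 - 1) x ... x cDelta^(v (n-1) - 1) x Delta^(v n - 1), the cone
   points being the last vertices *)
Definition blow (v : 'I_n.+1 -> nat) : 'I_n.+1 -> nat :=
  fun i => (v i + (i < n))%N.

Definition blow_mor v w (f : mor v w) : mor (blow v) (blow w) :=
  fun i => incr_join (f i) (i < n)%N.

(* the same product with the i-th factor replaced by the face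
   Delta^(v i - 1) x {1} opposite to the cone point *)
Definition blow_base (i : 'I_n.+1) (v : 'I_n.+1 -> nat) : 'I_n.+1 -> nat :=
  fun j => (v j + ((j < n) && (j != i)))%N.

Fact blow_base_le i v j : (blow_base i v j <= blow v j)%N.
Proof. by rewrite leq_add2l; case: (j < n)%N => //=; apply: leq_b1. Qed.

Definition blow_base_incl i v : mor (blow_base i v) (blow v) :=
  fun j => @Incr _ _ (widen_ord (blow_base_le i v j)) (fun _ _ h => h).

(* ||x||_l <= q: all non-zero components of the restriction have degree <= q in
   the last l factors.  [rev_ord l] is the index n - l. *)
Definition form_norm_le (l : 'I_n.+1) (q : \bar int) (v : 'I_n.+1 -> nat)
    (x : forms (blow v)) : Prop :=
  (0 < v (rev_ord l))%N ->
  forall d, component (fun i => rev_ord l < i)%N d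
              (pull (blow_base_incl (rev_ord l) v) x) != 0 ->
    (d%:Z%:E <= q)%E.

Variable K : filtered_face_set n.

Record plus_simplex := PlusSimplex {
  ps_obj : join_obj n;
  ps_simp : K ps_obj;
  ps_regular : regular_obj ps_obj }.

Definition blow_families : gdalg :=
  fam_gdalg (fun s : plus_simplex => forms_gdalg (blow (ps_obj s))).

Definition blow_compatible (w : blow_families) : Prop :=
  forall (v v' : join_obj n) (f : mor v v') (s : K v')
      (hv : regular_obj v) (hv' : regular_obj v'),
    w (PlusSimplex (ff_face f s) hv) = pull (blow_mor f) (w (PlusSimplex s hv')).

Definition norm_le (l : 'I_n.+1) (q : \bar int) (w : blow_families) : Prop :=
  forall s : plus_simplex, form_norm_le l q (w s).

(* A(K)_p: compatible families with ||w||_l, ||dw||_l <= p(l) for 1 <= l <= n *)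
Definition pforms (p : perv n) : submod blow_families.
Proof.
exists (fun w => blow_compatible w /\
  forall l : 'I_n.+1, (0 < l)%N ->
    norm_le l (perv_val p l) w /\
    norm_le l (perv_val p l) (gd_diff blow_families w)).
  have z : forall l, norm_le l (perv_val p l) 0.
    by move=> l s _ d; rewrite pull0 component0 eqxx.
  split=> [v v' f s hv hv'|l _]; first exact/esym/pull0.
  by split; rewrite ?linear0.
have lin l a (x y : blow_families) : norm_le l (perv_val p l) x ->
    norm_le l (perv_val p l) y -> norm_le l (perv_val p l) (a *: x + y).
  move=> hx hy s hs d.
  have -> : (a *: x + y) s = a *: x s + y s by [].
  rewrite pull_linear component_linear => nz.
  have [x0|/(hx s hs) //] := eqVneq (component (fun i => rev_ord l < i)%N d
    (pull (blow_base_incl (rev_ord l) (ps_obj s)) (x s))) 0.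
  by apply: (hy s hs); move: nz; rewrite x0 scaler0 add0r.
move=> a x y [cx hx] [cy hy]; split=> [v v' f s hv hv'|l l0].
  transitivity (a *: x (PlusSimplex (ff_face f s) hv) +
    y (PlusSimplex (ff_face f s) hv)) => //.
  by rewrite (cx _ _ _ _ _ hv') (cy _ _ _ _ _ hv') -pull_linear.
have [[? ?] [? ?]] := (hx l l0, hy l l0).
by split; rewrite ?linearP; apply: lin.
Defined.

Fact pforms_le p q : perv_le p q -> forall x, pforms p x -> pforms q x.
Proof.
move=> /perv_leE pq x [cx hx]; split=> // l l0; have [h h'] := hx l l0.
by split=> s hs d nz; apply: le_trans (pq l); [apply: h nz | apply: h' nz].
Qed.

Fact pforms1 : pforms (perv0 n) qone.
Proof.
split=> [v v' f s hv hv'|l l0]; first exact/esym/pull1.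
split=> s hs d.
  have -> : (qone : blow_families) s = qone by [].
  rewrite pull1 component1; case: (d =P 0%N) => [-> _|_]; last by rewrite eqxx.
  exact: perv_val_ge0.
have -> : gd_diff blow_families qone s = 0 by apply: form_diff1.
by rewrite pull0 component0 eqxx.
Qed.

Fact norm_leM l p q r (x y : blow_families) : perv_add_le p q r ->
  norm_le l (perv_val p l) x -> norm_le l (perv_val q l) y ->
  norm_le l (perv_val r l) (x ** y).
Proof.
move=> /perv_add_leE pqr hx hy s hs d.
have -> : (x ** y) s = x s ** y s by [].
rewrite pullM componentM => nz.
have [i /eqP nzi] : exists i : 'I_d.+1,
    component (fun i => rev_ord l < i)%N i
      (pull (blow_base_incl (rev_ord l) (ps_obj s)) (x s)) **
    component (fun i => rev_ord l < i)%N (d - i)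
      (pull (blow_base_incl (rev_ord l) (ps_obj s)) (y s)) <> 0.
  by apply: contrapT => /forallNP h; move/eqP: nz; apply; apply: big1 => i _; apply: contrapT.
apply: le_trans (pqr l); rewrite -[X in (X%:Z)%:E](subnKC (leq_ord i)) PoszD EFinD.
apply: leeD; [apply: (hx s hs) | apply: (hy s hs)]; apply: contra nzi => /eqP ->.
  by rewrite qmul0r.
by rewrite qmulr0.
Qed.

Fact pformsM p q r : perv_add_le p q r -> forall i j (x y : blow_families),
  gd_hom blow_families i x -> gd_hom blow_families j y ->
  pforms p x -> pforms q y -> pforms r (x ** y).
Proof.
move=> pqr i j x y hi hj [cx hx] [cy hy]; split=> [v v' f s hv hv'|l l0].
  transitivity (x (PlusSimplex (ff_face f s) hv) **
    y (PlusSimplex (ff_face f s) hv)) => //.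
  by rewrite (cx _ _ _ _ _ hv') (cy _ _ _ _ _ hv') -pullM.
have [[hx1 hx2] [hy1 hy2]] := (hx l l0, hy l l0); split.
  exact: norm_leM pqr hx1 hy1.
rewrite (gd_leibniz _ hi) addrC => s hs d.
have h1 := norm_leM pqr hx1 hy2; have h2 := norm_leM pqr hx2 hy1.
have -> : ((-1) ^+ i *: (x ** gd_diff blow_families y) +
    gd_diff blow_families x ** y) s =
    (-1) ^+ i *: (x ** gd_diff blow_families y) s +
    (gd_diff blow_families x ** y) s by [].
rewrite pull_linear component_linear => nz.
have [x0|/(h1 s hs) //] := eqVneq (component (fun i => rev_ord l < i)%N d
  (pull (blow_base_incl (rev_ord l) (ps_obj s))
    ((x ** gd_diff blow_families y) s))) 0.
by apply: (h2 s hs); move: nz; rewrite x0 scaler0 add0r.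
Qed.

Fact pforms_diff p (x : blow_families) :
  pforms p x -> pforms p (gd_diff blow_families x).
Proof.
move=> [cx hx]; split=> [v v' f s hv hv'|l l0].
  transitivity (form_diff (x (PlusSimplex (ff_face f s) hv))) => //.
  by rewrite (cx _ _ _ _ _ hv') -pull_diff.
have [_ h] := hx l l0; split=> //; rewrite gd_diffK => s hs d.
by rewrite pull0 component0 eqxx.
Qed.

Definition perverse_forms : perverse_cdga n :=
  @sub_perverse n blow_families pforms pforms_le pforms1 pformsM pforms_diff.

End BlowUp.

(* Main.v *)
(* On a simplex of K_+ the forms on the join Delta^{j_0} * ... * Delta^{j_n} pull
   back to the blow-up along the map which multiplies the coordinates of the
   factor l by the cone coordinates of the factors before l.  This maps
   compatible families of forms on the joins into A(K)_0, because a norm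
   condition ||.||_l <= 0 says that the form is constant along the last l factors
   at the bottom of the cone n - l.  To see that it is a quasi-isomorphism,
   contract its mapping cone on each simplex: for every vertex a of the join there
   is a contraction to a by straight-line homotopies, one factor at a time, which
   respects the norm conditions and the faces containing a.  The barycentric
   coordinates of the join glue these local contractions into one that is natural
   for faces.  Normality of K identifies the compatible families of forms on the
   joins over K_+ with A_PL of the associated face set.

   In the perverse model the part of perversity 0 is the free algebra on V_[0]; it
   is a Sullivan minimal algebra with a quasi-isomorphism to A(K)_0, and this
   lifts, up to homotopy and along the filtration of V_[0], through the
   quasi-isomorphism from A_PL. *)

(* A contraction to a vertex is natural only for faces containing it, and vertices cannot be chosen
   compatibly over a face set; hence the gluing. The weighted mean sum_a T_a h_a is not a
   contraction, the defect being made of the dT_a. Iterated corrections repair it, and each one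
   applies one more degree-lowering h_a, so q+1 terms suffice in degree q. Restriction to a face
   kills the coordinates of the missing vertices, which makes the result natural. A single
   acyclicity statement for the mapping cone then gives injectivity and surjectivity in cohomology,
   without a natural homotopy inverse. Moving one factor at a time is forced by the products of cone
   coordinates: they stay affine in the moving factor, so that the contractions of the join and of
   the blow-up correspond. The norm conditions enter as equations between algebra maps, which are
   stable under products and d. The glued contractions are not multiplicative. Multiplicativity
   comes from the lifting step, whose source is free; there, linear choices without bases are made
   by means of complements of subspaces. *)
Require Import Defs.
From mathcomp Require Import all_boot all_order all_algebra.
From HB Require Import structures.
From mathcomp Require Import boolp classical_sets constructive_ereal.
Set Implicit Arguments.
Unset Strict Implicit.
Unset Printing Implicit Defensive.
Import Order.TTheory GRing.Theory Num.Theory.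
Local Open Scope ring_scope.

(** * Differential graded algebras and power series *)

(* gi extends x |-> (-1)^|x| x to non-homogeneous elements, so that the Leibniz rule
   holds for all x. *)
Record igdalg := Igdalg {
  ig_alg :> gdalg;
  gi : {linear ig_alg -> ig_alg};
  giM : forall x y, gi (x ** y) = gi x ** gi y;
  gi_hom : forall k x, gd_hom ig_alg k x -> gi x = (-1) ^+ k *: x;
  gi_leibniz : forall x y,
    gd_diff ig_alg (x ** y) = gd_diff ig_alg x ** y + gi x ** gd_diff ig_alg y;
  gi_diff : forall x, gd_diff ig_alg (gi x) = - gi (gd_diff ig_alg x);
  giK : involutive gi }.

Notation hom A k := (gd_hom A k).
Notation dif A := (gd_diff A).

Lemma gd_diff1 (A : gdalg) : dif A qone = 0.
Proof.
have := gd_leibniz qone (gd_hom1 A); rewrite !qmul1r qmulr1 scale1r.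
by move=> /eqP; rewrite -subr_eq subrr eq_sym => /eqP.
Qed.

Record dga_map (A B : igdalg) := DgaMap {
  dm_fun :> {linear A -> B};
  dm1 : dm_fun qone = qone;
  dmM : forall x y, dm_fun (x ** y) = dm_fun x ** dm_fun y;
  dmd : forall x, dm_fun (dif A x) = dif B (dm_fun x);
  dmi : forall x, dm_fun (gi A x) = gi B (dm_fun x);
  dm_hom : forall k x, hom A k x -> hom B k (dm_fun x) }.

Section Gi.
Variable A : igdalg.
Lemma gi_one : gi A qone = qone.
Proof. by rewrite (gi_hom (gd_hom1 A)) scale1r. Qed.
Lemma gi_hom_hom k x : hom A k x -> hom A k (gi A x).
Proof. by move=> hx; rewrite (gi_hom hx); apply: smemZ. Qed.
End Gi.

Section Comp.
Variables A B C : igdalg.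

Definition dm_comp (g : dga_map B C) (f : dga_map A B) : dga_map A C.
Proof.
refine (@DgaMap A C (g \o f)%FUN _ _ _ _ _) => /=.
- by rewrite !dm1.
- by move=> x y; rewrite !dmM.
- by move=> x; rewrite !dmd.
- by move=> x; rewrite !dmi.
- by move=> k x hx; do 2 apply: dm_hom.
Defined.

Lemma dm_compE (g : dga_map B C) (f : dga_map A B) x : dm_comp g f x = g (f x).
Proof. by []. Qed.

Definition dm_id : dga_map A A.
Proof. by refine (@DgaMap A A idfun _ _ _ _ _). Defined.

End Comp.

Section Series.
Variable A : qalgType.
Implicit Types p q : pser A.

Lemma pserM p q k : (p ** q) k = \sum_(i < k.+1) p i ** q (k - i)%N.
Proof. by []. Qed.
Lemma pserD p q k : (p + q) k = p k + q k. Proof. by []. Qed.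
Lemma pserN p k : (- p) k = - p k. Proof. by []. Qed.
Lemma pserZ a p k : (a *: p) k = a *: p k. Proof. by []. Qed.
Lemma pser1 k : (qone : pser A) k = if k == 0%N then qone else 0.
Proof. by []. Qed.

Lemma pser_comm c p q :
  (forall i j, p i ** q j = c *: (q j ** p i)) -> p ** q = c *: (q ** p).
Proof.
move=> pq; apply/funext => k; rewrite pserZ !pserM scaler_sumr.
rewrite (reindex_inj rev_ord_inj) /=; apply: eq_bigr => i _.
by rewrite pq sub_ordK.
Qed.

Definition pderiv p : pser A := fun k => k.+1%:R *: p k.+1.

Lemma pderiv_linear : linear pderiv.
Proof.
move=> a p q; apply/funext => k; rewrite pserD pserZ /pderiv pserD pserZ.
by rewrite scalerDr !scalerA mulrC.
Qed.
HB.instance Definition _ :=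
  GRing.isLinear.Build rat (pser A) (pser A) _ pderiv pderiv_linear.

Lemma pderivM p q : pderiv (p ** q) = pderiv p ** q + p ** pderiv q.
Proof.
apply/funext => k; rewrite pserD !pserM /pderiv pserM scaler_sumr.
have split_nat (i : 'I_k.+2) : k.+1%:R = i%:R + (k.+1 - i)%:R :> rat.
  by rewrite -natrD subnKC // -ltnS.
rewrite (eq_bigr (fun i : 'I_k.+2 => i%:R *: p i ** q (k.+1 - i)%N +
    p i ** ((k.+1 - i)%:R *: q (k.+1 - i)%N))); last first.
  by move=> i _; rewrite {1}(split_nat i) scalerDl qscaleAl qscaleAr.
rewrite big_split /= big_ord_recl /= scale0r qmul0r add0r; congr (_ + _).
rewrite big_ord_recr /= subnn scale0r qmulr0 addr0.
by apply: eq_bigr => i _ /=; rewrite subSn // -ltnS.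
Qed.

Definition pconst (x : A) : pser A := fun k => if k == 0%N then x else 0.

Lemma pconst_linear : linear pconst.
Proof.
move=> a x y; apply/funext => k; rewrite pserD pserZ /pconst.
by case: eqP; rewrite // scaler0 addr0.
Qed.
HB.instance Definition _ :=
  GRing.isLinear.Build rat A (pser A) _ pconst pconst_linear.

Lemma pconstM_coef x p k : (pconst x ** p) k = x ** p k.
Proof.
rewrite pserM big_ord_recl /= subn0 big1 ?addr0 // => i _.
by rewrite /pconst /= qmul0r.
Qed.

Lemma pconstM x y : pconst (x ** y) = pconst x ** pconst y.
Proof.
apply/funext => k; rewrite pconstM_coef /pconst.
by case: eqP; rewrite ?qmulr0.
Qed.

Lemma coef0M p q : (p ** q) 0%N = p 0%N ** q 0%N.
Proof. by rewrite pserM big_ord_recl big_ord0 addr0. Qed.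

End Series.

Section SeriesMap.
Variables (A B : qalgType) (f : {linear A -> B}).

Definition pmap_ser (p : pser A) : pser B := fun k => f (p k).

Lemma pmap_ser_linear : linear pmap_ser.
Proof. by move=> a p q; apply/funext => k; apply: linearP. Qed.
HB.instance Definition _ :=
  GRing.isLinear.Build rat (pser A) (pser B) _ pmap_ser pmap_ser_linear.

Lemma pmap_serM (fM : forall x y, f (x ** y) = f x ** f y) p q :
  pmap_ser (p ** q) = pmap_ser p ** pmap_ser q.
Proof.
apply/funext => k; rewrite /pmap_ser !pserM raddf_sum /=.
by apply: eq_bigr => i _; rewrite fM.
Qed.

Lemma pmap_ser_deriv p : pmap_ser (pderiv p) = pderiv (pmap_ser p).
Proof. by apply/funext => k; rewrite /pmap_ser /pderiv linearZ. Qed.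

Lemma pmap_ser_const x : pmap_ser (pconst x) = pconst (f x).
Proof.
by apply/funext => k; rewrite /pmap_ser /pconst; case: ifP => // _; apply: linear0.
Qed.

End SeriesMap.

Section FiniteSeries.

Definition pbound (A : qalgType) N (p : pser A) : Prop :=
  forall k, (N <= k)%N -> p k = 0.

Definition pfin (A : qalgType) : submod (pser A).
Proof.
exists (fun p => exists N, pbound N p) => [|a p q [N Np] [M Mq]]; first by exists 0%N.
exists (maxn N M) => k; rewrite geq_max => /andP[Nk Mk].
by rewrite pserD pserZ Np // Mq // scaler0 addr0.
Defined.

Variable A : qalgType.
Implicit Types p q : pser A.

(* value at 1; 0 if the series is not a polynomial *)
Definition psum p : A :=
  if pselect (exists N, pbound N p) is left h
  then \sum_(i < proj1_sig (cid h)) p i else 0.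

Lemma psumE N p : pbound N p -> psum p = \sum_(i < N) p i.
Proof.
move=> Np; rewrite /psum; case: pselect => [h|[]]; last by exists N.
case: (cid h) => /= M Mp {h}.
have key a b : (a <= b)%N -> pbound a p -> \sum_(i < b) p i = \sum_(i < a) p i.
  move=> /subnKC <- ap; rewrite big_split_ord /= [X in _ + X]big1 ?addr0 // => i _.
  by apply: ap; apply: leq_addr.
by case: (leqP M N) => [/key ->|/ltnW /key ->].
Qed.

Lemma psum_linear a p q : pfin A p -> pfin A q ->
  psum (a *: p + q) = a *: psum p + psum q.
Proof.
move=> [N Np] [M Mq].
have bp : pbound (maxn N M) p by move=> k; rewrite geq_max => /andP[/Np].
have bq : pbound (maxn N M) q by move=> k; rewrite geq_max => /andP[_ /Mq].
have bpq : pbound (maxn N M) (a *: p + q).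
  by move=> k hk; rewrite pserD pserZ bp // bq // scaler0 addr0.
by rewrite !(psumE (N := maxn N M)) // scaler_sumr -big_split.
Qed.

Lemma pboundM N M p q : pbound N p -> pbound M q -> pbound (N + M) (p ** q).
Proof.
move=> Np Mq k hk; rewrite pserM big1 // => i _.
case: (leqP N i) => [/Np ->|iN]; first by rewrite qmul0r.
rewrite [q _]Mq ?qmulr0 // leq_subRL; last by rewrite -ltnS.
by apply: leq_trans hk; rewrite leq_add2r ltnW.
Qed.

Lemma pfinM p q : pfin A p -> pfin A q -> pfin A (p ** q).
Proof. by move=> [N Np] [M Mq]; exists (N + M)%N; apply: pboundM. Qed.

Lemma pfin1 : pfin A qone.
Proof. by exists 1%N => -[]. Qed.

Lemma psumM p q : pfin A p -> pfin A q -> psum (p ** q) = psum p ** psum q.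
Proof.
move=> [N Np] [M Mq].
rewrite (psumE (pboundM Np Mq)) (psumE Np) (psumE Mq) qmul_suml.
transitivity (\sum_(k < N + M) \sum_(i < N | (i <= k)%N) p i ** q (k - i)%N).
  apply: eq_bigr => k _; rewrite pserM.
  rewrite (big_ord_widen (N + M) (fun i => p i ** q (k - i)%N)) //.
  rewrite [RHS](big_ord_widen_cond (N + M) (fun i => (i <= k)%N)
    (fun i => p i ** q (k - i)%N)) ?leq_addr //.
  rewrite [LHS](bigID (fun i : 'I__ => (i < N)%N)) /= [X in _ + X]big1 ?addr0.
    by apply: eq_bigl => i; rewrite ltnS.
  by move=> i /andP[_]; rewrite -leqNgt => /Np ->; rewrite qmul0r.
rewrite (exchange_big_dep predT) //=; apply: eq_bigr => i _.
rewrite qmul_sumr.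
have iNM : (i + M <= N + M)%N by rewrite leq_add2r ltnW.
rewrite -(subnKC iNM) big_split_ord /= [X in _ + X]big1 ?addr0; last first.
  move=> j _; rewrite Mq ?qmulr0 // -addnA.
  by rewrite addKn leq_addr.
rewrite big_split_ord /= big1 ?add0r => [|j]; last by rewrite leqNgt ltn_ord.
by apply: eq_big => j; rewrite ?leq_addr // => _; rewrite addKn.
Qed.

Lemma psum_const x : psum (pconst x) = x.
Proof. by rewrite (@psumE 1) ?big_ord_recl ?big_ord0 ?addr0 // => -[]. Qed.

Lemma pfin_const x : pfin A (pconst x).
Proof. by exists 1%N => -[]. Qed.

End FiniteSeries.

Lemma pfin_map (A B : qalgType) (f : {linear A -> B}) p :
  pfin A p -> pfin B (pmap_ser f p).
Proof. by move=> [N Np]; exists N => k /Np h; rewrite /pmap_ser h linear0. Qed.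

Lemma psum_map (A B : qalgType) (f : {linear A -> B}) p :
  pfin A p -> psum (pmap_ser f p) = f (psum p).
Proof.
move=> [N Np]; rewrite (psumE Np) (@psumE _ N) ?raddf_sum // => k /Np h.
by rewrite /pmap_ser h linear0.
Qed.

(** * The path algebra *)

(* The pair (p, q) stands for p(l) + q(l) dl: forms on the interval with
   coefficients in A, power series in l being allowed. *)
Definition path_alg (A : igdalg) : Type := (pser A * pser A)%type.

Section PathAlgebra.
Variable A : igdalg.
Local Notation P := (path_alg A).
Local Notation s := (pmap_ser (gi A)).
Local Notation d := (pmap_ser (dif A)).

HB.instance Definition _ := GRing.Lmodule.on P.

Let one : P := (qone, 0).
(** dl is kept on the right; [s] is the sign it acquires when it moves past [w'.1]. *)
Definition path_mul (w w' : P) : P := (w.1 ** w'.1, w.1 ** w'.2 + w.2 ** s w'.1).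

Let sM p q : s (p ** q) = s p ** s q.
Proof. by apply: pmap_serM; apply: giM. Qed.
Let sK p : s (s p) = p.
Proof. by apply/funext => k; apply: giK. Qed.
Let s1 : s qone = qone.
Proof.
by apply/funext => k; rewrite /pmap_ser pser1; case: ifP => _; rewrite ?gi_one ?linear0.
Qed.
Let ds p : d (s p) = - s (d p).
Proof. by apply/funext => k; rewrite /pmap_ser gi_diff. Qed.
Let dM p q : d (p ** q) = d p ** q + s p ** d q.
Proof.
apply/funext => k; rewrite pserD /pmap_ser !pserM raddf_sum -big_split /=.
by apply: eq_bigr => i _; rewrite gi_leibniz.
Qed.
Let dd p : d (d p) = 0.
Proof. by apply/funext => k; apply: gd_diffK. Qed.

Fact path_mulA : associative path_mul.
Proof.
move=> [p q] [p' q'] [p'' q'']; congr pair => /=; first exact: qmulA.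
by rewrite sM qmulDr qmulDl !qmulA addrA.
Qed.
Fact path_mul1r : left_id one path_mul.
Proof. by move=> [p q]; rewrite /path_mul /= !qmul1r qmul0r addr0. Qed.
Fact path_mulr1 : right_id one path_mul.
Proof. by move=> [p q]; rewrite /path_mul /= s1 !qmulr1 qmulr0 add0r. Qed.
Fact path_mulDl : left_distributive path_mul +%R.
Proof.
move=> [p q] [p' q'] [p'' q'']; congr pair => /=; rewrite !qmulDl //.
by rewrite addrACA.
Qed.
Fact path_mulDr : right_distributive path_mul +%R.
Proof.
move=> [p q] [p' q'] [p'' q'']; congr pair => /=; rewrite ?linearD !qmulDr //.
by rewrite addrACA.
Qed.
Fact path_scaleAl (a : rat) (x y : P) : a *: path_mul x y = path_mul (a *: x) y.
Proof.
by case: x y => [p q] [p' q']; congr pair => /=; rewrite ?scalerDr !qscaleAl.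
Qed.
Fact path_scaleAr (a : rat) (x y : P) : a *: path_mul x y = path_mul x (a *: y).
Proof.
by case: x y => [p q] [p' q']; congr pair => /=; rewrite ?linearZ ?scalerDr !qscaleAr.
Qed.
HB.instance Definition _ := isQAlgebra.Build P path_mulA path_mul1r path_mulr1
  path_mulDl path_mulDr path_scaleAl path_scaleAr.

Lemma pathM (w w' : P) : w ** w' = (w.1 ** w'.1, w.1 ** w'.2 + w.2 ** s w'.1).
Proof. by []. Qed.

(** Degree k - 1, the degree of the coefficient of dl in a path of degree k. For k = 0 this is the
    zero subspace, written as the span of no vector. *)
Definition hom_pred k : submod A :=
  if k is k'.+1 then gd_hom A k' else Defs.sub_span (fun=> False).

Lemma hom_pred0 x : hom_pred 0 x -> x = 0.
Proof. by case=> r; case: r => [|a r] h ->; rewrite ?big_nil //; inversion h. Qed.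

Definition path_hom (k : nat) : submod P.
Proof.
exists (fun w => (forall i, hom A k (w.1 i)) /\ (forall i, hom_pred k (w.2 i))).
  by split=> i; apply: smem0.
by move=> a w w' [h1 h2] [h1' h2']; split=> i; apply: smemP.
Defined.

(** The term with [pderiv] is dl times the derivative in l, with dl moved to the right. *)
Definition path_diff (w : P) : P := (d w.1, d w.2 + s (pderiv w.1)).
Fact path_diff_linear : linear path_diff.
Proof.
move=> a [p q] [p' q']; congr pair; first exact: linearP.
by rewrite /= !linearP /= scalerDr addrACA.
Qed.
HB.instance Definition _ := GRing.isLinear.Build rat P P _ path_diff path_diff_linear.

Definition path_inv (w : P) : P := (s w.1, - s w.2).
Fact path_inv_linear : linear path_inv.
Proof.
move=> a [p q] [p' q']; congr pair; first exact: linearP.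
by rewrite /= linearP /= opprD scalerN.
Qed.
HB.instance Definition _ := GRing.isLinear.Build rat P P _ path_inv path_inv_linear.

Fact path_invM x y : path_inv (x ** y) = path_inv x ** path_inv y.
Proof.
case: x y => [p q] [p' q']; rewrite !pathM /path_inv /=; congr pair; first exact: sM.
by rewrite linearD /= !sM opprD -!scaleN1r -qscaleAr -qscaleAl.
Qed.

Fact path_inv_hom k x : path_hom k x -> path_inv x = (-1) ^+ k *: x.
Proof.
case: x => p q [/= hp hq]; congr pair; apply/funext => i.
  exact: gi_hom.
rewrite pserN pserZ /pmap_ser /=; case: k hp hq => [|k] hp hq.
  by rewrite (hom_pred0 (hq i)) linear0 oppr0 scaler0.
by rewrite (gi_hom (hq i)) exprS mulN1r scaleNr.
Qed.

Fact path_inv_leibniz x y : path_diff (x ** y) = path_diff x ** y + path_inv x ** path_diff y.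
Proof.
case: x y => [p q] [p' q']; rewrite !pathM /path_inv /path_diff /=.
congr pair; first exact: dM.
rewrite pderivM !linearD /= !dM !sM !ds.
rewrite -!scaleN1r !qmulDl !qmulDr -!qscaleAr -!qscaleAl !scaleN1r.
by rewrite !addrA [LHS](ACl (1*3*5*2*6*4)).
Qed.

Fact path_inv_diff x : path_diff (path_inv x) = - path_inv (path_diff x).
Proof.
case: x => p q; rewrite /path_inv /path_diff /=; congr pair; first exact: ds.
rewrite linearN linearD /= !ds !opprK; congr (_ + _).
by rewrite -pmap_ser_deriv.
Qed.

Fact path_invK : involutive path_inv.
Proof. by move=> [p q]; rewrite /path_inv /= linearN /= opprK !sK. Qed.

Fact path_hom1 : path_hom 0 qone.
Proof.
split=> i; last exact: smem0.
by case: i => [|i]; [apply: gd_hom1 | apply: smem0].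
Qed.

Fact hom_predMl i j x y : hom A i x -> hom_pred j y -> hom_pred (i + j) (x ** y).
Proof.
case: j => [|j] hx hy; first by rewrite (hom_pred0 hy) qmulr0; apply: smem0.
by rewrite addnS; apply: gd_homM.
Qed.
Fact hom_predMr i j x y : hom_pred i x -> hom A j y -> hom_pred (i + j) (x ** y).
Proof.
case: i => [|i] hx hy; first by rewrite (hom_pred0 hx) qmul0r; apply: smem0.
by rewrite addSn; apply: gd_homM.
Qed.

Fact path_homM i j x y : path_hom i x -> path_hom j y -> path_hom (i + j) (x ** y).
Proof.
case: x y => [p q] [p' q'] [/= hp hq] [/= hp' hq'].
split=> k /=.
  by rewrite pserM; apply: smem_sum => l; apply: gd_homM.
rewrite pserD; apply: smemD; rewrite pserM; apply: smem_sum => l.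
  exact: hom_predMl.
by apply: hom_predMr => //; apply: gi_hom_hom.
Qed.

Fact path_hom_diff k x : path_hom k x -> path_hom k.+1 (path_diff x).
Proof.
case: x => p q [/= hp hq]; split=> i /=; first exact: gd_hom_diff.
rewrite pserD; apply: smemD; last by apply/gi_hom_hom/smemZ.
rewrite /pmap_ser; case: k hp hq => [|k] hp hq; last exact: gd_hom_diff.
by rewrite (hom_pred0 (hq i)) linear0; apply: smem0.
Qed.

Fact path_comm i j x y : path_hom i x -> path_hom j y ->
  x ** y = (-1) ^+ (i * j) *: (y ** x).
Proof.
move=> hx; have [si1 si2] : path_inv x = (-1) ^+ i *: x /\ True.
  by split=> //; apply: path_inv_hom.
move=> hy; case: x y hx hy si1 => [p q] [p' q'] [/= hp hq] [/= hp' hq'].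
have sE k (r : pser A) : (forall l, hom A k (r l)) -> s r = (-1) ^+ k *: r.
  by move=> hr; apply/funext => l; apply: gi_hom.
have z (r : pser A) : (forall l, hom_pred 0 (r l)) -> r = 0.
  by move=> hr; apply/funext => l; apply: hom_pred0.
move=> _; rewrite !pathM /= !(sE _ _ hp) !(sE _ _ hp'); congr pair.
  by apply: pser_comm => k l; apply: gd_comm.
rewrite -!qscaleAr scalerDr scalerA addrC; congr (_ + _).
  case: i hp hq => [|i] hp hq; first by rewrite (z _ hq) qmulr0 qmul0r !scaler0.
  rewrite (@pser_comm _ ((-1) ^+ (i * j))) => [|k l]; last exact: gd_comm.
  by rewrite scalerA -exprD mulSn.
case: j hp' hq' => [|j] hp' hq'; first by rewrite (z _ hq') qmulr0 qmul0r scaler0.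
rewrite (@pser_comm _ ((-1) ^+ (i * j))) => [|k l]; last exact: gd_comm.
by rewrite -exprD mulnS addnAC addnn exprD -mul2n [_ ^+ (2 * i)]exprM sqrrN !expr1n mul1r.
Qed.

Fact path_leibniz i x y : path_hom i x ->
  path_diff (x ** y) = path_diff x ** y + (-1) ^+ i *: (x ** path_diff y).
Proof.
by move=> hx; rewrite path_inv_leibniz (path_inv_hom hx) qscaleAl.
Qed.

Fact path_diffK x : path_diff (path_diff x) = 0.
Proof.
case: x => p q; rewrite /path_diff /=; congr pair; first exact: dd.
by rewrite linearD /= dd add0r -pmap_ser_deriv ds addNr.
Qed.

Definition path_gdalg : gdalg :=
  @Gdalg P path_hom path_diff path_hom1 path_homM path_hom_diff path_comm
    path_leibniz path_diffK.

Definition path_ig : igdalg :=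
  @Igdalg path_gdalg path_inv path_invM path_inv_hom path_inv_leibniz
    path_inv_diff path_invK.

Lemma path_diffE (w : path_ig) :
  dif path_ig w = (d w.1, d w.2 + s (pderiv w.1)) :> P.
Proof. by []. Qed.

Definition path_const (x : A) : path_ig := (pconst x, 0).

Fact path_const_linear : linear path_const.
Proof.
move=> a x y; congr pair; first exact: linearP.
by rewrite /= scaler0 addr0.
Qed.
HB.instance Definition _ :=
  GRing.isLinear.Build rat A path_ig _ path_const path_const_linear.

Definition path_cst : dga_map A path_ig.
Proof.
refine (@DgaMap A path_ig path_const _ _ _ _ _).
- by [].
- move=> x y; rewrite pathM /= qmulr0 qmul0r addr0.
  by rewrite /path_const pconstM.
- move=> x; rewrite path_diffE /= linear0 add0r pmap_ser_const; congr pair.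
  apply/funext => k; rewrite /pmap_ser /pderiv /pconst /=.
  by rewrite scaler0 linear0.
- move=> x; congr pair; last by rewrite /= linear0 oppr0.
  exact/esym/pmap_ser_const.
- move=> k x hx; split=> i /=; last exact: smem0.
  by rewrite /pconst; case: ifP => _ //; apply: smem0.
Defined.

Definition path_ev0_fun (w : path_ig) : A := w.1 0%N.
Fact path_ev0_linear : linear path_ev0_fun. Proof. by []. Qed.
HB.instance Definition _ :=
  GRing.isLinear.Build rat path_ig A _ path_ev0_fun path_ev0_linear.

Definition path_ev0 : dga_map path_ig A.
Proof.
refine (@DgaMap path_ig A path_ev0_fun _ _ _ _ _) => //.
- by move=> x y; exact: (coef0M x.1 y.1).
- by move=> k x [h _]; apply: h.
Defined.

(** The paths polynomial in l. Evaluation at l = 1 is additive and multiplicative on these, whereas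
    evaluation at l = 0 is defined on all power series. *)
Definition path_fin : submod path_ig.
Proof.
exists (fun w => pfin A w.1 /\ pfin A w.2) => [|a w w' [h1 h2] [h1' h2']].
  by split; apply: smem0.
by split; apply: smemP.
Defined.

Lemma path_fin1 : path_fin qone.
Proof. by split; [apply: pfin1 | apply: smem0]. Qed.
Lemma path_finM x y : path_fin x -> path_fin y -> path_fin (x ** y).
Proof.
move=> [h1 h2] [h1' h2']; split; first exact: pfinM.
by apply: smemD; apply: pfinM => //; apply: pfin_map.
Qed.
Lemma pfin_deriv p : pfin A p -> pfin A (pderiv p).
Proof.
move=> [N Np]; exists N => k Nk; rewrite /pderiv Np ?scaler0 //.
exact: leq_trans Nk (leqnSn k).
Qed.
Lemma path_fin_diff x : path_fin x -> path_fin (dif path_ig x).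
Proof.
move=> [h1 h2]; split; first exact: pfin_map.
by apply: smemD; apply: pfin_map => //; apply: pfin_deriv.
Qed.
Lemma path_fin_cst x : path_fin (path_cst x).
Proof. by split; [apply: pfin_const | apply: smem0]. Qed.

Definition path_ev1 (w : path_ig) : A := psum w.1.

Lemma path_ev1M x y : path_fin x -> path_fin y ->
  path_ev1 (x ** y) = path_ev1 x ** path_ev1 y.
Proof. by move=> [h1 _] [h2 _]; apply: psumM. Qed.
Lemma path_ev1d x : path_fin x -> path_ev1 (dif path_ig x) = dif A (path_ev1 x).
Proof. by move=> [h1 _]; apply: psum_map. Qed.
Lemma path_ev1_linear a x y : path_fin x -> path_fin y ->
  path_ev1 (a *: x + y) = a *: path_ev1 x + path_ev1 y.
Proof. by move=> [h1 _] [h2 _]; apply: psum_linear. Qed.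
Lemma path_ev1_cst x : path_ev1 (path_cst x) = x.
Proof. exact: psum_const. Qed.

(* w |-> gi (int_0^l w) *)
Definition path_prim (w : path_ig) : path_ig :=
  (fun k => if k is k'.+1 then k%:R^-1 *: gi A (w.2 k') else 0, 0).

Fact path_prim_linear : linear path_prim.
Proof.
move=> a w w'; congr pair; last by rewrite /= scaler0 addr0.
apply/funext => -[|k] /=; rewrite ?pserD ?pserZ ?scaler0 ?addr0 //.
by rewrite linearP scalerDr !scalerA mulrC.
Qed.
HB.instance Definition _ :=
  GRing.isLinear.Build rat path_ig path_ig _ path_prim path_prim_linear.

(** The interval contracts to l = 0. The dl component is the fundamental theorem of calculus; in the
    other one the twist by [gi] makes the terms with the differential of A cancel. *)
Lemma path_prim_homotopy w :
  dif path_ig (path_prim w) + path_prim (dif path_ig w) = w - path_cst (path_ev0 w).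
Proof.
case: w => p q; rewrite !path_diffE; congr pair; last first.
  rewrite /= linear0 add0r subr0 addr0; apply/funext => k.
  rewrite /pmap_ser /pderiv scalerA divff ?pnatr_eq0 // scale1r.
  exact: giK.
apply/funext => -[|k].
  change (dif A 0 + 0 = p 0%N - p 0%N).
  by rewrite linear0 addr0 subrr.
change (dif A (k.+1%:R^-1 *: gi A (q k)) +
  k.+1%:R^-1 *: gi A (dif A (q k) + gi A (k.+1%:R *: p k.+1)) = p k.+1 - 0).
rewrite linearZ /= gi_diff [gi A (_ + _)]linearD /= giK scalerDr scalerN addKr scalerA.
by rewrite mulVf ?pnatr_eq0 // scale1r subr0.
Qed.

Lemma path_fin_prim w : path_fin w -> path_fin (path_prim w).
Proof.
move=> [_ [N Nq]]; split; last exact: smem0.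
by exists N.+1 => -[|k] // /Nq h /=; rewrite h linear0 scaler0.
Qed.

Lemma path_prim_hom k w : path_hom k.+1 w -> path_hom k (path_prim w).
Proof.
move=> [h1 h2]; split=> -[|i] /=; try exact: smem0.
by apply/smemZ/gi_hom_hom.
Qed.

Lemma path_prim_hom0 w : path_hom 0 w -> path_prim w = 0.
Proof.
move=> [_ h2]; congr pair; apply/funext => -[|i] //=.
by rewrite (hom_pred0 (h2 i)) linear0 scaler0.
Qed.

Definition path_int (w : path_ig) : A := path_ev1 (path_prim w).

(** Stokes on the interval: [path_prim_homotopy] evaluated at l = 1. *)
Lemma path_int_homotopy w : path_fin w ->
  dif A (path_int w) + path_int (dif path_ig w) = path_ev1 w - path_ev0 w.
Proof.
move=> fw; have fd := path_fin_diff fw.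
rewrite /path_int -path_ev1d; last exact: path_fin_prim.
have := path_ev1_linear 1 (path_fin_diff (path_fin_prim fw)) (path_fin_prim fd).
rewrite !scale1r => <-; rewrite path_prim_homotopy.
have := path_ev1_linear (-1) (path_fin_cst (path_ev0 w)) fw.
by rewrite path_ev1_cst !scaleN1r addrC => ->; rewrite addrC.
Qed.

Lemma path_int_linear a x y : path_fin x -> path_fin y ->
  path_int (a *: x + y) = a *: path_int x + path_int y.
Proof.
by move=> fx fy; rewrite /path_int linearP path_ev1_linear //; apply: path_fin_prim.
Qed.

Lemma psum_sub (S : submod A) (p : pser A) : (forall k, S (p k)) -> S (psum p).
Proof.
move=> Sp; rewrite /psum; case: pselect => [h|_]; last exact: smem0.
by apply: smem_sum.
Qed.

Lemma path_ev1_sub (S : submod A) w : (forall k, S (w.1 k)) -> S (path_ev1 w).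
Proof. exact: psum_sub. Qed.

Lemma path_int_hom k w : path_hom k.+1 w -> hom A k (path_int w).
Proof. by move=> /path_prim_hom[h _]; apply: psum_sub. Qed.

Lemma path_int_hom0 w : path_hom 0 w -> path_int w = 0.
Proof.
by move=> /path_prim_hom0 h; rewrite /path_int h -[RHS](psum_const (0 : A)) linear0.
Qed.

End PathAlgebra.
Arguments path_cst : simpl never.

Section PathMap.
Variables (A B : igdalg) (f : dga_map A B).

Definition path_map_fun (w : path_ig A) : path_ig B :=
  (pmap_ser f w.1, pmap_ser f w.2).

Fact path_map_linear : linear path_map_fun.
Proof. by move=> a w w'; congr pair; apply: linearP. Qed.
HB.instance Definition _ := GRing.isLinear.Build rat (path_ig A) (path_ig B) _
  path_map_fun path_map_linear.

Let fM (p q : pser A) : pmap_ser f (p ** q) = pmap_ser f p ** pmap_ser f q.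
Proof. exact/pmap_serM/dmM. Qed.
Let fs (p : pser A) : pmap_ser f (pmap_ser (gi A) p) = pmap_ser (gi B) (pmap_ser f p).
Proof. by apply/funext => k; apply: dmi. Qed.
Let fd (p : pser A) : pmap_ser f (pmap_ser (dif A) p) = pmap_ser (dif B) (pmap_ser f p).
Proof. by apply/funext => k; apply: dmd. Qed.

Definition path_map : dga_map (path_ig A) (path_ig B).
Proof.
refine (@DgaMap (path_ig A) (path_ig B) path_map_fun _ _ _ _ _).
- congr pair; last exact: linear0.
  by apply/funext => k; rewrite /= /pmap_ser !pser1; case: ifP; rewrite ?dm1 ?linear0.
- move=> [p q] [p' q']; congr pair; first exact: fM.
  by rewrite -fs -!fM -linearD.
- move=> [p q]; congr pair; first exact: fd.
  by rewrite -fd -pmap_ser_deriv -fs -linearD.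
- by move=> [p q]; congr pair; rewrite /= ?linearN /= fs.
- move=> k [p q] [/= hp hq]; split=> i /=; first exact: dm_hom.
  rewrite /pmap_ser; case: k hp hq => [|k] hp hq; last exact: dm_hom.
  by rewrite (hom_pred0 (hq i)) linear0; apply: smem0.
Defined.

Lemma path_int_map w : path_fin A w -> path_int (path_map w) = f (path_int w).
Proof.
move=> /path_fin_prim[h _]; rewrite /path_int /path_ev1 -psum_map //.
congr psum; apply/funext => -[|k] /=; first by rewrite /pmap_ser linear0.
by rewrite /pmap_ser linearZ /= dmi.
Qed.

End PathMap.
Arguments path_map : simpl never.

(** * Forms on products of simplices *)

Section FormsInvolution.
Variables (r : nat) (u : 'I_r -> nat).
Local Notation F := (forms u).

Definition form_inv (x : F) : F := grade_inv x.
Let invP := grade_invP (@form_inv_rel r u).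

Fact form_inv_linear : linear form_inv.
Proof. exact: cga_map_linear invP. Qed.
HB.instance Definition _ := GRing.isLinear.Build rat F F _ form_inv form_inv_linear.

Fact form_invM x y : form_inv (x ** y) = form_inv x ** form_inv y.
Proof. exact: cga_mapM invP x y. Qed.
Fact form_inv_gen g : form_inv (gen (@form_deg r u) (@form_rel r u) g) =
  (-1) ^+ form_deg g *: gen (@form_deg r u) (@form_rel r u) g.
Proof. exact: cga_map_gen invP g. Qed.
Fact form_inv_hom k x : homog (@form_deg r u) (@form_rel r u) k x ->
  form_inv x = (-1) ^+ k *: x.
Proof. exact: (grade_inv_homog (@form_inv_rel r u)). Qed.
Fact form_inv_leibniz x y :
  form_diff (x ** y) = form_diff x ** y + form_inv x ** form_diff y.
Proof. exact: (cga_derM_inv (@form_inv_rel r u) (@form_der_deg r u) (@form_der_rel r u)). Qed.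
Fact form_inv1 : form_inv qone = qone.
Proof. exact: cga_map1 invP. Qed.

Fact form_inv0 : form_inv 0 = 0.
Proof. exact: linear0 form_inv. Qed.

Fact form_invK : involutive form_inv.
Proof.
move=> x; move: x; apply: cga_ind => [|a x y hx hy||g x hx].
- by rewrite !linear0.
- by rewrite !linearP /= hx hy.
- by rewrite !form_inv1.
rewrite !form_invM hx form_inv_gen linearZ /= form_inv_gen scalerA -exprD addnn.
by rewrite -mul2n exprM sqrrN !expr1n scale1r.
Qed.

Fact form_inv_diff x : form_diff (form_inv x) = - form_inv (form_diff x).
Proof.
move: x; apply: cga_ind => [|a x y hx hy||g x hx].
- by rewrite form_inv0 form_diff0 form_inv0 oppr0.
- by rewrite form_inv_linear !form_diff_linear form_inv_linear hx hy opprD scalerN.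
- by rewrite form_inv1 form_diff1 linear0 oppr0.
rewrite form_invM !form_inv_leibniz form_invK linearD /= !form_invM form_invK hx.
have -> : form_diff (form_inv (gen _ _ g)) =
    - form_inv (form_diff (gen (@form_deg r u) (@form_rel r u) g)).
  rewrite form_inv_gen linearZ /= form_diff_gen (form_inv_hom (form_der_deg g)).
  by rewrite exprS mulN1r scaleNr opprK.
rewrite opprD -!scaleN1r -!qscaleAl -!qscaleAr.
by [].
Qed.

Definition forms_ig : igdalg :=
  @Igdalg (forms_gdalg u) form_inv form_invM form_inv_hom form_inv_leibniz
    form_inv_diff form_invK.

Lemma form_hom0 i (a : 'I_(u i)) : hom forms_ig 0 (fg false a).
Proof. exact: (homog_gen _ _ (form_vert false a)). Qed.

Lemma form_sum1 i : \sum_(a < u i) fg false a = qone :> forms_ig.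
Proof. exact: forms_rel. Qed.

Lemma form_gen_diff (g : form_gen u) : gen (@form_deg r u) (@form_rel r u) g =
  if g.2 then form_diff (fg false (tagged g.1)) else fg false (tagged g.1).
Proof. by case: g => -[i a] [] //=; rewrite form_diff_fg. Qed.

Lemma forms_ind (Q : F -> Prop) :
  Q 0 -> (forall a x y, Q x -> Q y -> Q (a *: x + y)) -> Q qone ->
  (forall x y, Q x -> Q y -> Q (x ** y)) ->
  (forall i (a : 'I_(u i)), Q (fg false a)) ->
  (forall i (a : 'I_(u i)), Q (form_diff (fg false a))) -> forall x, Q x.
Proof.
move=> Q0 QL Q1 QM Qf Qd; apply: cga_ind => // g x Qx; apply: QM => //.
by rewrite form_gen_diff; case: ifP.
Qed.

(** Compatibility with d takes care of the dt_a. Most identities below are obtained by writing both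
    sides as composites of DGA maps and comparing them on coordinates. *)
Lemma forms_ext (B : igdalg) (f g : dga_map forms_ig B) :
  (forall i (a : 'I_(u i)), f (fg false a) = g (fg false a)) -> f =1 g.
Proof.
move=> fg_eq; apply: forms_ind => [|a x y hx hy||x y hx hy|//|i a].
- by rewrite !linear0.
- by rewrite !linearP /= hx hy.
- by rewrite !dm1.
- by rewrite !dmM hx hy.
by rewrite !(@dmd forms_ig) fg_eq.
Qed.

End FormsInvolution.

(** A point of the product of simplices with values in B, which amounts to a DGA map from the forms
    to B ([fmap]). *)
Record coords r (u : 'I_r -> nat) (B : igdalg) := Coords {
  cx :> forall i, 'I_(u i) -> B;
  cx_hom : forall i a, hom B 0 (@cx i a);
  cx_sum : forall i, \sum_(a < u i) cx a = qone }.

Section Fmap.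
Variables (r : nat) (u : 'I_r -> nat) (B : igdalg) (x : coords u B).

Definition fmap_gen (g : form_gen u) : B :=
  if g.2 then dif B (x _ (tagged g.1)) else x _ (tagged g.1).

Fact fmap_gen_hom g : hom B (form_deg g) (fmap_gen g).
Proof. by case: g => -[i a] []; rewrite /fmap_gen /=; [apply: gd_hom_diff|]; apply: cx_hom. Qed.

Fact fmap_respects : respects_rel (@form_deg r u) (@form_rel r u) fmap_gen.
Proof.
split=> [g g'|t]; first by apply: gd_comm; apply: fmap_gen_hom.
case=> i /=; rewrite teval_sum big_enum /= /fmap_gen /=.
  by rewrite cx_sum subrr.
by rewrite -linear_sum cx_sum gd_diff1.
Qed.

Definition fmap_fun : forms_ig u -> B := cga_map fmap_gen.

Fact fmap_linear : linear fmap_fun.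
Proof. exact: cga_map_linear fmap_respects. Qed.
HB.instance Definition _ :=
  GRing.isLinear.Build rat (forms_ig u) B _ fmap_fun fmap_linear.

Lemma fmap_fun_gen g : fmap_fun (gen (@form_deg r u) (@form_rel r u) g) = fmap_gen g.
Proof. exact: cga_map_gen fmap_respects g. Qed.
Lemma fmap_fun1 : fmap_fun qone = qone.
Proof. exact: cga_map1 fmap_respects. Qed.
Lemma fmap_funM y z : fmap_fun (y ** z) = fmap_fun y ** fmap_fun z.
Proof. exact: cga_mapM fmap_respects y z. Qed.
Lemma fmap_fun_hom k y : hom (forms_ig u) k y -> hom B k (fmap_fun y).
Proof.
move: y; apply: mspan_ind => [|a y z hy hz|s <-].
- by rewrite linear0; apply: smem0.
- by rewrite linearP; apply: smemP.
elim: s => [|g s IH]; first by rewrite monom_nil wt_nil fmap_fun1; apply: gd_hom1.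
rewrite monom_cons wt_cons fmap_funM fmap_fun_gen; apply: gd_homM => //.
exact: fmap_gen_hom.
Qed.
Lemma fmap_fun_inv y : fmap_fun (gi (forms_ig u) y) = gi B (fmap_fun y).
Proof.
move: y; apply: cga_ind => [|a y z hy hz||g y hy].
- by rewrite !linear0.
- by rewrite !linearP /= hy hz.
- by rewrite gi_one fmap_fun1 gi_one.
rewrite giM !fmap_funM giM hy; congr (_ ** _).
rewrite (@gi_hom (forms_ig u) _ _ (homog_gen _ _ g)) linearZ /= fmap_fun_gen.
by rewrite (gi_hom (fmap_gen_hom g)).
Qed.
Lemma fmap_fun_diff y : fmap_fun (dif (forms_ig u) y) = dif B (fmap_fun y).
Proof.
move: y; apply: cga_ind => [|a y z hy hz||g y hy].
- by rewrite !linear0.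
- by rewrite !linearP /= hy hz.
- by rewrite gd_diff1 fmap_fun1 gd_diff1 linear0.
rewrite gi_leibniz linearD /= !fmap_funM gi_leibniz hy fmap_fun_inv.
congr (_ ** _ + _); rewrite fmap_fun_gen.
have -> : dif (forms_ig u) (gen _ _ g) = form_der_gen g by exact: form_diff_gen.
rewrite /form_der_gen /fmap_gen; case: ifP => _; first by rewrite gd_diffK linear0.
by rewrite fmap_fun_gen.
Qed.

Definition fmap : dga_map (forms_ig u) B :=
  @DgaMap (forms_ig u) B fmap_fun fmap_fun1 fmap_funM fmap_fun_diff fmap_fun_inv
    fmap_fun_hom.

Lemma fmapE i (a : 'I_(u i)) : fmap (fg false a) = x _ a.
Proof. exact: fmap_fun_gen. Qed.

End Fmap.
Arguments fmap : simpl never.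

Section Affine.
Variable B : igdalg.

(* a + (b - a) l *)
Definition aff (a b : B) : path_ig B :=
  (fun k => if k is k'.+1 then if k' is _.+1 then 0 else b - a else a, 0).

Lemma aff_linear c (a a' b b' : B) :
  aff (c *: a + a') (c *: b + b') = c *: aff a b + aff a' b'.
Proof.
congr pair; last by rewrite /= scaler0 addr0.
apply/funext => -[|[|k]] //.
  change (c *: b + b' - (c *: a + a') = c *: (b - a) + (b' - a')).
  by rewrite scalerBr opprD addrACA.
change (0 = c *: 0 + 0 :> B).
by rewrite scaler0 addr0.
Qed.
Lemma affD (a a' b b' : B) : aff (a + a') (b + b') = aff a b + aff a' b'.
Proof. by have := aff_linear 1 a a' b b'; rewrite !scale1r. Qed.
Lemma aff_cst a : aff a a = path_cst B a.
Proof. by congr pair; apply/funext => -[|[|k]] //=; rewrite subrr. Qed.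
Lemma aff_sum (I : Type) (s : seq I) (P : pred I) (F G : I -> B) :
  \sum_(i <- s | P i) aff (F i) (G i) =
  aff (\sum_(i <- s | P i) F i) (\sum_(i <- s | P i) G i).
Proof.
elim: s => [|i s IH]; first by rewrite !big_nil aff_cst linear0.
by rewrite !big_cons; case: ifP => _; rewrite IH ?affD.
Qed.
Lemma aff_fin a b : path_fin B (aff a b).
Proof. by split; [exists 2%N => -[|[|k]] | apply: smem0]. Qed.
Lemma aff_ev0 a b : path_ev0 B (aff a b) = a. Proof. by []. Qed.
Lemma aff_ev1 a b : path_ev1 (aff a b) = b.
Proof.
rewrite /path_ev1 (@psumE _ 2) => [|[|[|k]]] //=.
by rewrite !big_ord_recl big_ord0 addr0 /= addrC subrK.
Qed.
Lemma aff_hom a b : hom B 0 a -> hom B 0 b -> hom (path_ig B) 0 (aff a b).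
Proof.
move=> ha hb; split=> [|k]; last exact: smem0.
case=> [|[|k]]; [exact: ha | | exact: smem0].
by rewrite /= addrC -scaleN1r; apply: smemP.
Qed.
Lemma aff_mull c a b : aff (c ** a) (c ** b) = path_cst B c ** aff a b.
Proof.
rewrite pathM /= qmulr0 qmul0r addr0; congr pair.
by apply/funext => -[|[|k]]; rewrite pconstM_coef //= ?qmulr0 // qmulDr -!scaleN1r qscaleAr.
Qed.

End Affine.

Lemma aff_map (A B : igdalg) (f : dga_map A B) a b :
  path_map f (aff a b) = aff (f a) (f b).
Proof.
congr pair; last by rewrite /= linear0.
by apply/funext => -[|[|k]] //=; rewrite /pmap_ser ?linearB ?linear0.
Qed.

Section Interpolation.
Variables (r : nat) (u : 'I_r -> nat) (B : igdalg) (x x' : coords u B).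

(** The straight segment from x to x'; simplices being convex, its coordinates still add up to 1 in
    every factor. *)
Definition interp : coords u (path_ig B).
Proof.
refine (@Coords r u (path_ig B) (fun i a => aff (x _ a) (x' _ a)) _ _).
- by move=> i a; apply: aff_hom; apply: cx_hom.
- by move=> i; rewrite aff_sum !cx_sum aff_cst dm1.
Defined.

Lemma interp_fin y : path_fin B (fmap interp y).
Proof.
move: y; apply: forms_ind => [|a y z hy hz||y z hy hz|i a|i a].
- by rewrite linear0; apply: smem0.
- by rewrite linearP; apply: smemP.
- by rewrite dm1; apply: path_fin1.
- by rewrite dmM; apply: path_finM.
- by rewrite fmapE; apply: aff_fin.
by rewrite (@dmd (forms_ig u)) fmapE; apply/path_fin_diff/aff_fin.
Qed.

Lemma interp_ev0 y : path_ev0 B (fmap interp y) = fmap x y.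
Proof.
rewrite -[LHS]/(dm_comp (path_ev0 B) (fmap interp) y).
by apply: forms_ext => i a; rewrite /= !fmapE.
Qed.

Lemma interp_ev1 y : path_ev1 (fmap interp y) = fmap x' y.
Proof.
move: y; apply: forms_ind => [|a y z hy hz||y z hy hz|i a|i a].
- by rewrite !linear0 -(linear0 (path_cst B)) path_ev1_cst.
- by rewrite !linearP path_ev1_linear ?hy ?hz //; apply: interp_fin.
- by rewrite !dm1 -(dm1 (path_cst B)) path_ev1_cst.
- by rewrite !dmM path_ev1M ?hy ?hz //; apply: interp_fin.
- by rewrite !fmapE aff_ev1.
by rewrite !(@dmd (forms_ig u)) !fmapE path_ev1d ?aff_ev1 //; apply: aff_fin.
Qed.

(** Integration along the segment: the chain homotopy between the two evaluations. *)
Definition homot (y : forms_ig u) : B := path_int (fmap interp y).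

Fact homot_linear : linear homot.
Proof.
by move=> a y z; rewrite /homot linearP path_int_linear //; apply: interp_fin.
Qed.
HB.instance Definition _ :=
  GRing.isLinear.Build rat (forms_ig u) B _ homot homot_linear.

Lemma homotP y :
  dif B (homot y) + homot (dif (forms_ig u) y) = fmap x' y - fmap x y.
Proof.
rewrite /homot dmd path_int_homotopy; last exact: interp_fin.
by rewrite interp_ev1 interp_ev0.
Qed.

Lemma homot_hom k y : hom (forms_ig u) k.+1 y -> hom B k (homot y).
Proof. by move=> hy; apply/path_int_hom/(@dm_hom _ _ (fmap interp)). Qed.

Lemma homot_hom0 y : hom (forms_ig u) 0 y -> homot y = 0.
Proof. by move=> hy; apply/path_int_hom0/(@dm_hom _ _ (fmap interp)). Qed.

End Interpolation.

Section NatCoordinates.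
Variable r : nat.
Implicit Types u w : 'I_r -> nat.

(* the coordinate t_b of the factor l, equal to 0 if there is no vertex b *)
Definition nt w (l : 'I_r) (b : nat) : forms_ig w :=
  if insub b is Some c then @fg r w false l c else 0.

Lemma nt_ord w l (b : 'I_(w l)) : nt w l b = fg false b.
Proof. by rewrite /nt valK. Qed.
Lemma nt_out w l b : (w l <= b)%N -> nt w l b = 0.
Proof. by move=> h; rewrite /nt insubF //; apply/negbTE; rewrite -leqNgt. Qed.
Lemma nt_hom w l b : hom (forms_ig w) 0 (nt w l b).
Proof. by rewrite /nt; case: insubP => [c _ _|_]; [apply: form_hom0 | apply: smem0]. Qed.
Lemma nt_sum w l N : (w l <= N)%N -> \sum_(b < N) nt w l b = qone.
Proof.
move=> /subnKC <-; rewrite big_split_ord /= [X in _ + X]big1 => [|b _]; last first.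
  by apply: nt_out; apply: leq_addr.
by rewrite addr0 -(form_sum1 w l); apply: eq_bigr => b _; apply: nt_ord.
Qed.

Lemma nt_ext u (B : igdalg) (f g : dga_map (forms_ig u) B) :
  (forall l b, (b < u l)%N -> f (nt u l b) = g (nt u l b)) -> f =1 g.
Proof. by move=> h; apply: forms_ext => l b; rewrite -nt_ord; apply: h. Qed.

Definition unit_coord (B : igdalg) (b c : nat) : B := if b == c then qone else 0.

Lemma unit_coord_sum (B : igdalg) N c : (c < N)%N ->
  \sum_(b < N) unit_coord B b c = qone.
Proof.
move=> cN; rewrite (bigD1 (Ordinal cN)) //= /unit_coord eqxx big1 ?addr0 // => b.
by rewrite -val_eqE /= => /negbTE ->.
Qed.

Lemma unit_coord_hom (B : igdalg) b c : hom B 0 (unit_coord B b c).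
Proof. by rewrite /unit_coord; case: ifP => _; [apply: gd_hom1 | apply: smem0]. Qed.

Lemma dm_unit (B C : igdalg) (f : dga_map B C) b c :
  f (unit_coord B b c) = unit_coord C b c.
Proof. by rewrite /unit_coord; case: ifP => _; [apply: dm1 | apply: linear0]. Qed.

(* [ch l = Some c] sends the whole factor l to its vertex c, [ch l = None] keeps
   the coordinates of the factor l. *)
Definition sub_coord (B : igdalg) (y : 'I_r -> nat -> B) (ch : 'I_r -> option nat)
    (l : 'I_r) (b : nat) : B :=
  if ch l is Some c then unit_coord B b c else y l b.

(** [coords] with vertices numbered by natural numbers, so that points of a factor, of its cone and
    of its base can be compared without casts. *)
Record ncoords u (B : igdalg) := NCoords {
  nc :> 'I_r -> nat -> B;
  nc_hom : forall l b, hom B 0 (nc l b);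
  nc_out : forall l b, (u l <= b)%N -> nc l b = 0;
  nc_sum : forall l, \sum_(b < u l) nc l b = qone }.

Definition coords_of u B (y : ncoords u B) : coords u B :=
  @Coords r u B (fun l b => y l b) (fun l b => nc_hom y l b) (nc_sum y).

Definition nmap u B (y : ncoords u B) : dga_map (forms_ig u) B := fmap (coords_of y).

Lemma nmapE u B (y : ncoords u B) l b : nmap y (nt u l b) = y l b.
Proof.
case: (ltnP b (u l)) => h; last by rewrite nt_out // nc_out // linear0.
by rewrite -[b]/(val (Ordinal h)) nt_ord [LHS]fmapE.
Qed.

(** The inclusion of the face spanned by the first [w l] vertices of each factor l. *)
Definition nt_coords u w (h : forall l, (w l <= u l)%N) : ncoords u (forms_ig w) :=
  @NCoords u (forms_ig w) (nt w) (@nt_hom w)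
    (fun l b hb => nt_out (leq_trans (h l) hb)) (fun l => nt_sum (h l)).

Definition sub_ok u (ch : 'I_r -> option nat) : Prop :=
  forall l, if ch l is Some c then (c < u l)%N else true.

Definition sub_coords u (B : igdalg) (y : 'I_r -> nat -> B) (ch : 'I_r -> option nat)
  (h0 : forall l b, hom B 0 (y l b))
  (h1 : forall l, ch l = None ->
     (forall b, (u l <= b)%N -> y l b = 0) /\ \sum_(b < u l) y l b = qone)
  (h2 : sub_ok u ch) : ncoords u B.
Proof.
refine (@NCoords u B (sub_coord y ch) _ _ _).
- by move=> l b; rewrite /sub_coord; case: (ch l) => [c|] //; apply: unit_coord_hom.
- move=> l b; rewrite /sub_coord; have := h2 l; case E: (ch l) => [c|].
    by move=> cu ub; rewrite /unit_coord; case: eqP => // bc; move: cu; rewrite -bc ltnNge ub.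
  by move=> _; apply: (h1 _ E).1.
- move=> l; rewrite /sub_coord; have := h2 l; case E: (ch l) => [c|].
    exact: unit_coord_sum.
  by move=> _; apply: (h1 _ E).2.
Defined.

Definition sub_nt u w (ch : 'I_r -> option nat) (h : forall l, ch l = None -> (w l <= u l)%N)
  (h2 : sub_ok u ch) : ncoords u (forms_ig w) :=
  @sub_coords u (forms_ig w) (nt w) ch (@nt_hom w)
    (fun l e => conj (fun b hb => nt_out (leq_trans (h l e) hb)) (nt_sum (h l e))) h2.

Definition ninterp u B (y y' : ncoords u B) : dga_map (forms_ig u) (path_ig B) :=
  fmap (interp (coords_of y) (coords_of y')).

Definition nhomot u B (y y' : ncoords u B) : {linear forms_ig u -> B} :=
  homot (coords_of y) (coords_of y').

Lemma nhomotE u B (y y' : ncoords u B) x : nhomot y y' x = path_int (ninterp y y' x).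
Proof. by []. Qed.

Lemma ninterpE u B (y y' : ncoords u B) l b :
  ninterp y y' (nt u l b) = aff (y l b) (y' l b).
Proof.
case: (ltnP b (u l)) => h; last first.
  by rewrite nt_out // !nc_out // linear0 aff_cst linear0.
by rewrite -[b]/(val (Ordinal h)) nt_ord [LHS]fmapE.
Qed.

Lemma nhomotP u B (y y' : ncoords u B) x :
  dif B (nhomot y y' x) + nhomot y y' (dif (forms_ig u) x) = nmap y' x - nmap y x.
Proof. exact: homotP. Qed.

Lemma nhomot_map u B C (y y' : ncoords u B) (f : dga_map B C) x :
  f (nhomot y y' x) = path_int (path_map f (ninterp y y' x)).
Proof. by rewrite nhomotE path_int_map //; apply: interp_fin. Qed.

End NatCoordinates.
Arguments nmap : simpl never.
Arguments ninterp : simpl never.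
Arguments nhomot : simpl never.

Section Components.
Variables (r : nat) (u : 'I_r -> nat) (c : pred 'I_r).
Local Notation F := (forms_ig u).
Local Notation comp := (@component r u c).

Lemma component_gen d (g : form_gen u) :
  comp d (gen (@form_deg r u) (@form_rel r u) g) =
  if d == comp_wt c g then gen (@form_deg r u) (@form_rel r u) g else 0.
Proof.
by rewrite /component (cga_map_gen (comp_respects u c)).
Qed.

Lemma component_t d l (a : 'I_(u l)) : comp d (fg false a) = if d == 0%N then fg false a else 0.
Proof. by rewrite /fg component_gen /comp_wt /= andbF. Qed.

Lemma component_dt d l (a : 'I_(u l)) :
  comp d (form_diff (fg false a)) = if d == c l :> nat then form_diff (fg false a) else 0.
Proof. by rewrite form_diff_fg /fg component_gen /comp_wt /= andbT. Qed.

Definition components (x : forms u) : pser (forms u) := fun d => comp d x.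

Lemma components_linear : linear components.
Proof. by move=> a x y; apply/funext => d; apply: component_linear. Qed.
HB.instance Definition _ :=
  GRing.isLinear.Build rat (forms u) (pser (forms u)) _ components components_linear.
Lemma componentsM x y : components (x ** y) = components x ** components y.
Proof. by apply/funext => d; apply: componentM. Qed.
Lemma components1 : components qone = qone.
Proof. by apply/funext => d; apply: component1. Qed.
Lemma components_t l (a : 'I_(u l)) : components (fg false a) = pconst (fg false a).
Proof. by apply/funext => d; apply: component_t. Qed.
Lemma components_dt_bound l (a : 'I_(u l)) : pbound 2 (components (form_diff (fg false a))).
Proof.
move=> d hd; rewrite /components component_dt ifN //.
by case: (c l); rewrite neq_ltn; apply/orP; right; apply: leq_trans hd.
Qed.

Lemma components_fin x : pfin (forms u) (components x).
Proof.
move: x; apply: forms_ind => [|a x y hx hy||x y hx hy|l a|l a].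
- by rewrite linear0; apply: smem0.
- by rewrite linearP; apply: smemP.
- by rewrite components1; apply: pfin1.
- by rewrite componentsM; apply: pfinM.
- by rewrite components_t; apply: pfin_const.
by exists 2%N; apply: components_dt_bound.
Qed.

(** The power series splitting x becomes x again at T = 1. *)
Lemma component_sum x : psum (components x) = x.
Proof.
move: x; apply: forms_ind => [|a x y hx hy||x y hx hy|l a|l a].
- by rewrite linear0 -(linear0 (@pconst (forms u))) psum_const.
- by rewrite linearP psum_linear ?hx ?hy //; apply: components_fin.
- rewrite components1 -[LHS]/(psum (pconst (qone : forms u))).
  exact: psum_const.
- by rewrite componentsM psumM ?hx ?hy //; apply: components_fin.
- by rewrite components_t psum_const.
rewrite (psumE (components_dt_bound a)) !big_ord_recl big_ord0 /components.
by rewrite !component_dt; case: (c l); rewrite ?addr0 ?add0r.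
Qed.

Lemma component_pos0 x : (forall d, (0 < d)%N -> comp d x = 0) -> x = comp 0 x.
Proof.
move=> h; rewrite -[LHS]component_sum (@psumE _ 1); last by move=> [|d] // _; apply: h.
by rewrite big_ord_recl big_ord0 addr0.
Qed.

Definition collapse (b : 'I_r -> nat) (l : 'I_r) : option nat :=
  if c l then Some (b l) else None.

Lemma collapse_ok b : (forall l, c l -> (b l < u l)%N) -> sub_ok u (collapse b).
Proof. by move=> h l; rewrite /collapse; case: ifP => // /h. Qed.

Variables (b : 'I_r -> nat) (bP : sub_ok u (collapse b)).

Definition collapse_map : dga_map F F :=
  nmap (sub_nt (w := u) (fun l _ => leqnn (u l)) bP).

Lemma collapse_mapE l a : collapse_map (nt u l a) = if c l then unit_coord F a (b l) else nt u l a.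
Proof. by rewrite /collapse_map nmapE /= /sub_coord /collapse; case: ifP. Qed.

(* The homotopy contracting the factors in c vanishes on forms of degree 0 in
   these factors. *)
Lemma collapse_fix x :
  (forall d, (0 < d)%N -> comp d x = 0) ->
  (forall d, (0 < d)%N -> comp d (form_diff x) = 0) -> collapse_map x = x.
Proof.
pose y0 := nt_coords (w := u) (fun l => leqnn (u l)).
pose y1 := sub_nt (w := u) (fun l _ => leqnn (u l)) bP.
(* Along the segment dl comes only from dt_a with a in a moving factor, and such dt_a have weight 1,
   hence are absent from the component of degree 0. *)
have int0 z : (ninterp y0 y1 (comp 0 z)).2 = 0.
  move: z; apply: forms_ind => [|a z z' hz hz'||z z' hz hz'|l a|l a].
  - by rewrite component0 linear0.
  - by rewrite component_linear linearP /= hz hz' scaler0 addr0.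
  - by rewrite component1 dm1.
  - have -> : comp 0 (z ** z') = comp 0 z ** comp 0 z' by rewrite componentM big_ord1.
    rewrite dmM pathM /= hz hz'.
    by rewrite qmulr0 qmul0r addr0.
  - by rewrite component_t -nt_ord ninterpE.
  rewrite component_dt eq_sym eqb0; case: ifPn => E; last by rewrite linear0.
  rewrite -nt_ord (@dmd F) ninterpE.
  have -> : aff (y0 l a) (y1 l a) = path_cst F (nt u l a).
    by rewrite -aff_cst /y0 /y1 /= /sub_coord /collapse (negbTE E).
  by rewrite -dmd.
have hom0 z : (forall d, (0 < d)%N -> comp d z = 0) -> nhomot y0 y1 z = 0.
  move=> /component_pos0 ->; rewrite nhomotE; move: (int0 z).
  case: (ninterp y0 y1 _) => p q /= ->.
  transitivity (psum (pconst (0 : F))); last exact: psum_const.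
  congr psum; apply/funext => -[|k] //.
  change (k.+1%:R^-1 *: gi F 0 = 0).
  by rewrite linear0 scaler0.
move=> h h'; have := nhomotP y0 y1 x; rewrite (hom0 _ h) (hom0 _ h') linear0 addr0.
move=> /esym/eqP; rewrite subr_eq0 => /eqP -> {h h'}.
rewrite -[RHS]/(dm_id F x); apply: nt_ext => l a _.
by rewrite nmapE.
Qed.

(** A collapsed factor has constant coordinates, so no dt_a survives there. This is the converse of
    [collapse_fix]: forms fixed by the collapse have degree 0 in the factors c. *)
Lemma component_collapse d x : (0 < d)%N -> comp d (collapse_map x) = 0.
Proof.
move: x d; apply: forms_ind => [|a x y hx hy||x y hx hy|l a|l a] d d0.
- by rewrite linear0 component0.
- by rewrite linearP component_linear hx // hy // scaler0 addr0.
- by rewrite dm1 component1 ifN // -lt0n.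
- rewrite dmM componentM big1 // => -[i /= id] _.
  case: (posnP i) => [->|i0]; last by rewrite hx // qmul0r.
  by rewrite subn0 hy // qmulr0.
- rewrite -nt_ord collapse_mapE; case: ifP => _.
    rewrite /unit_coord; case: ifP => _; last exact: component0.
    by rewrite component1 ifN // -lt0n.
  by rewrite nt_ord component_t ifN // -lt0n.
rewrite (@dmd F) -nt_ord collapse_mapE; case: ifP => E.
  rewrite /unit_coord; case: ifP => _; rewrite ?gd_diff1 ?linear0 component0 //.
by rewrite nt_ord component_dt E ifN // -lt0n.
Qed.

End Components.
Arguments collapse_map : simpl never.

Section PullMaps.
Variables (r : nat) (u w : 'I_r -> nat) (f : mor u w).

Definition pull_coords : coords w (forms_ig u).
Proof.
refine (@Coords r w (forms_ig u)
  (fun l b => \sum_(a : 'I_(u l) | f l a == b) fg false a) _ _).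
- by move=> l b; elim/big_ind: _ => [|x y|a _];
    [apply: smem0 | apply: smemD | apply: form_hom0].
- by move=> l; rewrite -(form_sum1 u l) [RHS](partition_big (f l) predT).
Defined.

Definition dpull : dga_map (forms_ig w) (forms_ig u) := fmap pull_coords.

Lemma dpullE x : dpull x = pull f x.
Proof.
move: x; apply: forms_ind => [|a x y hx hy||x y hx hy|l b|l b].
- by rewrite pull0 linear0.
- by rewrite pull_linear linearP /= hx hy.
- by rewrite pull1 dm1.
- by rewrite pullM dmM hx hy.
- by rewrite /dpull fmapE [RHS]pull_genE.
by rewrite pull_diff (@dmd (forms_ig w)) /dpull fmapE pull_genE.
Qed.

Lemma dpull_nt l b :
  dpull (nt w l b) = \sum_(a : 'I_(u l) | f l a == b :> nat) nt u l a.
Proof.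
case: (ltnP b (w l)) => h; last first.
  rewrite nt_out // linear0 big_pred0 // => a.
  by apply/negbTE; rewrite neq_ltn (leq_trans (ltn_ord _) h).
rewrite -[b]/(val (Ordinal h)) nt_ord /dpull fmapE /=.
by apply: eq_bigr => a _; rewrite nt_ord.
Qed.

End PullMaps.
Arguments dpull : simpl never.

(** * Forms on joins and the blow-up map *)

Section Join.
Variable n : nat.
Implicit Types v : 'I_n.+1 -> nat.

Definition vt v : Type := {l : 'I_n.+1 & 'I_(v l)}.
HB.instance Definition _ v := Finite.on (vt v).

Lemma vt_eqE v (p q : vt v) :
  (p == q) = (tag p == tag q) && (tagged p == tagged q :> nat).
Proof.
case: p q => [l c] [l' c'] /=; case: (eqVneq l l') => [e|/eqP ne].
  by case: _ / e c' => c'; rewrite eq_Tagged.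
by apply/negbTE/eqP => /(congr1 tag).
Qed.

(* the forms on the join, seen as a single simplex *)
Definition jvtx v : 'I_1 -> nat := fun=> #|{: vt v}|.
Definition jforms v : igdalg := forms_ig (jvtx v).
Definition jx v (p : vt v) : jforms v := @fg 1 (jvtx v) false ord0 (enum_rank p).

Record jcoords v (B : igdalg) := JCoords {
  jc :> vt v -> B;
  jc_hom : forall p, hom B 0 (jc p);
  jc_sum : \sum_p jc p = qone }.

Definition coords_of_j v B (y : jcoords v B) : coords (jvtx v) B.
Proof.
refine (@Coords 1 (jvtx v) B (fun _ a => y (enum_val (a : 'I_#|{: vt v}|))) _ _).
- by move=> l a; apply: jc_hom.
- by move=> l; rewrite -(jc_sum y) [RHS](reindex (@enum_val _ {: vt v})) //=;
    apply: onW_bij; apply: enum_val_bij.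
Defined.

Definition jmap v B (y : jcoords v B) : dga_map (jforms v) B := fmap (coords_of_j y).

Lemma jmapE v B (y : jcoords v B) p : jmap y (jx p) = y p.
Proof. by rewrite [LHS]fmapE /= enum_rankK. Qed.

Lemma jforms_ext v B (f g : dga_map (jforms v) B) :
  (forall p, f (jx p) = g (jx p)) -> f =1 g.
Proof.
move=> h; apply: forms_ext => l a; have := h (enum_val (a : 'I_#|{: vt v}|)).
by rewrite /jx enum_valK (ord1 l).
Qed.

Lemma jx_hom v (p : vt v) : hom (jforms v) 0 (jx p).
Proof. exact: form_hom0. Qed.

Lemma jx_sum v : \sum_(p : vt v) jx p = qone.
Proof.
rewrite -[RHS](@form_sum1 1 (jvtx v) ord0) (reindex (@enum_rank {: vt v})) //=.
apply: onW_bij; exact: enum_rank_bij.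
Qed.

Definition jhomot v B (y y' : jcoords v B) : {linear jforms v -> B} :=
  homot (coords_of_j y) (coords_of_j y').
Definition jinterp v B (y y' : jcoords v B) : dga_map (jforms v) (path_ig B) :=
  fmap (interp (coords_of_j y) (coords_of_j y')).

Lemma jinterpE v B (y y' : jcoords v B) p : jinterp y y' (jx p) = aff (y p) (y' p).
Proof. by rewrite [LHS]fmapE /= enum_rankK. Qed.

Lemma jhomotP v B (y y' : jcoords v B) x :
  dif B (jhomot y y' x) + jhomot y y' (dif (jforms v) x) = jmap y' x - jmap y x.
Proof. exact: homotP. Qed.

Lemma jhomotE v B (y y' : jcoords v B) x : jhomot y y' x = path_int (jinterp y y' x).
Proof. by []. Qed.

Lemma jhomot_map v B C (y y' : jcoords v B) (f : dga_map B C) x :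
  f (jhomot y y' x) = path_int (path_map f (jinterp y y' x)).
Proof. by rewrite jhomotE path_int_map //; apply: interp_fin. Qed.

Definition fvert u v (f : mor u v) (p : vt u) : vt v :=
  Tagged (fun l => 'I_(v l)) (f (tag p) (tagged p)).

Lemma incr_inj a b (g : incr a b) : injective g.
Proof.
move=> x y gxy; apply/val_inj/eqP; rewrite eqn_leq leqNgt [(y <= x)%N]leqNgt.
by apply/andP; split; apply/negP => /(incr_lt g); rewrite gxy ltnn.
Qed.

Lemma fvert_inj u v (f : mor u v) : injective (fvert f).
Proof.
move=> [l a] [l' a'] e; have /= ll := congr1 tag e; case: _ / ll a' e => a'.
by move=> /eqP; rewrite eq_Tagged /= => /eqP/incr_inj ->.
Qed.

Definition jpull_coords u v (f : mor u v) : jcoords v (jforms u).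
Proof.
refine (@JCoords v (jforms u) (fun q => \sum_(p | fvert f p == q) jx p) _ _).
- by move=> q; elim/big_ind: _ => [|x y|p _];
    [apply: smem0 | apply: smemD | apply: jx_hom].
- by rewrite -(jx_sum u) [RHS](partition_big (fvert f) predT).
Defined.

Definition jpull u v (f : mor u v) : dga_map (jforms v) (jforms u) :=
  jmap (jpull_coords f).

Lemma jpullE u v (f : mor u v) q : jpull f (jx q) = \sum_(p | fvert f p == q) jx p.
Proof. exact: jmapE. Qed.

End Join.
Arguments jmap : simpl never.
Arguments jinterp : simpl never.
Arguments jhomot : simpl never.
Arguments jpull : simpl never.

Section BlowUpMap.
Variables (n : nat) (v : 'I_n.+1 -> nat).
Local Notation B := (forms_ig (blow v)).
Local Notation T := (jforms v).

(* y_0 y_1 ... y_(m-1) evaluated at the cone points of the factors; the factor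
   n has no vertex numbered v n *)
Definition cone_prod (C : igdalg) (y : 'I_n.+1 -> nat -> C) (m : nat) : C :=
  \big[qmul/qone]_(0 <= k < m) y (inord k) (v (inord k)).

Lemma cone_prod0 (C : igdalg) (y : 'I_n.+1 -> nat -> C) : cone_prod y 0 = qone.
Proof. by rewrite /cone_prod big_geq. Qed.
Lemma cone_prodS (C : igdalg) (y : 'I_n.+1 -> nat -> C) m :
  cone_prod y m.+1 = cone_prod y m ** y (inord m) (v (inord m)).
Proof. by rewrite /cone_prod big_nat_recr. Qed.

Lemma cone_prod_hom (C : igdalg) (y : 'I_n.+1 -> nat -> C) m :
  (forall l b, hom C 0 (y l b)) -> hom C 0 (cone_prod y m).
Proof.
move=> h; elim: m => [|m IH]; first by rewrite cone_prod0; apply: gd_hom1.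
by rewrite cone_prodS; apply: (@gd_homM C 0 0).
Qed.

Lemma cone_prod_map (C D : igdalg) (f : dga_map C D) (y : 'I_n.+1 -> nat -> C) m :
  f (cone_prod y m) = cone_prod (fun l b => f (y l b)) m.
Proof.
by elim: m => [|m IH]; rewrite ?cone_prod0 ?dm1 // !cone_prodS dmM IH.
Qed.

Lemma eq_cone_prod (C : igdalg) (y y' : 'I_n.+1 -> nat -> C) m :
  (m <= n.+1)%N -> (forall l : 'I_n.+1, (l < m)%N -> y l (v l) = y' l (v l)) ->
  cone_prod y m = cone_prod y' m.
Proof.
elim: m => [|m IH] mn h; first by rewrite !cone_prod0.
rewrite !cone_prodS IH; [|exact: ltnW|by move=> l lm; apply: h; apply: ltnW].
congr (_ ** _); apply: h; by rewrite inordK.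
Qed.

(** How the cone products look along the contraction: the factors j <= l < i sit at their cone
    points and contribute 1, and the factor i sits on its base and kills every product containing
    it. *)
Lemma cone_prod_sub (C : igdalg) (y : 'I_n.+1 -> nat -> C) j (i : 'I_n.+1) m :
  (m <= n.+1)%N -> (j <= i)%N ->
  (forall l : 'I_n.+1, (j <= l < i)%N -> y l (v l) = qone) -> y i (v i) = 0 ->
  cone_prod y m =
    if (m <= j)%N then cone_prod y m else if (m <= i)%N then cone_prod y j else 0.
Proof.
move=> mn ji h1 h0; elim: m mn => [|m IH] mn //.
case: (ltnP m j) => // jm; rewrite cone_prodS IH ?(ltnW mn) //.
have mE : (inord m : 'I_n.+1) = m :> nat by rewrite inordK.
case: (leqP m j) => mj.
  have <- : m = j by apply/eqP; rewrite eqn_leq mj.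
  case: (ltnP m i) => mi; first by rewrite h1 ?qmulr1 // mE mi jm.
  have -> : inord m = i.
    by apply/val_inj => /=; rewrite mE; apply/eqP; rewrite eqn_leq mi (leq_trans mj).
  by rewrite h0 qmulr0.
case: (ltngtP m i) => mi; first by rewrite h1 ?qmulr1 // mE mi ltnW.
  by rewrite qmul0r.
have -> : inord m = i by apply/val_inj; rewrite /= mE.
by rewrite h0 qmulr0.
Qed.

Lemma blow_lt (l : 'I_n.+1) : (l < n)%N -> blow v l = (v l).+1.
Proof. by move=> h; rewrite /blow h addn1. Qed.
Lemma blow_max : blow v ord_max = v ord_max.
Proof. by rewrite /blow ltnn addn0. Qed.
Lemma blow_ge l : (v l <= blow v l)%N.
Proof. exact: leq_addr. Qed.

Local Notation tp := (cone_prod (nt (blow v))).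

Lemma cone_prod_end : tp n.+1 = 0.
Proof.
rewrite cone_prodS; have -> : inord n = ord_max :> 'I_n.+1 by apply/val_inj; rewrite /= inordK.
by rewrite [nt _ _ _]nt_out ?qmulr0 // blow_max.
Qed.

Lemma nt_base_sum (l : 'I_n.+1) :
  \sum_(b : 'I_(v l)) nt (blow v) l b = qone - nt (blow v) l (v l).
Proof.
have <- : \sum_(b < (v l).+1) nt (blow v) l b = qone.
  apply: nt_sum; rewrite /blow -[(v l).+1]addn1 leq_add2l; exact: leq_b1.
by rewrite big_ord_recr /= addrK.
Qed.

Definition blow_val (p : vt v) : B := tp (tag p) ** nt (blow v) (tag p) (tagged p).

(** Telescoping, as the base coordinates of a factor add up to one minus its cone coordinate. The
    case j = 0 makes [blow_coords] a point of the join; the other cases compute the mass that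
    [jstage_val] pushes to p. *)
Lemma blow_val_tail j : (j <= n.+1)%N ->
  \sum_(p : vt v | (j <= tag p)%N) blow_val p = tp j.
Proof.
move=> jn.
transitivity (\sum_(l < n.+1 | (j <= l)%N) (tp l - tp l.+1)).
  transitivity (\sum_(l < n.+1 | (j <= l)%N) \sum_(b : 'I_(v l)) tp l ** nt (blow v) l b).
    rewrite (sig_big_dep (fun l : 'I_n.+1 => (j <= l)%N) (fun _ => predT)
      (fun l b => tp l ** nt (blow v) l (b : 'I_(v l)))) /=.
    by apply: eq_bigl => p; rewrite andbT.
  apply: eq_bigr => l _; rewrite -qmul_sumr nt_base_sum qmulDr qmulr1 cone_prodS inord_val.
  by rewrite -scaleN1r -qscaleAr scaleN1r.
have -> : \sum_(l < n.+1 | (j <= l)%N) (tp l - tp l.+1) = \sum_(j <= l < n.+1) (tp l - tp l.+1).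
  by rewrite big_geq_mkord.
under eq_bigr do rewrite -opprB.
by rewrite sumrN telescope_sumr // cone_prod_end sub0r opprK.
Qed.

Definition blow_coords : jcoords v B.
Proof.
refine (@JCoords n v B blow_val _ _).
- move=> p; apply: (@gd_homM B 0 0); last exact: nt_hom.
  by apply: cone_prod_hom => l b; apply: nt_hom.
- by have := blow_val_tail (leq0n n.+1); rewrite cone_prod0.
Defined.

Definition blowup : dga_map T B := jmap blow_coords.

Lemma blowupE p : blowup (jx p) = blow_val p.
Proof. exact: jmapE. Qed.

Arguments blowup : simpl never.

(* restriction to the face of the factor k opposite to the cone point *)
Definition rk (k : 'I_n.+1) : dga_map B (forms_ig (blow_base k v)) :=
  nmap (nt_coords (blow_base_le k v)).

Arguments rk : simpl never.

Lemma rkE k l b : rk k (nt (blow v) l b) = nt (blow_base k v) l b.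
Proof. exact: nmapE. Qed.

Lemma rk_pull k x : pull (blow_base_incl k v) x = rk k x.
Proof.
rewrite -dpullE; move: x.
apply: (@nt_ext _ (blow v) _ (dpull (blow_base_incl k v)) (rk k)) => l b bv.
rewrite dpull_nt rkE.
case: (ltnP b (blow_base k v l)) => h; last first.
  rewrite big_pred0 => [|a]; first by rewrite nt_out.
  apply/negbTE; rewrite neq_ltn /=.
  by rewrite (leq_trans (ltn_ord a)).
by rewrite (big_pred1 (Ordinal h)).
Qed.

(** The form taken by the norm conditions in perversity 0, for x and dx together ([norm_le0_gcond]):
    on the base of the cone k, x does not change when the later factors are collapsed to any
    vertices b. An equation between values of DGA maps is stable under sums, products and d. *)
Definition gcond (x : B) : Prop := forall k : 'I_n.+1, (k < n)%N -> (0 < v k)%N ->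
  forall b (bP : sub_ok (blow_base k v) (collapse (fun l => (k < l)%N) b)),
    collapse_map bP (rk k x) = rk k x.

Lemma gcondP a x y : gcond x -> gcond y -> gcond (a *: x + y).
Proof. by move=> hx hy k kn vk b bP; rewrite !linearP /= hx // hy. Qed.
Lemma gcond0 : gcond 0.
Proof. by move=> k kn vk b bP; rewrite !linear0. Qed.
Lemma gcondM x y : gcond x -> gcond y -> gcond (x ** y).
Proof. by move=> hx hy k kn vk b bP; rewrite !dmM hx // hy. Qed.
Lemma gcond_diff x : gcond x -> gcond (dif B x).
Proof. by move=> hx k kn vk b bP; rewrite !dmd hx. Qed.

Definition gsub : submod B := @Submod B gcond gcond0 gcondP.

Lemma blow_base_eq k : blow_base k v k = v k.
Proof. by rewrite /blow_base eqxx andbF addn0. Qed.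
Lemma blow_base_neq (k l : 'I_n.+1) : l != k -> blow_base k v l = blow v l.
Proof. by move=> h; rewrite /blow_base /blow h andbT. Qed.

(** On the base of the cone k its cone coordinate is 0, so all join coordinates of later factors
    vanish and the remaining ones involve only factors up to k. *)
Lemma gcond_blowup x : gcond (blowup x).
Proof.
move=> k kn vk b bP.
rewrite -[LHS]/(dm_comp (collapse_map bP) (dm_comp (rk k) blowup) x).
rewrite -[RHS]/(dm_comp (rk k) blowup x).
apply: jforms_ext => -[l c]; rewrite !dm_compE blowupE /blow_val !dmM.
rewrite !cone_prod_map rkE [tag _]/= [tagged _]/=.
case: (ltnP k l) => kl.
  have -> : cone_prod (fun l b => rk k (nt (blow v) l b)) l = 0.
    rewrite (@cone_prod_sub _ _ k k) ?leqnn ?(ltnW (ltn_ord l)) //.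
    - by rewrite leqNgt kl.
    - by move=> i /andP[ki ik]; move: (leq_ltn_trans ki ik); rewrite ltnn.
    by rewrite rkE nt_out // blow_base_eq.
  have -> : cone_prod (fun l b => collapse_map bP (rk k (nt (blow v) l b))) l = 0.
    rewrite (@cone_prod_sub _ _ k k) ?leqnn ?(ltnW (ltn_ord l)) //.
    - by rewrite leqNgt kl.
    - by move=> i /andP[ki ik]; move: (leq_ltn_trans ki ik); rewrite ltnn.
    by rewrite rkE nt_out ?linear0 // blow_base_eq.
  by rewrite !qmul0r.
rewrite collapse_mapE ltnNge kl; congr (_ ** _).
apply: eq_cone_prod => [|i il]; first exact: ltnW.
by rewrite rkE collapse_mapE ltnNge (leq_trans (ltnW il) kl).
Qed.

(** A map M killing the cone coordinate of k factors through the base of that cone. There [gcond]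
    says that the later factors may be sent to vertices, which is what M' does. *)
Lemma gcond_indep (k : 'I_n.+1) (b : 'I_n.+1 -> nat) (C : igdalg) (M M' : dga_map B C) x :
  (k < n)%N -> (0 < v k)%N -> (forall l : 'I_n.+1, (k < l)%N -> (b l < blow v l)%N) ->
  M (nt (blow v) k (v k)) = 0 ->
  (forall l c, (c < blow v l)%N -> M' (nt (blow v) l c) =
     if (k < l)%N then unit_coord C c (b l) else M (nt (blow v) l c)) ->
  gcond x -> M x = M' x.
Proof.
move=> kn vk bv M0 M'E gx.
have bP : sub_ok (blow_base k v) (collapse (fun l => (k < l)%N) b).
  apply: collapse_ok => l kl; rewrite blow_base_neq; first exact: bv.
  by rewrite -val_eqE neq_ltn kl orbT.
pose y l c := M (nt (blow v) l c).
have y_out l c : (blow_base k v l <= c)%N -> y l c = 0.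
  rewrite /y; case: (eqVneq l k) => [->|lk]; last first.
    by rewrite blow_base_neq // => h; rewrite nt_out // linear0.
  rewrite blow_base_eq leq_eqVlt => /predU1P[<- //|h].
  by rewrite nt_out ?linear0 // blow_lt.
have y_sum l : \sum_(c < blow_base k v l) y l c = qone.
  rewrite -(dm1 M) -(nt_sum (leqnn (blow v l))) raddf_sum /=.
  rewrite -(subnKC (blow_base_le k v l)) [RHS]big_split_ord /= [X in _ = _ + X]big1 ?addr0 //.
  by move=> c _; apply: y_out; apply: leq_addr.
pose N := nmap (@NCoords n.+1 (blow_base k v) C y
  (fun l c => dm_hom M (nt_hom (blow v) l c)) y_out y_sum).
have MN z : M z = N (rk k z).
  rewrite -[RHS]/(dm_comp N (rk k) z); apply: nt_ext => l c _.
  by rewrite dm_compE rkE nmapE.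
rewrite MN -(gx k kn vk b bP).
rewrite -[LHS]/(dm_comp N (dm_comp (collapse_map bP) (rk k)) x).
apply: nt_ext => l c cl; rewrite !dm_compE rkE collapse_mapE M'E //.
by case: ifP => kl; rewrite ?dm_unit // nmapE.
Qed.

End BlowUpMap.
Arguments blowup : simpl never.
Arguments rk : simpl never.

(** * Contractions of the blow-up and of the join *)

Section Contraction.
Variables (n : nat) (v : 'I_n.+1 -> nat) (p : vt v).
Hypothesis v_reg : (0 < v ord_max)%N.
Local Notation B := (forms_ig (blow v)).
Local Notation T := (jforms v).
Local Notation i := (tag p).

Lemma ord_lt_max (l : 'I_n.+1) : (l < n)%N = (l != ord_max).
Proof. by rewrite ltn_neqAle -ltnS ltn_ord andbT -val_eqE. Qed.

Lemma blow_gt0 l : (0 < blow v l)%N.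
Proof.
case: (ltnP l n) => h; first by rewrite blow_lt.
have -> : l = ord_max by apply/eqP; rewrite -[_ == _]negbK -ord_lt_max -leqNgt.
exact: leq_trans v_reg (blow_ge v _).
Qed.

(** [gcond_indep] at the factor i of p when i < n. For i = n there is no later factor, and M' has
    the same coordinates as M. *)
Lemma gcond_tail (b : 'I_n.+1 -> nat) (C : igdalg) (M M' : dga_map B C) x :
  (forall l : 'I_n.+1, (i < l)%N -> (b l < blow v l)%N) ->
  M (nt (blow v) i (v i)) = 0 ->
  (forall l c, (c < blow v l)%N -> M' (nt (blow v) l c) =
     if (i < l)%N then unit_coord C c (b l) else M (nt (blow v) l c)) ->
  gcond x -> M x = M' x.
Proof.
move=> bv M0 M'E; case: (ltnP i n) => ni.
  by apply: gcond_indep bv M0 M'E => //; apply: leq_ltn_trans (ltn_ord (tagged p)).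
move=> _; apply: nt_ext => l c cl; rewrite M'E // ifF //.
by apply/negbTE; rewrite -leqNgt (leq_trans _ ni) // -ltnS.
Qed.

Lemma unit_cone (C : igdalg) : unit_coord C (v i) (tagged p) = 0.
Proof. by rewrite /unit_coord gtn_eqF // ltn_ord. Qed.

(* the choice for stage j of the contraction to the vertex p: the factors l < j
   are kept, those with j <= l < i are sent to their cone points, the factor i
   is sent to p *)
Definition ech (j : nat) (g : 'I_n.+1 -> option nat) (l : 'I_n.+1) : option nat :=
  if (l < j)%N then None else
  if (l < i)%N then Some (v l) else if l == i then Some (tagged p : nat) else g l.

(** g prescribes the factors after i: [None] in the contraction itself, vertices in the variant
    which [gcond] cannot distinguish from it. *)
Definition tail_ok (g : 'I_n.+1 -> option nat) : Prop :=
  forall l : 'I_n.+1, (i < l)%N -> if g l is Some c then (c < blow v l)%N else true.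

Lemma ech_ok j g : tail_ok g -> sub_ok (blow v) (ech j g).
Proof.
move=> gP l; rewrite /ech; case: ifP => // _; case: (ltngtP l i) => li.
- by rewrite blow_lt // (leq_trans li) // -ltnS.
- by rewrite ifN ?neq_ltn ?li ?orbT //; apply: gP.
- by rewrite (val_inj li) eqxx (leq_trans (ltn_ord (tagged p))) // blow_ge.
Qed.

(** Stage j preserves the base of the cone k if the factor k is kept (k < j) or if no factor is sent
    to a cone point (i <= j). *)
Lemma ech_ok_base j (k : 'I_n.+1) : (k < j)%N || (i <= j)%N -> sub_ok (blow_base k v) (ech j (fun=> None)).
Proof.
move=> kj l; rewrite /ech; case: (ltnP l j) => // jl; case: (ltngtP l i) => li.
- rewrite blow_base_neq; first by rewrite blow_lt // (leq_trans li) // -ltnS.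
  rewrite -val_eqE neq_ltn; case/orP: kj => [kj|ij]; first by rewrite (leq_trans kj) ?orbT.
  by move: (leq_trans ij jl); rewrite leqNgt li.
- by rewrite ifN ?neq_ltn ?li ?orbT.
- by rewrite (val_inj li) eqxx (leq_trans (ltn_ord (tagged p))) // leq_addr.
Qed.

Lemma tail_none : tail_ok (fun=> None). Proof. by []. Qed.

Definition stage_gen (g : 'I_n.+1 -> option nat) (gP : tail_ok g) j : ncoords (blow v) B :=
  sub_nt (w := blow v) (fun l _ => leqnn (blow v l)) (ech_ok j gP).

Definition stage : nat -> ncoords (blow v) B := stage_gen tail_none.

Lemma stage_genE g (gP : tail_ok g) j l c :
  stage_gen gP j l c = sub_coord (nt (blow v)) (ech j g) l c.
Proof. by []. Qed.

Lemma stageE j l c : stage j l c = sub_coord (nt (blow v)) (ech j (fun=> None)) l c.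
Proof. by []. Qed.

(** Stages j and j+1 differ only in the factor j. Stage i+1 is the identity, stage 0 has all factors
    up to i at vertices, and the factors after i never move. *)
Definition contract (x : B) : B := \sum_(j < i.+1) nhomot (stage j) (stage j.+1) x.

Fact contract_linear : linear contract.
Proof.
move=> a x y; rewrite /contract scaler_sumr -big_split /=.
by apply: eq_bigr => j _; rewrite linearP.
Qed.
HB.instance Definition _ := GRing.isLinear.Build rat B B _ contract contract_linear.

Lemma stage_last x : nmap (stage i.+1) x = x.
Proof.
rewrite -[RHS]/(dm_id B x); apply: nt_ext => l c _.
rewrite nmapE stage_genE /sub_coord /ech; case: (ltnP l i.+1) => // il.
by rewrite ifN -?leqNgt ?(ltnW il) // ifN // neq_ltn il orbT.
Qed.

Lemma contractP x : dif B (contract x) + contract (dif B x) = x - nmap (stage 0) x.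
Proof.
rewrite /contract linear_sum -big_split /=.
rewrite (eq_bigr (fun j : 'I_i.+1 => nmap (stage j.+1) x - nmap (stage j) x)); last first.
  by move=> j _; apply: nhomotP.
rewrite -(big_mkord xpredT (fun j => nmap (stage j.+1) x - nmap (stage j) x)).
by rewrite telescope_sumr // stage_last.
Qed.

Lemma contract_hom k x : hom B k.+1 x -> hom B k (contract x).
Proof. by move=> hx; apply: smem_sum => j; apply: homot_hom. Qed.
Lemma contract_hom0 x : hom B 0 x -> contract x = 0.
Proof. by move=> hx; rewrite /contract big1 // => j _; apply: homot_hom0. Qed.

Let zero : 'I_n.+1 -> nat := fun=> 0%N.
Let tail_some (b : 'I_n.+1 -> nat) :
  (forall l : 'I_n.+1, (i < l)%N -> (b l < blow v l)%N) -> tail_ok (fun l => Some (b l)).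
Proof. by move=> h l /h. Qed.
Let zero_ok : tail_ok (fun l => Some (zero l)).
Proof. by apply: tail_some => l _; apply: blow_gt0. Qed.

(** For j < i the factor i stays at p, on its base, during the whole homotopy, so the later factors
    may be put at their vertices 0. *)
Lemma stage_tail j x : (j < i)%N -> gcond x ->
  ninterp (stage j) (stage j.+1) x =
  ninterp (stage_gen zero_ok j) (stage_gen zero_ok j.+1) x.
Proof.
move=> ji; apply: (@gcond_tail zero) => [l _||l c cl]; first exact: blow_gt0.
  have e1 : (i < j)%N = false by apply/negbTE; rewrite -leqNgt ltnW.
  have e2 : (i < j.+1)%N = false by apply/negbTE; rewrite -leqNgt.
  rewrite ninterpE !stage_genE /sub_coord /ech e1 e2 ltnn eqxx.
  by rewrite unit_cone aff_cst linear0.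
rewrite !ninterpE !stage_genE /sub_coord /ech.
case: (ltngtP l i) => li.
- by case: ifP; case: ifP.
- have lj : (l < j.+1)%N = false by apply/negbTE; rewrite -leqNgt (leq_trans ji) // ltnW.
  have lj' : (l < j)%N = false by apply/negbTE; rewrite -leqNgt (leq_trans (ltnW ji)) // ltnW.
  have lE : (l == i) = false by apply/negbTE; rewrite -val_eqE neq_ltn li orbT.
  by rewrite lj lj' lE aff_cst dm_unit.
- by rewrite (val_inj li) eqxx.
Qed.

Lemma gcond_stage j x : (j <= i)%N -> gcond x -> gcond (nhomot (stage j) (stage j.+1) x).
Proof.
move=> ji gx k kn vk b bP; set col := collapse_map bP.
have colE l c : col (nt (blow_base k v) l c) =
    if (k < l)%N then unit_coord _ c (b l) else nt (blow_base k v) l c.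
  exact: collapse_mapE.
(* Here both stages preserve the base of the cone k. The homotopy restricts to this base, where [y]
   and [y'] are its ends, and it is compatible with the collapse. *)
case: (boolP ((k < j)%N || (i <= j)%N)) => hk.
  have hk' : (k < j.+1)%N || (i <= j.+1)%N.
    by case/orP: hk => h; apply/orP; [left|right]; apply: leqW.
  pose y := sub_nt (w := blow_base k v) (fun l _ => leqnn _) (ech_ok_base hk).
  pose y' := sub_nt (w := blow_base k v) (fun l _ => leqnn _) (ech_ok_base hk').
  have yE l c : y l c = sub_coord (nt (blow_base k v)) (ech j (fun=> None)) l c by [].
  have yE' l c : y' l c = sub_coord (nt (blow_base k v)) (ech j.+1 (fun=> None)) l c by [].
  have rH z : path_map (rk v k) (ninterp (stage j) (stage j.+1) z) = ninterp y y' (rk v k z).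
    rewrite -[LHS]/(dm_comp (path_map (rk v k)) (ninterp (stage j) (stage j.+1)) z).
    rewrite -[RHS]/(dm_comp (ninterp y y') (rk v k) z).
    apply: nt_ext => l c _; rewrite !dm_compE rkE !ninterpE aff_map yE yE'.
    rewrite !stage_genE /sub_coord; congr aff.
      by case: (ech _ _ _) => [d|]; rewrite ?dm_unit ?rkE.
    by case: (ech _ _ _) => [d|]; rewrite ?dm_unit ?rkE.
  rewrite [rk v k _]nhomot_map rH -(gx k kn vk b bP) -/col.
  rewrite -(path_int_map col); last exact: interp_fin.
  congr path_int.
  rewrite -[LHS]/(dm_comp (path_map col) (dm_comp (ninterp y y') col) (rk v k x)).
  rewrite -[RHS]/(dm_comp (ninterp y y') col (rk v k x)).
  apply: nt_ext => l c _; rewrite !dm_compE colE.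
  case: ifP => kl; first by rewrite !dm_unit.
  rewrite ninterpE aff_map yE yE' /sub_coord; congr aff.
    by case: (ech _ _ _) => [d|]; rewrite ?dm_unit // colE kl.
  by case: (ech _ _ _) => [d|]; rewrite ?dm_unit // colE kl.
(* Now j <= k and j < i. With the factors after i put at vertices, all factors after k are constant
   along the homotopy, so collapsing them changes nothing. *)
move: hk; rewrite negb_or -leqNgt -ltnNge => /andP[jk {}ji].
rewrite [rk v k _]nhomot_map (stage_tail ji gx) -(path_int_map col); last first.
  by rewrite -/(dm_comp _ _ _); split; apply: pfin_map; case: (interp_fin
    (coords_of (stage_gen zero_ok j)) (coords_of (stage_gen zero_ok j.+1)) x).
congr path_int; set N := ninterp _ _.
rewrite -[LHS]/(dm_comp (path_map col) (dm_comp (path_map (rk v k)) N) x).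
rewrite -[RHS]/(dm_comp (path_map (rk v k)) N x).
apply: nt_ext => l c _; rewrite !dm_compE /N ninterpE !aff_map !stage_genE /sub_coord /ech.
have col_nt : (l <= j)%N -> col (rk v k (nt (blow v) l c)) = rk v k (nt (blow v) l c).
  by move=> lj; rewrite rkE colE ltnNge (leq_trans lj jk).
congr aff.
  case: (ltnP l j) => lj; first by rewrite col_nt // ltnW.
  by case: ifP => _; [rewrite !dm_unit | case: ifP => _; rewrite !dm_unit].
case: (ltnP l j.+1) => lj; first by rewrite col_nt.
by case: ifP => _; [rewrite !dm_unit | case: ifP => _; rewrite !dm_unit].
Qed.

Lemma gcond_contract x : gcond x -> gcond (contract x).
Proof.
move=> gx; rewrite /contract; elim/big_ind: _ => [|y z|j _].
- exact: gcond0.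
- exact: (smemD (S := gsub v)).
- by apply: gcond_stage => //; rewrite -ltnS.
Qed.

(* evaluation at p, the values of the coordinates of the later factors being
   irrelevant on the forms considered *)
Definition eps_coords (C : igdalg) (b : 'I_n.+1 -> nat)
  (bP : forall l : 'I_n.+1, (i < l)%N -> (b l < blow v l)%N) : ncoords (blow v) C.
Proof.
refine (@sub_coords n.+1 (blow v) C (fun _ _ => 0) (ech 0 (fun l => Some (b l))) _ _
  (ech_ok 0 (tail_some bP))) => [l c|l]; first exact: smem0.
by rewrite /ech; case: ifP => //; case: ifP => //; case: ifP.
Defined.

Definition eps_gen (C : igdalg) b bP : dga_map B C := nmap (@eps_coords C b bP).

Lemma eps_genE C b bP l c : @eps_gen C b bP (nt (blow v) l c) =
  unit_coord C c (if (l < i)%N then v l else if l == i then tagged p : nat else b l).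
Proof.
rewrite /eps_gen nmapE -[LHS]/(sub_coord (fun _ _ => 0) (ech 0 (fun l => Some (b l))) l c).
by rewrite /sub_coord /ech /=; case: ifP => //; case: ifP.
Qed.

Lemma eps_gen_indep C b bP b' bP' x : gcond x -> @eps_gen C b bP x = @eps_gen C b' bP' x.
Proof.
apply: (@gcond_tail b') => // [|l c _].
  by rewrite eps_genE ltnn eqxx unit_cone.
rewrite !eps_genE; case: (ltngtP l i) => // li.
  by rewrite ifN // neq_ltn li orbT.
by rewrite (val_inj li) eqxx.
Qed.

Let zero_bound (l : 'I_n.+1) : (i < l)%N -> (zero l < blow v l)%N.
Proof. by move=> _; apply: blow_gt0. Qed.

Definition eps : dga_map B T := eps_gen T zero_bound.

(** Stage 0 still keeps the factors after i, whereas [eps] puts them at vertices; [gcond] does not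
    see the difference, as the factor i is on its base. *)
Lemma eps_stage x : gcond x -> blowup v (eps x) = nmap (stage 0) x.
Proof.
move=> gx; rewrite -dm_compE; apply: esym; move: gx.
apply: (@gcond_tail zero) => // [|l c _].
  by rewrite nmapE stage_genE /sub_coord /ech ltnn eqxx /= unit_cone.
rewrite dm_compE eps_genE dm_unit nmapE stage_genE /sub_coord /ech /=.
case: (ltngtP l i) => // li; first by rewrite ifN // neq_ltn li orbT.
by rewrite (val_inj li) eqxx.
Qed.

Lemma eps_gen_diff (C : igdalg) b bP x : dif C (@eps_gen C b bP x) = 0.
Proof.
rewrite -dmd; move: x; apply: forms_ind => [|a x y hx hy||x y hx hy|l c|l c].
- by rewrite !linear0.
- by rewrite linearP linearP /= hx hy scaler0 addr0.
- by rewrite gd_diff1 linear0.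
- by rewrite gi_leibniz linearD !dmM hx hy qmul0r qmulr0 addr0.
- rewrite -nt_ord dmd eps_genE /unit_coord.
  by case: ifP => _; rewrite ?gd_diff1 ?linear0.
by rewrite gd_diffK linear0.
Qed.

(** The map of the join which stage j covers ([blowup_stage]): the coordinates of the factors before
    j are kept, and the total mass of the other factors is moved to p. *)
Definition jstage_val j (q : vt v) : T :=
  if (j <= i)%N then
    if (tag q < j)%N then jx q else
    if q == p then \sum_(q' : vt v | (j <= tag q')%N) jx q' else 0
  else jx q.

Let jx_sum_hom (P : pred (vt v)) : hom T 0 (\sum_(q | P q) jx q).
Proof. by elim/big_ind: _ => [|x y|q _]; [apply: smem0 | apply: smemD | apply: jx_hom]. Qed.

Definition jstage (j : nat) : jcoords v T.
Proof.
refine (@JCoords n v T (jstage_val j) _ _).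
- move=> q; rewrite /jstage_val; case: ifP => _; last exact: jx_hom.
  case: ifP => _; first exact: jx_hom.
  by case: ifP => _; [apply: jx_sum_hom | apply: smem0].
- rewrite -(jx_sum v) /jstage_val; case: (leqP j i) => // ji.
  rewrite [RHS](bigID (fun q : vt v => (tag q < j)%N)) /=.
  rewrite [LHS](bigID (fun q : vt v => (tag q < j)%N)) /=; congr (_ + _).
    by apply: eq_bigr => q ->.
  rewrite (bigD1 p) -?leqNgt //= ltnNge ji eqxx /= [X in _ + X]big1 ?addr0.
    by apply: eq_bigl => q; rewrite -leqNgt.
  by move=> q /andP[/negbTE -> /negbTE ->].
Defined.

Lemma jstageE j q : jstage j q = jstage_val j q. Proof. by []. Qed.

Definition jcontract (x : T) : T := \sum_(j < i.+1) jhomot (jstage j) (jstage j.+1) x.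

Fact jcontract_linear : linear jcontract.
Proof.
move=> a x y; rewrite /jcontract scaler_sumr -big_split /=.
by apply: eq_bigr => j _; rewrite linearP.
Qed.
HB.instance Definition _ := GRing.isLinear.Build rat T T _ jcontract jcontract_linear.

Lemma jcontractP x : dif T (jcontract x) + jcontract (dif T x) = x - jmap (jstage 0) x.
Proof.
have last : jmap (jstage i.+1) x = x.
  rewrite -[RHS]/(dm_id T x); apply: jforms_ext => q.
  by rewrite jmapE jstageE /jstage_val ltnn.
rewrite /jcontract linear_sum -big_split /=.
rewrite (eq_bigr (fun j : 'I_i.+1 => jmap (jstage j.+1) x - jmap (jstage j) x)); last first.
  by move=> j _; apply: jhomotP.
rewrite -(big_mkord xpredT (fun j => jmap (jstage j.+1) x - jmap (jstage j) x)).
by rewrite telescope_sumr // last.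
Qed.

Lemma jcontract_hom k x : hom T k.+1 x -> hom T k (jcontract x).
Proof. by move=> hx; apply: smem_sum => j; apply: homot_hom. Qed.
Lemma jcontract_hom0 x : hom T 0 x -> jcontract x = 0.
Proof. by move=> hx; rewrite /jcontract big1 // => j _; apply: homot_hom0. Qed.

Lemma nmap_stage_cone j m : (m <= n.+1)%N -> (j <= i)%N ->
  nmap (stage j) (cone_prod v (nt (blow v)) m) =
  if (m <= j)%N then cone_prod v (nt (blow v)) m
  else if (m <= i)%N then cone_prod v (nt (blow v)) j else 0.
Proof.
move=> mn ji; rewrite cone_prod_map.
have E m' : (m' <= n.+1)%N -> (m' <= j)%N ->
    cone_prod v (fun l b => nmap (stage j) (nt (blow v) l b)) m' =
    cone_prod v (nt (blow v)) m'.
  move=> m'n m'j; apply: eq_cone_prod => // l lm.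
  by rewrite nmapE stage_genE /sub_coord /ech (leq_trans lm).
rewrite (@cone_prod_sub _ _ _ _ j i) //.
- have jn : (j <= n.+1)%N by apply: leq_trans ji (ltnW (ltn_ord _)).
  by case: ifP => mj; [rewrite E | rewrite (E j)].
- move=> l /andP[jl li]; rewrite nmapE stage_genE /sub_coord /ech.
  by rewrite ltnNge jl li /= /unit_coord eqxx.
- rewrite nmapE stage_genE /sub_coord /ech ltnn eqxx ltnNge ji /=.
  by rewrite unit_cone.
Qed.

(** At stage j the factors j <= l < i have zero base coordinates and the factors after i have zero
    cone product. In the factor i only p survives, with the cone product of the factors before j,
    which is the tail mass by [blow_val_tail]. *)
Lemma blowup_stage j q : (j <= i.+1)%N ->
  nmap (stage j) (blow_val q) = blowup v (jstage_val j q).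
Proof.
rewrite leq_eqVlt => /predU1P[->|]; first by rewrite stage_last /jstage_val ltnn blowupE.
rewrite ltnS => ji; case: q => l c; rewrite /blow_val dmM /jstage_val ji [tag (existT _ _ _)]/= [tagged (existT _ _ _)]/=.
rewrite nmap_stage_cone ?(ltnW (ltn_ord l)) // nmapE stage_genE /sub_coord /ech.
case: (ltnP l j) => lj; first by rewrite ltnW // blowupE.
have tailE : blowup v (\sum_(q' : vt v | (j <= tag q')%N) jx q') = cone_prod v (nt (blow v)) j.
  rewrite linear_sum -blow_val_tail; last exact: leq_trans ji (ltnW (ltn_ord _)).
  by apply: eq_bigr => q' _; apply: blowupE.
have ne : l != i -> (Tagged (fun l => 'I_(v l)) c == p) = false.
  by move=> /negbTE li; rewrite vt_eqE /= li.
case: (ltngtP l i) => li.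
- have -> : unit_coord B c (v l) = 0 by rewrite /unit_coord ltn_eqF.
  by rewrite qmulr0 ne ?linear0 // -val_eqE ltn_eqF.
- have -> : (l <= j)%N = false by apply/negbTE; rewrite -ltnNge (leq_ltn_trans ji).
  by rewrite qmul0r ne ?linear0 // -val_eqE gtn_eqF.
- have lE : (l == i) = true by apply/eqP/val_inj.
  have -> : (Tagged (fun l => 'I_(v l)) c == p) = (c == tagged p :> nat).
    by rewrite vt_eqE /= lE.
  have -> : (if (l <= j)%N then cone_prod v (nt (blow v)) l else cone_prod v (nt (blow v)) j)
      = cone_prod v (nt (blow v)) j.
    by case: (leqP l j) => // h; congr cone_prod; apply/eqP; rewrite eqn_leq h.
  rewrite lE /unit_coord; case: ifP => _; first by rewrite tailE qmulr1.
  by rewrite qmulr0 linear0.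
Qed.

End Contraction.

Lemma aff_mulr (B : igdalg) (a b c : B) : aff (a ** c) (b ** c) = aff a b ** path_cst B c.
Proof.
rewrite pathM /= qmulr0 qmul0r addr0; congr pair.
have pconstMr (q : pser B) k : (q ** pconst c) k = q k ** c.
  rewrite pserM big_ord_recr /= subnn big1 ?add0r // => l _.
  by rewrite /pconst subn_eq0 leqNgt ltn_ord qmulr0.
apply/funext => -[|[|k]]; rewrite pconstMr //= ?qmul0r // qmulDl -!scaleN1r.
by rewrite qscaleAl.
Qed.

(** If both arguments moved, the product would be quadratic in l; hence the stages which move a
    single factor. *)
Lemma affM (B : igdalg) (a a' b b' : B) : a = a' \/ b = b' ->
  aff (a ** b) (a' ** b') = aff a a' ** aff b b'.
Proof.
by case=> <-; rewrite aff_cst; [apply: aff_mull | apply: aff_mulr].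
Qed.

Section ContractionBlowUp.
Variables (n : nat) (v : 'I_n.+1 -> nat) (p : vt v).
Hypothesis v_reg : (0 < v ord_max)%N.
Local Notation B := (forms_ig (blow v)).
Local Notation T := (jforms v).
Local Notation i := (tag p).

Lemma stage_nat j (l : 'I_n.+1) c : l != j :> nat -> stage p j l c = stage p j.+1 l c.
Proof.
move=> lj; rewrite !stageE /sub_coord /ech ltnS [in RHS]leq_eqVlt.
by rewrite (negbTE lj).
Qed.

Lemma ninterp_cone j m : (m <= n.+1)%N ->
  ninterp (stage p j) (stage p j.+1) (cone_prod v (nt (blow v)) m) =
  aff (nmap (stage p j) (cone_prod v (nt (blow v)) m))
      (nmap (stage p j.+1) (cone_prod v (nt (blow v)) m)).
Proof.
elim: m => [|m IH] mn; first by rewrite cone_prod0 !dm1 aff_cst dm1.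
rewrite cone_prodS !dmM IH ?(ltnW mn) // ninterpE !nmapE affM //.
case: (eqVneq m j) => [e|mj]; [left|right]; last by apply: stage_nat; rewrite inordK.
rewrite !cone_prod_map; apply: eq_cone_prod => [|l lm]; first exact: ltnW.
by rewrite !nmapE !stageE /sub_coord /ech -e lm (leqW lm).
Qed.

(** [blow_val q] is a product of coordinates of distinct factors, hence affine in the only factor
    that moves. *)
Lemma ninterp_blow j q :
  ninterp (stage p j) (stage p j.+1) (blow_val q) =
  aff (nmap (stage p j) (blow_val q)) (nmap (stage p j.+1) (blow_val q)).
Proof.
rewrite /blow_val !dmM ninterp_cone ?(ltnW (ltn_ord _)) // ninterpE !nmapE affM //.
case: (eqVneq (tag q : nat) j) => [lj|lj]; [left|right]; last exact: stage_nat.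
rewrite !cone_prod_map; apply: eq_cone_prod => [|l lm]; first exact: ltnW.
by rewrite !nmapE !stageE /sub_coord /ech -lj lm (leqW lm).
Qed.

(** Each summand is the integral of a DGA map to paths. On a join coordinate both paths are affine
    by [ninterp_blow], with the same ends by [blowup_stage]. *)
Lemma blowup_contract x : blowup v (jcontract p x) = contract p (blowup v x).
Proof.
rewrite linear_sum; apply: eq_bigr => j _; have ji := ltn_ord j.
rewrite [LHS]jhomot_map [RHS]nhomotE; congr path_int.
rewrite -[LHS]/(dm_comp (path_map (blowup v)) (jinterp (jstage p j) (jstage p j.+1)) x).
rewrite -[RHS]/(dm_comp (ninterp (stage p j) (stage p j.+1)) (blowup v) x).
apply: jforms_ext => q; rewrite !dm_compE jinterpE aff_map blowupE !jstageE.
by rewrite -!blowup_stage ?ninterp_blow //; exact: ltnW.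
Qed.

Lemma eps_blowup x : eps p v_reg (blowup v x) = jmap (jstage p 0) x.
Proof.
rewrite -dm_compE; apply: jforms_ext => -[l c].
rewrite dm_compE jmapE blowupE jstageE /blow_val dmM cone_prod_map /jstage_val.
rewrite [tag (existT _ _ _)]/= [tagged (existT _ _ _)]/= /=.
rewrite (@cone_prod_sub _ v _ _ 0 i) ?(ltnW (ltn_ord l)) //; first last.
- by rewrite eps_genE ltnn eqxx unit_cone.
- by move=> l' /andP[_ li]; rewrite eps_genE li /unit_coord eqxx.
have -> : \sum_(q' : vt v | (0 <= tag q')%N) jx q' = qone by rewrite -(jx_sum v).
rewrite cone_prod0 eps_genE vt_eqE /=.
case: (ltngtP l i) => li.
- by rewrite /unit_coord ltn_eqF // qmulr0 -val_eqE ltn_eqF.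
- by rewrite leqNgt (leq_ltn_trans _ li) //= qmul0r -val_eqE gtn_eqF.
have -> : l == i by apply/eqP/val_inj.
case: (posnP l) => [->|l0]; first by rewrite cone_prod0 qmul1r.
by rewrite leqNgt l0 /= qmul1r.
Qed.

End ContractionBlowUp.

Section ContractionNaturality.
Variables (n : nat) (u v : 'I_n.+1 -> nat) (f : mor u v).

Definition bpull : dga_map (forms_ig (blow v)) (forms_ig (blow u)) := dpull (blow_mor f).

Lemma blow_mor_cone l (x : 'I_(blow u l)) : x = u l :> nat -> blow_mor f l x = v l :> nat.
Proof.
rewrite /blow_mor /= /incr_join_fun; case: splitP => y /= -> e.
  by move: (ltn_ord y); rewrite e ltnn.
by move: e; rewrite -[in RHS](addn0 (u l)) => /addnI ->; rewrite addn0.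
Qed.

Lemma blow_mor_base l (x : 'I_(blow u l)) (a : 'I_(u l)) : x = a :> nat ->
  blow_mor f l x = f l a :> nat.
Proof.
rewrite /blow_mor /= /incr_join_fun; case: splitP => y /= -> e.
  by congr (nat_of_ord (f l _)); apply: val_inj.
by move: (ltn_ord a); rewrite -e ltnNge leq_addr.
Qed.

Lemma unit_fiber (B : igdalg) a b (g : incr a b) (d : 'I_a) c :
  \sum_(x : 'I_a | g x == c :> nat) unit_coord B x d = unit_coord B c (g d).
Proof.
rewrite big_mkcond (bigD1 d) //= big1 => [|x xd]; last first.
  by rewrite /unit_coord (inj_eq val_inj) (negbTE xd); case: ifP.
by rewrite addr0 /unit_coord eqxx eq_sym.
Qed.

(** A face map sends cone points to cone points and p to [fvert f p], so the stages towards these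
    two vertices correspond. *)
Lemma bpull_stage (p : vt u) j l c :
  bpull (stage (fvert f p) j l c) =
  \sum_(a : 'I_(blow u l) | blow_mor f l a == c :> nat) stage p j l a.
Proof.
rewrite stageE /sub_coord /ech [tag (fvert _ _)]/= [tagged (fvert _ _)]/=.
case: (ltnP l j) => lj.
  under [RHS]eq_bigr => a _ do rewrite stageE /sub_coord /ech lj.
  exact: dpull_nt.
case: (ltngtP l (tag p)) => li.
- under [RHS]eq_bigr => a _ do rewrite stageE /sub_coord /ech ltnNge lj li /=.
  have ln : (l < n)%N by rewrite (leq_trans li) // -ltnS.
  have h : (u l < blow u l)%N by rewrite blow_lt.
  by rewrite (unit_fiber _ _ (Ordinal h)) (@blow_mor_cone l (Ordinal h)) // dm_unit.
- rewrite ifN ?neq_ltn ?li ?orbT // [LHS]dpull_nt.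
  apply: eq_bigr => a _; rewrite stageE /sub_coord /ech ltnNge lj /= ltnNge (ltnW li) /=.
  by rewrite ifN // neq_ltn li orbT.
have {}li : tag p = l by apply/esym/val_inj.
case: _ / li in c lj *; rewrite eqxx dm_unit.
have h : (tagged p < blow u (tag p))%N by apply: leq_trans (ltn_ord _) (blow_ge u _).
rewrite -(@blow_mor_base (tag p) (Ordinal h)) // -(unit_fiber _ _ (Ordinal h)).
by apply: eq_bigr => a _; rewrite stageE /sub_coord /ech ltnNge lj /= ltnn eqxx.
Qed.

Lemma bpull_contract p x : bpull (contract (fvert f p) x) = contract p (bpull x).
Proof.
rewrite linear_sum; apply: eq_bigr => j _; have ji := ltn_ord j.
rewrite [LHS]nhomot_map [RHS]nhomotE; congr path_int.
set N := ninterp _ _; set N' := ninterp _ _.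
rewrite -[LHS]/(dm_comp (path_map bpull) N x) -[RHS]/(dm_comp N' bpull x).
apply: nt_ext => l c _; rewrite !dm_compE /N ninterpE aff_map [bpull (nt _ _ _)]dpull_nt.
rewrite linear_sum /=.
under [RHS]eq_bigr => a _ do rewrite /N' ninterpE.
by rewrite aff_sum -!bpull_stage.
Qed.

Lemma jpull_stage (p : vt u) j q :
  jpull f (jstage_val (fvert f p) j q) = \sum_(q' | fvert f q' == q) jstage_val p j q'.
Proof.
rewrite /jstage_val /=; case: (leqP j (tag p)) => ji; last exact: jpullE.
case: (ltnP (tag q) j) => qj.
  rewrite jpullE; apply: eq_bigr => q' /eqP e.
  by rewrite -[tag q']/(tag (fvert f q')) e qj.
have E q' : fvert f q' == q -> (tag q' < j)%N = false.
  by move=> /eqP e; rewrite -[tag q']/(tag (fvert f q')) e ltnNge qj.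
rewrite (eq_bigr (fun q' => if q' == p then \sum_(q'' : vt u | (j <= tag q'')%N) jx q''
  else 0)); last by move=> q' /E ->.
case: eqP => [->|qp]; last first.
  rewrite linear0 big1 // => q' /eqP e; rewrite ifN //.
  by apply/eqP => q'p; apply: qp; rewrite -e q'p.
rewrite (big_pred1 p) ?eqxx => [|q']; last by rewrite /= (inj_eq (@fvert_inj _ _ _ f)).
rewrite linear_sum /= [RHS](partition_big (fvert f) (fun q => (j <= tag q)%N)) //=.
apply: eq_bigr => q' jq'; rewrite jpullE; apply: eq_bigl => q''.
case: eqP => [e|]; last by rewrite andbF.
by rewrite -[tag q'']/(tag (fvert f q'')) e jq'.
Qed.

Lemma jpull_contract p x : jpull f (jcontract (fvert f p) x) = jcontract p (jpull f x).
Proof.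
rewrite linear_sum; apply: eq_bigr => j _; have ji := ltn_ord j.
rewrite [LHS]jhomot_map [RHS]jhomotE; congr path_int.
set N := jinterp _ _; set N' := jinterp _ _.
rewrite -[LHS]/(dm_comp (path_map (jpull f)) N x) -[RHS]/(dm_comp N' (jpull f) x).
apply: jforms_ext => q; rewrite !dm_compE /N jinterpE aff_map jpullE linear_sum.
rewrite [RHS](eq_bigr (fun q' => aff (jstage_val p j q') (jstage_val p j.+1 q'))).
  by rewrite aff_sum !jstageE !jpull_stage.
by move=> q' _; rewrite /N' [LHS]jinterpE !jstageE.
Qed.

Hypotheses (u_reg : (0 < u ord_max)%N) (v_reg : (0 < v ord_max)%N).

(** The vertices 0 chosen by [eps] in the later factors are not preserved: f carries them to the
    vertices b. [gcond] makes the evaluation independent of this choice ([eps_gen_indep]). *)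
Lemma jpull_eps p x : gcond x ->
  jpull f (eps (fvert f p) v_reg x) = eps p u_reg (bpull x).
Proof.
move=> gx.
pose b l : nat := blow_mor f l (Ordinal (blow_gt0 u_reg l)).
have bP (l : 'I_n.+1) : (tag (fvert f p) < l)%N -> (b l < blow v l)%N by move=> _; apply: ltn_ord.
have z (l : 'I_n.+1) : (tag (fvert f p) < l)%N -> (0 < blow v l)%N by move=> _; apply: blow_gt0.
pose d (l : 'I_n.+1) : nat := if (l < tag p)%N then u l else if l == tag p then tagged p : nat else 0%N.
have dP l : (d l < blow u l)%N.
  rewrite /d; case: (ltnP l (tag p)) => li; first by rewrite blow_lt // (leq_trans li) // -ltnS.
  case: eqP => [->|_]; last exact: blow_gt0.
  exact: leq_trans (ltn_ord _) (blow_ge u _).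
have -> : eps p u_reg (bpull x) = @eps_gen n v (fvert f p) (jforms u) b bP x.
  rewrite -dm_compE; apply: nt_ext => l c _; rewrite dm_compE eps_genE dpull_nt.
  rewrite linear_sum /=.
  under eq_bigr => a _ do rewrite eps_genE.
  transitivity (unit_coord (jforms u) c (blow_mor f l (Ordinal (dP l)))).
    refine (unit_fiber (jforms u) (blow_mor f l) (Ordinal (dP l)) c).
  apply: (congr1 (unit_coord (jforms u) c)).
  case: (ltngtP l (tag p)) => li.
  - by apply: blow_mor_cone; rewrite -[LHS]/(d l) /d li.
  - have lp : (l == tag p) = false by rewrite -val_eqE gtn_eqF.
    rewrite lp; congr (nat_of_ord (blow_mor f l _)); apply: val_inj.
    by rewrite -[LHS]/(d l) /d ltnNge (ltnW li) lp.
  rewrite (val_inj li) eqxx; apply: blow_mor_base.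
  by rewrite -[LHS]/(d (tag p)) /d ltnn eqxx.
rewrite (@eps_gen_indep _ _ _ _ b bP (fun=> 0%N) z x gx) -dm_compE.
apply: nt_ext => l c _; by rewrite dm_compE !eps_genE dm_unit.
Qed.

Lemma bpull_blowup x : bpull (blowup v x) = blowup u (jpull f x).
Proof.
rewrite -[LHS]/(dm_comp bpull (blowup v) x) -[RHS]/(dm_comp (blowup u) (jpull f) x).
apply: jforms_ext => -[l c]; rewrite !dm_compE blowupE jpullE linear_sum.
rewrite [RHS](eq_bigr (@blow_val n u)) => [|q _]; last exact: blowupE.
rewrite /blow_val dmM [tag (existT _ _ _)]/= [tagged (existT _ _ _)]/= cone_prod_map.
have coneE : cone_prod v (fun l b => bpull (nt (blow v) l b)) l = cone_prod u (nt (blow u)) l.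
  rewrite /cone_prod !big_nat; apply: eq_bigr => k /andP[_ kl].
  have kn : (k < n)%N by rewrite (leq_trans kl) // -ltnS.
  set k' := inord k : 'I_n.+1; have k'n : (k' < n)%N by rewrite inordK // ltnW.
  have h : (u k' < blow u k')%N by rewrite blow_lt.
  have e := @blow_mor_cone k' (Ordinal h) erefl.
  rewrite [bpull _]dpull_nt (big_pred1 (Ordinal h)) // => a.
  apply/eqP/eqP => [ea|->]; last exact: e.
  apply/(@incr_inj _ _ (blow_mor f k'))/val_inj.
  exact: etrans ea (esym e).
rewrite coneE [bpull _]dpull_nt qmul_sumr.
transitivity (\sum_(a : 'I_(u l) | f l a == c :> nat) cone_prod u (nt (blow u)) l ** nt (blow u) l a).
  rewrite /blow big_split_ord /= [X in _ + X]big_pred0 ?addr0 => [|a].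
    apply: eq_big => [a|a _] //=.
    by have /= -> := @blow_mor_base l (lshift (l < n)%N a) a erefl.
  apply/negbTE; rewrite neq_ltn; apply/orP; right.
  rewrite /incr_join_fun; case: splitP => y /= e; last exact: leq_trans (ltn_ord c) (leq_addr _ _).
  by move: (ltn_ord y); rewrite -e ltnNge leq_addr.
transitivity (\sum_(l' | l' == l) \sum_(a : 'I_(u l') | f l' a == c :> nat)
    cone_prod u (nt (blow u)) l' ** nt (blow u) l' a).
  by rewrite big_pred1_eq.
rewrite (sig_big_dep (fun l' => l' == l) (fun l' (a : 'I_(u l')) => f l' a == c :> nat)
  (fun l' (a : 'I_(u l')) => cone_prod u (nt (blow u)) l' ** nt (blow u) l' a)).
by apply: eq_bigl => q; rewrite vt_eqE.
Qed.

End ContractionNaturality.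

(** * Gluing of contractions *)

(* Local contractions h_a, one for each vertex a, are glued by means of the
   barycentric coordinates T_a and their differentials E_a: with
   D_0 = id, D_(k+1) = sum_a E_a D_k h_a and S_k = sum_a T_a D_k h_a
   one has d S_k + S_k d = D_(k+1) + D_k. *)
Section Glue.
Variables (I : finType) (W : lmodType rat) (d : {linear W -> W}).
Variables (T E h : I -> {linear W -> W}) (S : submod W).
Hypothesis Sh : forall a x, S x -> S (h a x).
Hypothesis dT : forall a x, d (T a x) = E a x + T a (d x).
Hypothesis dE : forall a x, d (E a x) = - E a (d x).
Hypothesis sumT : forall x, \sum_a T a x = x.
Hypothesis sumE : forall x, \sum_a E a x = 0.
Hypothesis hP : forall a x, S x -> d (h a x) + h a (d x) = x.

Fixpoint glueD k x : W := if k is k'.+1 then \sum_a E a (glueD k' (h a x)) else x.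
Definition glueS k x : W := \sum_a T a (glueD k (h a x)).
Definition glue N x : W := \sum_(k < N) (-1) ^+ k *: glueS k x.

Lemma glueD_linear k : linear (glueD k).
Proof.
elim: k => [//|k IH] a x y /=; rewrite scaler_sumr -big_split /=.
by apply: eq_bigr => b _; rewrite linearP IH linearP.
Qed.

Lemma glueDB k x y : glueD k (x - y) = glueD k x - glueD k y.
Proof. by rewrite addrC -scaleN1r glueD_linear scaleN1r addrC. Qed.

Lemma glueD_zero k : glueD k 0 = 0.
Proof. by have := glueDB k 0 0; rewrite !subrr. Qed.

(** With d h_a = 1 - h_a d, the identity parts contribute the E_a D_k x, whose sum is 0; so each D_k
    is a chain map. *)
Lemma glueD_d k x : S x -> d (glueD k x) = glueD k (d x).
Proof.
elim: k x => [//|k IH] x Sx /=; rewrite linear_sum /=.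
transitivity (\sum_a (E a (glueD k (h a (d x))) - E a (glueD k x))).
  apply: eq_bigr => a _; rewrite dE IH; last exact: Sh.
  have -> : d (h a x) = x - h a (d x) by apply/eqP; rewrite eq_sym subr_eq hP.
  by rewrite glueDB linearB /= opprB.
by rewrite sumrB sumE subr0.
Qed.

Lemma glueSP k x : S x -> d (glueS k x) + glueS k (d x) = glueD k.+1 x + glueD k x.
Proof.
move=> Sx; rewrite /glueS linear_sum -big_split /=.
rewrite -[X in _ = _ + X]sumT -big_split /=; apply: eq_bigr => a _.
rewrite dT glueD_d; last exact: Sh.
rewrite -addrA; congr (_ + _).
rewrite -linearD /=; congr (T a _).
have -> : d (h a x) = x - h a (d x) by apply/eqP; rewrite eq_sym subr_eq hP.
by rewrite glueDB subrK.
Qed.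

(** The alternating sum of the identities [glueSP] telescopes to x, up to a multiple of D_N x. *)
Lemma glueP N x : S x -> glueD N x = 0 -> d (glue N x) + glue N (d x) = x.
Proof.
move=> Sx DN; have : d (glue N x) + glue N (d x) = x - (-1) ^+ N *: glueD N x.
  rewrite /glue linear_sum -big_split /= {DN}.
  rewrite (eq_bigr (fun k : 'I_N => (-1) ^+ k *: (glueD k.+1 x + glueD k x))); last first.
    by move=> k _; rewrite linearZ -scalerDr glueSP.
  elim: N => [|N IH]; first by rewrite big_ord0 scale1r subrr.
  rewrite big_ord_recr /= IH scalerDr exprS mulN1r scaleNr opprK.
  by rewrite [X in _ + X]addrC addrA subrK.
by rewrite DN scaler0 subr0.
Qed.

Lemma glueS_sub k x : (forall a x, S x -> S (T a x)) -> (forall a x, S x -> S (E a x)) ->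
  S x -> S (glueS k x).
Proof.
move=> ST SE Sx; apply: smem_sum => a; apply: ST.
elim: k (h a x) (Sh a Sx) => [//|k IH] y Sy /=.
by apply: smem_sum => b; apply/SE/IH/Sh.
Qed.

Lemma glue_sub N x : (forall a x, S x -> S (T a x)) -> (forall a x, S x -> S (E a x)) ->
  S x -> S (glue N x).
Proof. by move=> ST SE Sx; apply: smem_sum => k; apply/smemZ/glueS_sub. Qed.

Variable hom : nat -> submod W.
Hypothesis hom_h : forall a k x, hom k.+1 x -> hom k (h a x).
Hypothesis hom_h0 : forall a x, hom 0 x -> h a x = 0.
Hypothesis hom_T : forall a k x, hom k x -> hom k (T a x).
Hypothesis hom_E : forall a k x, hom k x -> hom k.+1 (E a x).

Lemma glueD_0 k x : hom 0 x -> glueD k.+1 x = 0.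
Proof.
move=> hx; rewrite /= big1 // => a _; rewrite hom_h0 //.
by rewrite glueD_zero linear0.
Qed.

(** [glueD k] applies k contractions before any E_a, each lowering the degree by one. This is where
    the number of terms of [glue] comes from. *)
Lemma glueD_high k q x : hom q x -> (q < k)%N -> glueD k x = 0.
Proof.
elim: k q x => [|k IH] [|q] x hx //= qk; first exact: glueD_0 hx.
by rewrite big1 // => a _; rewrite (IH q) ?linear0 //; apply: hom_h.
Qed.

Lemma glueD_hom k q x : hom q x -> hom q (glueD k x).
Proof.
elim: k q x => [//|k IH] [|q] x hx; first by rewrite glueD_0 //; apply: smem0.
by apply: smem_sum => a; apply/hom_E/IH/hom_h.
Qed.

Lemma glue_hom N q x : hom q.+1 x -> hom q (glue N x).
Proof.
move=> hx; apply: smem_sum => k; apply: smemZ; apply: smem_sum => a.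
by apply/hom_T/glueD_hom/hom_h.
Qed.

Lemma glue_hom0 N x : hom 0 x -> glue N x = 0.
Proof.
move=> hx; rewrite /glue big1 // => k _; rewrite /glueS big1 ?scaler0 // => a _.
by rewrite hom_h0 // glueD_zero linear0.
Qed.

End Glue.

Section GlueNaturality.
Variables (I I' : finType) (W W' : lmodType rat) (g : I -> I') (R : {linear W' -> W}).
Variables (T E h : I -> {linear W -> W}) (T' E' h' : I' -> {linear W' -> W'}).
Variable S' : submod W'.
Hypothesis Sh' : forall a x, S' x -> S' (h' a x).
Hypothesis RT : forall b z, R (T' b z) = \sum_(a | g a == b) T a (R z).
Hypothesis RE : forall b z, R (E' b z) = \sum_(a | g a == b) E a (R z).
Hypothesis Rh : forall a z, S' z -> R (h' (g a) z) = h a (R z).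

(** For a vertex b outside the face the sums in [RT] and [RE] are empty, so only the contractions to
    vertices of the face, which are natural by [Rh], contribute. *)
Lemma glueD_nat k z : S' z -> R (glueD E' h' k z) = glueD E h k (R z).
Proof.
elim: k z => [//|k IH] z Sz /=; rewrite linear_sum [RHS](partition_big g predT) //=.
apply: eq_bigr => b _; rewrite RE; apply: eq_bigr => a /eqP <-.
by rewrite IH ?Rh //; apply: Sh'.
Qed.

Lemma glueS_nat k z : S' z -> R (glueS T' E' h' k z) = glueS T E h k (R z).
Proof.
move=> Sz; rewrite linear_sum [RHS](partition_big g predT) //=.
apply: eq_bigr => b _; rewrite RT; apply: eq_bigr => a /eqP <-.
by rewrite glueD_nat ?Rh //; apply: Sh'.
Qed.

Lemma glue_nat N z : S' z -> R (glue T' E' h' N z) = glue T E h N (R z).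
Proof.
move=> Sz; rewrite /glue linear_sum; apply: eq_bigr => k _.
by rewrite linearZ /= glueS_nat.
Qed.

End GlueNaturality.

(** * The mapping cone of the blow-up map *)

Section Cone.
Variables (n : nat) (v : 'I_n.+1 -> nat) (v_reg : (0 < v ord_max)%N).
Local Notation B := (forms_ig (blow v)).
Local Notation T := (jforms v).

(* the mapping cone of the pullback of forms along the blow-up *)
Definition cone : Type := (T * B)%type.
HB.instance Definition _ := GRing.Lmodule.on cone.
Implicit Type z : cone.

Definition cone_d z : cone := (- dif T z.1, blowup v z.1 + dif B z.2).
Fact cone_d_linear : linear cone_d.
Proof.
move=> a [x y] [x' y']; congr pair; first by rewrite /= linearP opprD scalerN.
by rewrite /= !linearP /= scalerDr addrACA.
Qed.
HB.instance Definition _ := GRing.isLinear.Build rat cone cone _ cone_d cone_d_linear.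

Definition cone_t (p : vt v) z : cone := (jx p ** z.1, blowup v (jx p) ** z.2).
Fact cone_t_linear p : linear (cone_t p).
Proof.
by move=> a [x y] [x' y']; congr pair; rewrite /= qmulDr -qscaleAr.
Qed.
HB.instance Definition _ p :=
  GRing.isLinear.Build rat cone cone _ (cone_t p) (cone_t_linear p).

Definition cone_e (p : vt v) z : cone :=
  (- (dif T (jx p) ** z.1), blowup v (dif T (jx p)) ** z.2).
Fact cone_e_linear p : linear (cone_e p).
Proof.
move=> a [x y] [x' y']; congr pair; last by rewrite /= qmulDr -qscaleAr.
by rewrite /= qmulDr opprD -qscaleAr -scalerN.
Qed.
HB.instance Definition _ p :=
  GRing.isLinear.Build rat cone cone _ (cone_e p) (cone_e_linear p).

(** [contract] and [jcontract] leave as errors the evaluations at p. The off-diagonal term [eps]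
    produces the same evaluations through the differential of the cone and cancels them
    ([cone_hP]). *)
Definition cone_h (p : vt v) z : cone :=
  (eps p v_reg z.2 - jcontract p z.1, contract p z.2).
Fact cone_h_linear p : linear (cone_h p).
Proof.
move=> a [x y] [x' y']; congr pair; last by rewrite /= linearP.
by rewrite /= !linearP /= scalerBr scalerN addrACA.
Qed.
HB.instance Definition _ p :=
  GRing.isLinear.Build rat cone cone _ (cone_h p) (cone_h_linear p).

Definition cone_sub : submod cone.
Proof.
exists (fun z => gcond z.2) => [|a z z' hz hz']; first exact: gcond0.
exact: gcondP.
Defined.

Definition cone_hom (k : nat) : submod cone.
Proof.
exists (fun z => hom T k z.1 /\ hom_pred B k z.2) => [|a z z' [h1 h2] [h1' h2']].
  by split; apply: smem0.
by split; apply: smemP.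
Defined.

Lemma jx_inv p : gi T (jx p) = jx p :> T.
Proof. by rewrite (gi_hom (jx_hom p)) scale1r. Qed.
Lemma djx_inv p : gi T (dif T (jx p)) = - dif T (jx p) :> T.
Proof. by rewrite (gi_hom (gd_hom_diff (jx_hom p))) scaleN1r. Qed.

Let mulrNq (A : qalgType) (x y : A) : x ** - y = - (x ** y).
Proof. by rewrite -scaleN1r -qscaleAr scaleN1r. Qed.
Let mulNrq (A : qalgType) (x y : A) : - x ** y = - (x ** y).
Proof. by rewrite -scaleN1r -qscaleAl scaleN1r. Qed.

Lemma cone_dt p z : cone_d (cone_t p z) = cone_e p z + cone_t p (cone_d z).
Proof.
case: z => x y; congr pair.
  change (- dif T (jx p ** x) = - (dif T (jx p) ** x) + jx p ** - dif T x).
  by rewrite gi_leibniz jx_inv opprD mulrNq.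
change (blowup v (jx p ** x) + dif B (blowup v (jx p) ** y) =
  blowup v (dif T (jx p)) ** y + blowup v (jx p) ** (blowup v x + dif B y)).
by rewrite dmM gi_leibniz -dmi jx_inv -dmd qmulDr addrCA.
Qed.

Lemma cone_de p z : cone_d (cone_e p z) = - cone_e p (cone_d z).
Proof.
case: z => x y; congr pair.
  change (- dif T (- (dif T (jx p) ** x)) = - - (dif T (jx p) ** - dif T x)).
  by rewrite linearN !opprK gi_leibniz gd_diffK qmul0r add0r djx_inv mulNrq mulrNq.
change (blowup v (- (dif T (jx p) ** x)) + dif B (blowup v (dif T (jx p)) ** y) =
  - (blowup v (dif T (jx p)) ** (blowup v x + dif B y))).
rewrite linearN dmM gi_leibniz -[dif B (blowup v _)]dmd gd_diffK linear0 qmul0r add0r.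
by rewrite -dmi djx_inv linearN mulNrq qmulDr opprD.
Qed.

Lemma cone_sum_pair (J : finType) (F : J -> cone) :
  \sum_j F j = (\sum_j (F j).1, \sum_j (F j).2) :> cone.
Proof.
apply: (big_ind3 (fun z x y => z = (x, y))) => // [z x y z' x' y' -> -> //|j _].
by case: (F j).
Qed.

Lemma cone_sum_t z : \sum_p cone_t p z = z.
Proof.
rewrite cone_sum_pair /cone_t -!qmul_suml -linear_sum jx_sum dm1 !qmul1r.
by case: z.
Qed.

Lemma cone_sum_e z : \sum_p cone_e p z = 0.
Proof.
rewrite cone_sum_pair /cone_e sumrN -!qmul_suml -!linear_sum jx_sum gd_diff1 linear0.
by rewrite !qmul0r oppr0.
Qed.

Lemma cone_hP p z : cone_sub z -> cone_d (cone_h p z) + cone_h p (cone_d z) = z.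
Proof.
case: z => x y gy; have {}gy : gcond y := gy; congr pair.
  have e0 : dif T (eps p v_reg y) = 0 by exact: eps_gen_diff.
  have e1 : eps p v_reg (dif B y) = 0 by rewrite dmd.
  change (- dif T (eps p v_reg y - jcontract p x) +
    (eps p v_reg (blowup v x + dif B y) - jcontract p (- dif T x)) = x).
  rewrite linearB e0 sub0r opprK linearD e1 addr0 eps_blowup linearN opprK.
  by rewrite addrCA jcontractP addrC subrK.
change (blowup v (eps p v_reg y - jcontract p x) + dif B (contract p y) +
  contract p (blowup v x + dif B y) = y).
rewrite linearB blowup_contract linearD eps_stage // -addrA.
rewrite [dif B _ + _]addrCA [X in _ + (_ + X)](contractP p y).
by rewrite addrA addrNK addrC subrK.
Qed.

Lemma cone_sub_h p z : cone_sub z -> cone_sub (cone_h p z).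
Proof. exact: gcond_contract. Qed.
Lemma cone_sub_t p z : cone_sub z -> cone_sub (cone_t p z).
Proof. by move=> hz; apply: gcondM => //; apply: gcond_blowup. Qed.
Lemma cone_sub_e p z : cone_sub z -> cone_sub (cone_e p z).
Proof. by move=> hz; apply: gcondM => //; apply: gcond_blowup. Qed.

Lemma cone_hom_h p k z : cone_hom k.+1 z -> cone_hom k (cone_h p z).
Proof.
case: z => x y [hx hy]; split.
  change (hom T k (eps p v_reg y - jcontract p x)).
  rewrite addrC -scaleN1r; apply: smemP; first exact: jcontract_hom.
  exact: dm_hom.
case: k hx hy => [|k] hx hy; last exact: contract_hom.
have -> : (cone_h p (x, y)).2 = 0 by apply: contract_hom0.
exact: smem0.
Qed.

Lemma cone_hom_h0 p z : cone_hom 0 z -> cone_h p z = 0.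
Proof.
case: z => x y [hx /hom_pred0 /= y0]; rewrite /cone_h y0 !linear0 sub0r.
by rewrite jcontract_hom0 // oppr0.
Qed.

Lemma cone_hom_t p k z : cone_hom k z -> cone_hom k (cone_t p z).
Proof.
case: z => x y [hx hy]; split; first exact: (@gd_homM T 0 k _ _ (jx_hom p)).
exact: (@hom_predMl B 0 k _ _ (dm_hom (blowup v) (jx_hom p))).
Qed.

Lemma cone_hom_e p k z : cone_hom k z -> cone_hom k.+1 (cone_e p z).
Proof.
have hd := gd_hom_diff (jx_hom p).
case: z => x y [hx hy]; split.
  by rewrite -[_.1]scaleN1r; apply: smemZ; apply: (@gd_homM T 1 k _ _ hd).
exact: (@hom_predMl B 1 k _ _ (dm_hom (blowup v) hd)).
Qed.

End Cone.

(** * Norm conditions of perversity 0 and acyclicity over K_+ *)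

Section NormZero.
Variables (n : nat) (v : 'I_n.+1 -> nat).
Hypothesis v_reg : (0 < v ord_max)%N.

Lemma perv_val0 (l : 'I_n.+1) : perv_val (perv0 n) l = 0%E.
Proof. by rewrite /perv_val /= ffunE. Qed.

(** [collapse_fix], which uses the bounds on both x and dx, gives one direction. Conversely
    collapsed forms have no component of positive degree, and [gcond] passes to dx. *)
Lemma norm_le0_gcond (x : forms (blow v)) :
  (forall l : 'I_n.+1, (0 < l)%N ->
     form_norm_le l (perv_val (perv0 n) l) x /\
     form_norm_le l (perv_val (perv0 n) l) (form_diff x)) <->
  gcond (x : forms_ig (blow v)).
Proof.
have posE d : ((d%:Z)%:E <= 0 :> \bar int)%E = (d == 0%N).
  by rewrite lee_fin; case: d.
split=> [hx k kn vk b bP | gx l l0].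
  have kK : rev_ord (rev_ord k) = k by apply: rev_ordK.
  have k0 : (0 < rev_ord k)%N by rewrite /= subn_gt0.
  have [h h'] := hx _ k0; move: h h'; rewrite perv_val0 /form_norm_le kK => h h'.
  apply: collapse_fix => d d0.
    rewrite -rk_pull; apply/eqP/negPn/negP => /(h vk).
    by rewrite posE eqn0Ngt d0.
  have -> : form_diff (rk v k x) = rk v k (form_diff x) by exact/esym/(@dmd _ _ (rk v k)).
  rewrite -rk_pull; apply/eqP/negPn/negP => /(h' vk).
  by rewrite posE eqn0Ngt d0.
have kn : (rev_ord l < n)%N by rewrite /= subSS ltn_subrL l0 (leq_trans l0) // -ltnS.
have bP : sub_ok (blow_base (rev_ord l) v) (collapse (fun j => (rev_ord l < j)%N) (fun=> 0%N)).
  apply: collapse_ok => j lj; rewrite blow_base_neq; first exact: blow_gt0.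
  by rewrite -val_eqE gtn_eqF.
have key y : gcond (y : forms_ig (blow v)) -> form_norm_le l (perv_val (perv0 n) l) y.
  move=> gy vl d; rewrite perv_val0 posE rk_pull -(gy _ kn vl _ bP).
  by case: d => // d; rewrite component_collapse ?eqxx.
split; first exact: key.
exact/key/gcond_diff.
Qed.

End NormZero.

Section PlusFamilies.
Variables (n : nat) (K : filtered_face_set n).
Local Notation PS := (plus_simplex K).

Definition jplus : Type := forall s : PS, jforms (ps_obj s).
Definition bplus : Type := forall s : PS, forms_ig (blow (ps_obj s)).

Definition jplus_compat (x : jplus) : Prop :=
  forall (v v' : join_obj n) (f : mor v v') (s : K v')
      (hv : regular_obj v) (hv' : regular_obj v'),
    x (PlusSimplex (ff_face f s) hv) = jpull f (x (PlusSimplex s hv')).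

Lemma pforms0P (y : blow_families K) :
  pforms K (perv0 n) y <-> blow_compatible y /\ forall s, gcond (y s : forms_ig _).
Proof.
split=> [[cy ny]|[cy gy]]; split=> //.
  move=> s; apply/(norm_le0_gcond (ps_regular s)) => l l0.
  by have [h h'] := ny l l0; split; [apply: h | apply: h'].
move=> l l0.
by split=> s; have /(norm_le0_gcond (ps_regular s))/(_ l l0)[] := gy s.
Qed.

Section ConeMap.
Variables (u v : 'I_n.+1 -> nat) (f : mor u v).
Definition cone_pull (z : cone v) : cone u := (jpull f z.1, bpull f z.2).
Fact cone_pull_linear : linear cone_pull.
Proof. by move=> a z z'; congr pair; apply: linearP. Qed.
HB.instance Definition _ :=
  GRing.isLinear.Build rat (cone v) (cone u) _ cone_pull cone_pull_linear.

Lemma cone_pull_t b z : cone_pull (cone_t b z) = \sum_(a | fvert f a == b) cone_t a (cone_pull z).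
Proof.
rewrite (big_mkcond) cone_sum_pair; congr pair.
  rewrite [LHS]dmM jpullE qmul_suml big_mkcond; apply: eq_bigr => a _.
  by case: ifP.
rewrite [LHS]dmM bpull_blowup jpullE linear_sum qmul_suml big_mkcond.
by apply: eq_bigr => a _; case: ifP.
Qed.

Lemma cone_pull_e b z : cone_pull (cone_e b z) = \sum_(a | fvert f a == b) cone_e a (cone_pull z).
Proof.
rewrite (big_mkcond) cone_sum_pair; congr pair.
  change (jpull f (- (dif (jforms v) (jx b) ** z.1)) =
    \sum_a (if fvert f a == b then cone_e a (cone_pull z) else 0).1).
  rewrite linearN dmM dmd jpullE linear_sum qmul_suml -sumrN big_mkcond.
  by apply: eq_bigr => a _; case: ifP.
rewrite [LHS]dmM bpull_blowup dmd jpullE !linear_sum qmul_suml big_mkcond.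
by apply: eq_bigr => a _; case: ifP.
Qed.

Lemma cone_pull_h (u_reg : (0 < u ord_max)%N) (v_reg : (0 < v ord_max)%N) a z :
  cone_sub v z -> cone_pull (cone_h v_reg (fvert f a) z) = cone_h u_reg a (cone_pull z).
Proof.
case: z => x y gy; congr pair; last exact: bpull_contract.
change (jpull f (eps (fvert f a) v_reg y - jcontract (fvert f a) x) =
  eps a u_reg (bpull f y) - jcontract a (jpull f x)).
by rewrite linearB (jpull_eps f u_reg) // jpull_contract.
Qed.

End ConeMap.

(** The primitive on each simplex is given by the contractions [cone_h] glued over its vertices. In
    degree q, [q.+1] terms suffice by [glueD_high], and [glue_nat] makes the primitives agree on
    faces. *)
Lemma plus_acyclic q (x : jplus) (y : bplus) :
  jplus_compat x -> blow_compatible y -> (forall s, gcond (y s)) ->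
  (forall s, cone_hom (ps_obj s) q (x s, y s)) ->
  (forall s, cone_d ((x s, y s) : cone (ps_obj s)) = 0) ->
  exists (x' : jplus) (y' : bplus),
    [/\ jplus_compat x', blow_compatible y', forall s, gcond (y' s),
        forall s, if q is q'.+1 then cone_hom (ps_obj s) q' (x' s, y' s)
                  else (x' s, y' s) = 0 &
        forall s, cone_d ((x' s, y' s) : cone (ps_obj s)) = (x s, y s)].
Proof.
move=> cx cy gy hz dz.
pose w (s : PS) : cone (ps_obj s) :=
  glue (@cone_t n (ps_obj s)) (@cone_e n (ps_obj s)) (cone_h (ps_regular s)) q.+1 (x s, y s).
have w_compat (v v' : join_obj n) (f : mor v v') (s : K v') (hv : regular_obj v) (hv' : regular_obj v') :
    w (PlusSimplex (ff_face f s) hv) = cone_pull f (w (PlusSimplex s hv')).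
  have zE : (x (PlusSimplex (ff_face f s) hv), y (PlusSimplex (ff_face f s) hv)) =
      cone_pull f (x (PlusSimplex s hv'), y (PlusSimplex s hv')) :> cone v.
    congr pair; first exact: cx.
    rewrite (cy _ _ f s hv hv'); exact/esym/dpullE.
  transitivity (glue (@cone_t n v) (@cone_e n v) (cone_h hv) q.+1
      (cone_pull f (x (PlusSimplex s hv'), y (PlusSimplex s hv')))).
    by rewrite -zE.
  apply/esym.
  apply: (@glue_nat _ _ _ _ (fvert f) (cone_pull f) _ _ (cone_h hv) _ _ (cone_h hv')
    (cone_sub v')).
  - exact: cone_sub_h.
  - exact: cone_pull_t.
  - exact: cone_pull_e.
  - exact: cone_pull_h.
  - exact: gy (PlusSimplex s hv').
exists (fun s => (w s).1), (fun s => (w s).2); split.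
- by move=> v v' f s hv hv'; rewrite (w_compat _ _ f s hv hv').
- move=> v v' f s hv hv'; rewrite (w_compat _ _ f s hv hv').
  exact: dpullE.
- move=> s; apply: (glue_sub (S := cone_sub (ps_obj s))).
  + exact: cone_sub_h.
  + exact: cone_sub_t.
  + exact: cone_sub_e.
  + exact: gy.
- move=> s; rewrite -surjective_pairing; case: q hz @w {w_compat} => [|q] hz w.
    exact: (glue_hom0 _ _ (cone_hom_h0 (ps_regular s)) 1 (hz s)).
  exact: (glue_hom (cone_hom_h (ps_regular s)) (cone_hom_h0 (ps_regular s))
    (@cone_hom_t n _) (@cone_hom_e n _) q.+2 (hz s)).
move=> s; rewrite -surjective_pairing.
have gz : cone_sub (ps_obj s) (x s, y s) := gy s.
have D0 := glueD_high (@cone_e n (ps_obj s)) (cone_hom_h (ps_regular s))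
  (cone_hom_h0 (ps_regular s)) (hz s) (ltnSn q).
have G : cone_d (w s) + glue (@cone_t n _) (@cone_e n _) (cone_h (ps_regular s)) q.+1
    (cone_d ((x s, y s) : cone (ps_obj s))) = (x s, y s).
  have G := glueP (@cone_sub_h n _ (ps_regular s)) (@cone_dt n _) (@cone_de n _)
    (@cone_sum_t n _) (@cone_sum_e n _) (@cone_hP n _ (ps_regular s)) gz D0.
  exact G.
rewrite -[RHS]G dz [X in _ = _ + X](_ : _ = 0) ?addr0 // /glue big1 // => k _.
by rewrite /glueS big1 ?scaler0 // => a _; rewrite linear0 glueD_zero linear0.
Qed.

End PlusFamilies.

Definition sforms m : igdalg := forms_ig (fun _ : 'I_1 => m.+1).
Definition st m (a : 'I_m.+1) : sforms m := @fg 1 (fun=> m.+1) false ord0 a.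

Lemma sforms_ext m (B : igdalg) (f g : dga_map (sforms m) B) :
  (forall a, f (st a) = g (st a)) -> f =1 g.
Proof. by move=> h; apply: forms_ext => i a; rewrite (ord1 i); apply: h. Qed.

Section VertexMaps.
Variables (n m : nat) (v : 'I_n.+1 -> nat) (k : vt v -> 'I_m.+1).

Definition spull_coords : coords (fun _ : 'I_1 => m.+1) (jforms v).
Proof.
refine (@Coords 1 (fun=> m.+1) (jforms v) (fun _ a => \sum_(p | k p == a) jx p) _ _).
- by move=> _ a; elim/big_ind: _ => [|x y|p _]; [apply: smem0|apply: smemD|apply: jx_hom].
- by move=> _; rewrite -(jx_sum v) [RHS](partition_big k predT).
Defined.

Definition spull : dga_map (sforms m) (jforms v) := fmap spull_coords.

Lemma spullE a : spull (st a) = \sum_(p | k p == a) jx p.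
Proof. exact: fmapE. Qed.

End VertexMaps.
Arguments spull : simpl never.

Section JoinOf.
Variables (n m : nat) (c : 'I_m.+1 -> 'I_n.+1).

(** The position of a vertex of the join among the m+1 vertices of the simplex. *)
Definition cvert (p : vt (join_of c)) : 'I_m.+1 := enum_val (tagged p).

Lemma cvert_tag p : c (cvert p) = tag p.
Proof. by have := enum_valP (tagged p); rewrite inE => /eqP. Qed.

Lemma cvert_subproof (a : 'I_m.+1) : a \in [pred b | c b == c a].
Proof. by rewrite inE. Qed.

Definition cvert_inv (a : 'I_m.+1) : vt (join_of c) :=
  Tagged (fun i => 'I_(join_of c i)) (enum_rank_in (cvert_subproof a) a).

Lemma cvert_invK : cancel cvert_inv cvert.
Proof. move=> a; exact: (enum_rankK_in (cvert_subproof a) (cvert_subproof a)). Qed.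

Lemma cvert_inj : injective cvert.
Proof.
move=> [i x] [j y] e; have ij : i = j.
  by have := congr1 c e; rewrite !cvert_tag.
by case: _ / ij y e => y /enum_val_inj /= ->.
Qed.

Lemma cvertK : cancel cvert cvert_inv.
Proof. by move=> p; apply: cvert_inj; rewrite cvert_invK. Qed.

Hypothesis c_mono : forall x y : 'I_m.+1, (x <= y)%N -> (c x <= c y)%N.

Definition vt_lt (v : 'I_n.+1 -> nat) (p q : vt v) : bool :=
  (tag p < tag q)%N || (tag p == tag q) && (tagged p < tagged q)%N.

Lemma cvert_lt (p q : vt (join_of c)) : (cvert p < cvert q)%N = vt_lt p q.
Proof.
have lt_tag (a b : vt (join_of c)) : (tag a < tag b)%N -> (cvert a < cvert b)%N.
  rewrite -!cvert_tag; apply: contraTT; rewrite -!leqNgt; exact: c_mono.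
rewrite /vt_lt; case: (ltngtP (tag p) (tag q)) => pq /=.
- exact: lt_tag.
- rewrite -val_eqE gtn_eqF //=; apply/negbTE; rewrite -leqNgt; apply/ltnW/lt_tag.
  by [].
have {}pq := val_inj pq.
case: p q pq => [i x] [j y] /= ij; case: _ / ij y => y; rewrite eqxx /=.
exact: enum_val_ltn.
Qed.

End JoinOf.

Lemma fvert_lt n (u v : 'I_n.+1 -> nat) (f : mor u v) p q :
  vt_lt p q -> vt_lt (fvert f p) (fvert f q).
Proof.
case: p q => [i x] [j y]; rewrite /vt_lt /= => /orP[-> //|/andP[/eqP ij]].
case: _ / ij y => y xy; rewrite eqxx /= (incr_lt (f i) xy).
by rewrite orbT.
Qed.

(** * Normality: forms on the associated face set *)

Section Charts.
Variables (n : nat) (K : filtered_face_set n).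

(** The colouring of a face agrees with c' only by extensionality; the transport this causes is
    dealt with here once and for all. *)
Lemma assoc_face_mor k m (c' : 'I_k.+1 -> 'I_n.+1) (c : 'I_m.+1 -> 'I_n.+1)
    (h : mor (join_of c') (join_of c)) (g : incr k.+1 m.+1)
    (t : K (join_of c)) cP c'P :
  (forall p, g (cvert p) = cvert (fvert h p)) ->
  assoc_face g (@AssocSimplex n K m c t cP) = @AssocSimplex n K k c' (ff_face h t) c'P.
Proof.
move=> gh; have e : (fun a => c (g a)) = c'.
  apply/funext => a; rewrite -[a](cvert_invK c') gh cvert_tag.
  by rewrite [RHS]cvert_tag.
case: _ / e h c'P gh => h c'P gh; rewrite /assoc_face /=.
have -> : join_of_face g c = h.
  apply: mor_ext => i x; apply: enum_val_inj; rewrite enum_val_join_of_face.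
  exact: (gh (Tagged (fun i => 'I_(join_of (fun a => c (g a)) i)) x)).
by congr AssocSimplex; apply: Prop_irrelevance.
Qed.

Lemma vt_map_incr k m (c' : 'I_k.+1 -> 'I_n.+1) (c : 'I_m.+1 -> 'I_n.+1)
    (h : mor (join_of c') (join_of c)) :
  (forall x y : 'I_k.+1, (x <= y)%N -> (c' x <= c' y)%N) ->
  (forall x y : 'I_m.+1, (x <= y)%N -> (c x <= c y)%N) ->
  exists g : incr k.+1 m.+1, forall p, g (cvert p) = cvert (fvert h p).
Proof.
move=> c'P cP.
have gP (x y : 'I_k.+1) : (x < y)%N ->
    (cvert (fvert h (cvert_inv c' x)) < cvert (fvert h (cvert_inv c' y)))%N.
  move=> xy; rewrite cvert_lt //; apply: fvert_lt.
  by rewrite -cvert_lt // !cvert_invK.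
by exists (Incr gP) => p /=; rewrite cvertK.
Qed.

(* an ordering of the vertices of a join as a simplex *)
Record chart (v : join_obj n) := Chart {
  ch_dim : nat;
  ch_col : 'I_ch_dim.+1 -> 'I_n.+1;
  ch_mono : forall x y : 'I_ch_dim.+1, (x <= y)%N -> (ch_col x <= ch_col y)%N;
  ch_to : mor (join_of ch_col) v;
  ch_from : mor v (join_of ch_col);
  ch_toK : mor_comp ch_from ch_to = mor_id v }.

(** Sort the vertices by the index of their factor. The resulting [join_of c] has factors of the
    same sizes as v without being the same object, hence the pair of casts [ch_to] and [ch_from]. *)
Lemma chart_exists v : inhabited (chart v).
Proof.
have [p0] : inhabited (vt v).
  by have [i vi] := jv_neq0 v; constructor; exists i; exists (Ordinal vi).
pose leT (p q : vt v) : bool := (tag p <= tag q)%N.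
have leT_total : total leT by move=> p q; apply: leq_total.
have leT_trans : transitive leT by move=> p q s; apply: leq_trans.
pose s := sort leT (enum {: vt v}).
have s_sorted : sorted leT s by apply: sort_sorted.
have sE : perm_eq s (enum {: vt v}) by rewrite perm_sort.
have s0 : (0 < size s)%N by rewrite size_sort -cardE; apply/card_gt0P; exists p0.
have [m sm] : exists m, size s = m.+1 by exists (size s).-1; rewrite prednK.
pose c (a : 'I_m.+1) := tag (nth p0 s a).
have c_mono (x y : 'I_m.+1) : (x <= y)%N -> (c x <= c y)%N.
  move=> xy; apply: (sorted_leq_nth leT_trans) => //.
  - by move=> p; apply: leqnn.
  - by rewrite inE sm.
  - by rewrite inE sm.
have c_card i : join_of c i = v i.
  rewrite /= -sum1_card.
  transitivity (\sum_(p <- s | tag p == i) 1)%N.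
    by rewrite (big_nth p0) sm big_mkord; apply: eq_bigl => a; rewrite inE.
  rewrite (perm_big _ sE) /= big_enum_cond /=.
  transitivity (\sum_(l | l == i) \sum_(a : 'I_(v l)) 1)%N.
    rewrite (sig_big_dep (fun l => l == i) (fun l (a : 'I_(v l)) => true)
      (fun l (a : 'I_(v l)) => 1%N)) /=.
    by apply: eq_bigl => p; rewrite andbT.
  by rewrite big_pred1_eq sum1_card card_ord.
pose to : mor (join_of c) v := fun i =>
  @Incr _ _ (cast_ord (c_card i)) (fun _ _ h => h).
pose from : mor v (join_of c) := fun i =>
  @Incr _ _ (cast_ord (esym (c_card i))) (fun _ _ h => h).
constructor; apply: (@Chart v m c c_mono to from).
by apply: mor_ext => i x; apply: val_inj.
Qed.

Definition chart_of v : chart v :=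
  proj1_sig (cid (let: inhabits x := chart_exists v in ex_intro (fun=> True) x I)).

Definition assoc_of v (s : K v) : assoc_simplex K (ch_dim (chart_of v)) :=
  @AssocSimplex n K _ (@ch_col v (chart_of v)) (ff_face (ch_to (chart_of v)) s)
    (@ch_mono v (chart_of v)).

Variable x : apl_families (assoc K).
Hypothesis cx : apl_compatible (assoc K) x.

Definition ev v (s : K v) : jforms v :=
  spull (fun p => cvert (fvert (ch_from (chart_of v)) p))
    (x (Tagged (assoc K) (assoc_of s))).

(** Independence of the chart: any presentation of a simplex as a face of an associated simplex
    computes [ev], by compatibility of x. *)
Lemma ev_face (v : join_obj n) m (c : 'I_m.+1 -> 'I_n.+1) (t : K (join_of c)) cP (f : mor v (join_of c)) :
  ev (ff_face f t) = spull (fun p => cvert (fvert f p))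
    (x (Tagged (assoc K) (@AssocSimplex n K m c t cP))).
Proof.
rewrite /ev; set ch := chart_of v.
pose h : mor (join_of (@ch_col v ch)) (join_of c) := mor_comp (ch_to ch) f.
have [g gh] := vt_map_incr h (@ch_mono v ch) cP.
have e : assoc_of (ff_face f t) = assoc_face g (@AssocSimplex n K m c t cP).
  by rewrite (assoc_face_mor _ cP (@ch_mono v ch) gh) /h ff_comp.
rewrite e; have := cx g (@AssocSimplex n K m c t cP).
have -> : fs_face g (AssocSimplex t cP : assoc K m) = assoc_face g (AssocSimplex t cP) by [].
move=> ->; rewrite -dpullE -[LHS]/(dm_comp (spull _) (dpull (simplex_mor g)) _).
apply: sforms_ext => a; rewrite dm_compE [dpull _ _]fmapE /= spullE linear_sum.
rewrite (eq_bigr (fun b => \sum_(p | cvert (fvert (ch_from ch) p) == b) jx p)); last first.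
  by move=> b _; apply: spullE.
have fE p : g (cvert (fvert (ch_from ch) p)) = cvert (fvert f p).
  rewrite gh /h; congr cvert.
  rewrite -[fvert f p]/(fvert (mor_comp (mor_id v) f) p) -(ch_toK ch).
  by [].
rewrite [RHS](partition_big (fun p => cvert (fvert (ch_from ch) p)) (fun b => g b == a)) /=.
  apply: eq_bigr => b /eqP gb; apply: eq_bigl => p.
  case: eqP => [e'|]; last by rewrite andbF.
  by rewrite -fE e' gb eqxx.
by move=> p /eqP <-; rewrite fE.
Qed.

Lemma ev_compat (u v : join_obj n) (f : mor u v) (s : K v) :
  ev (ff_face f s) = jpull f (ev s).
Proof.
have {1}-> : s = ff_face (ch_from (chart_of v)) (ff_face (ch_to (chart_of v)) s).
  by rewrite -ff_comp ch_toK ff_id.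
rewrite -ff_comp (ev_face _ (@ch_mono v (chart_of v))).
rewrite -[RHS]/(dm_comp (jpull f) (spull _) _).
apply: sforms_ext => a; rewrite dm_compE !spullE linear_sum.
rewrite [RHS](eq_bigr (fun q => \sum_(p | fvert f p == q) jx p)); last first.
  by move=> q _; apply: jpullE.
rewrite [LHS](partition_big (fvert f)
  (fun q => cvert (fvert (ch_from (chart_of v)) q) == a)) //=.
apply: eq_bigr => q /eqP qa; apply: eq_bigl => p.
case: (eqVneq (fvert f p) q) => [e|_]; last by rewrite andbF.
by rewrite andbT -qa -e; apply: eqxx.
Qed.

End Charts.

Lemma jpull_comp n (u v w : 'I_n.+1 -> nat) (f : mor u v) (g : mor v w) x :
  jpull (mor_comp f g) x = jpull f (jpull g x).
Proof.
rewrite -[RHS]dm_compE; apply: jforms_ext => q; rewrite dm_compE !jpullE linear_sum.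
rewrite [RHS](eq_bigr (fun q => \sum_(p | fvert f p == q) jx p)); last first.
  by move=> q' _; apply: jpullE.
rewrite [LHS](partition_big (fvert f) (fun q' => fvert g q' == q)) //=.
apply: eq_bigr => q' /eqP qa; apply: eq_bigl => p.
case: (eqVneq (fvert f p) q') => [e|_]; last by rewrite andbF.
by rewrite andbT -qa -e; apply: eqxx.
Qed.

Lemma jpull_id n (v : 'I_n.+1 -> nat) x : jpull (mor_id v) x = x.
Proof.
rewrite -[RHS]/(dm_id _ x); apply: jforms_ext => q.
by rewrite jpullE (big_pred1 q).
Qed.

Section FromPlus.
Variables (n : nat) (K : filtered_face_set n).
Hypothesis K_normal : ff_normal K.

Lemma coface_exists v (s : K v) : inhabited (coface s).
Proof.
case: (posnP (v ord_max)) => hv.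
  by apply: K_normal.1; rewrite /regular_obj hv.
by constructor; apply: (@Coface n K v s v (mor_id v) s (ff_id s) hv).
Qed.

Definition coface_of v (s : K v) : coface s :=
  proj1_sig (cid (let: inhabits x := coface_exists s in ex_intro (fun=> True) x I)).

Variable y : jplus K.

Definition cval v (s : K v) (X : coface s) : jforms v :=
  jpull (cf_incl X) (y (PlusSimplex (cf_simp X) (cf_regular X))).

Definition ext_plus v (s : K v) : jforms v := cval (coface_of s).

Hypothesis cy : jplus_compat y.

(** Values agree along each arrow of cofaces because y is compatible. Outside K_+ normality joins
    any two cofaces by a zigzag, whose compatibility with the inclusions of s is used here; in K_+
    the value is that of y on s. *)
Lemma cval_indep v (s : K v) (X Y : coface s) : cval X = cval Y.
Proof.
case: (posnP (v ord_max)) => hv; last first.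
  have key (Z : coface s) : cval Z = y (@PlusSimplex n K v s hv).
    by case: Z => w i t ts tr; rewrite /cval /=; case: _ / ts; rewrite (cy _ _ _ tr).
  by rewrite !key.
have step (Z Z' : coface s) : coface_le Z Z' -> cval Z = cval Z'.
  case: Z => w i t ts tr; case: Z' => w' i' t' ts' tr' [/= f ft fi].
  rewrite /cval /= -fi jpull_comp; congr (jpull _ _).
  by case: _ / ft tr {ts} => tr; rewrite (cy _ _ _ tr').
have nv : ~ regular_obj v by rewrite /regular_obj hv.
have := K_normal.2 v s nv X Y; elim => [Z Z1 Z' /step -> /step -> //|].
by move=> Z Z1 Z2 Z' /step -> /step <-.
Qed.

(** A regular coface of s, preceded by f, is a regular coface of the face of s along f. *)
Lemma ext_plus_compat (u v : join_obj n) (f : mor u v) (s : K v) :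
  ext_plus (ff_face f s) = jpull f (ext_plus s).
Proof.
pose X := coface_of s.
have e : ff_face (mor_comp f (cf_incl X)) (cf_simp X) = ff_face f s.
  by rewrite ff_comp cf_face.
rewrite /ext_plus (cval_indep _ (Coface e (cf_regular X))) /cval /=.
exact: jpull_comp.
Qed.

Lemma ext_plus_regular (s : plus_simplex K) : ext_plus (ps_simp s) = y s.
Proof.
case: s => v s hv; rewrite /ext_plus /=.
rewrite (cval_indep _ (@Coface n K v s v (mor_id v) s (ff_id s) hv)) /cval /=.
exact: jpull_id.
Qed.

End FromPlus.

Section JoinToSimplex.
Variables (n m : nat) (c : 'I_m.+1 -> 'I_n.+1).

Definition unjoin_coords : jcoords (join_of c) (sforms m).
Proof.
refine (@JCoords n (join_of c) (sforms m) (fun p => st (cvert p)) _ _).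
- by move=> p; apply: form_hom0.
- rewrite -(@form_sum1 1 (fun=> m.+1) ord0) [RHS](reindex (@cvert n m c)) //.
  by exists (cvert_inv c) => a _; [apply: cvertK | apply: cvert_invK].
Defined.

Definition unjoin : dga_map (jforms (join_of c)) (sforms m) := jmap unjoin_coords.

Lemma unjoinE p : unjoin (jx p) = st (cvert p).
Proof. exact: jmapE. Qed.

Lemma spull_cvertK x : unjoin (spull (@cvert n m c) x) = x.
Proof.
rewrite -dm_compE -[RHS]/(dm_id _ x); apply: sforms_ext => a.
rewrite dm_compE spullE (big_pred1 (cvert_inv c a)) ?unjoinE ?cvert_invK // => p.
by rewrite /= -[a in LHS](cvert_invK c) (inj_eq (@cvert_inj _ _ c)).
Qed.

Lemma spull_unjoin (v : 'I_n.+1 -> nat) (f : mor v (join_of c)) x :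
  spull (fun p => cvert (fvert f p)) (unjoin x) = jpull f x.
Proof.
rewrite -dm_compE; apply: jforms_ext => q; rewrite dm_compE unjoinE spullE jpullE.
by apply: eq_bigl => p; rewrite (inj_eq (@cvert_inj _ _ c)).
Qed.

End JoinToSimplex.
Arguments unjoin : simpl never.

Lemma unjoin_face n m k (c : 'I_m.+1 -> 'I_n.+1) (f : incr k.+1 m.+1) x :
  unjoin (fun a => c (f a)) (jpull (join_of_face f c) x) =
  pull (simplex_mor f) (unjoin c x).
Proof.
rewrite -dpullE -[LHS]/(dm_comp (unjoin _) (jpull _) x).
rewrite -[RHS]/(dm_comp (dpull (simplex_mor f)) (unjoin c) x).
apply: jforms_ext => q; rewrite !dm_compE unjoinE jpullE linear_sum.
rewrite [RHS]fmapE.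
rewrite [LHS](eq_bigr (fun p => st (cvert p))) => [|p _]; last exact: unjoinE.
rewrite [RHS](reindex (@cvert n k (fun a => c (f a)))) /=; last first.
  by exists (cvert_inv (fun a => c (f a))) => a _; [apply: cvertK | apply: cvert_invK].
apply: eq_bigl => p; rewrite -(inj_eq (@cvert_inj _ _ c)); congr (_ == _).
exact: enum_val_join_of_face.
Qed.

Section AssocPlus.
Variables (n : nat) (K : filtered_face_set n).
Hypothesis K_normal : ff_normal K.

Definition plus_to_assoc (y : jplus K) : apl_families (assoc K) :=
  fun s => unjoin (as_factor (tagged s)) (ext_plus K_normal y (as_simp (tagged s))).

Definition assoc_to_plus (x : apl_families (assoc K)) : jplus K :=
  fun s => ev x (ps_simp s).

Lemma plus_to_assoc_compat y : jplus_compat y ->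
  apl_compatible (assoc K) (plus_to_assoc y).
Proof.
move=> cy k m f [c t cP]; rewrite /plus_to_assoc /= ext_plus_compat //.
exact: unjoin_face.
Qed.

Lemma assoc_to_plus_compat x : apl_compatible (assoc K) x ->
  jplus_compat (assoc_to_plus x).
Proof. by move=> cx v v' f s hv hv'; apply: ev_compat. Qed.

Lemma assoc_to_plusK x : apl_compatible (assoc K) x -> plus_to_assoc (assoc_to_plus x) = x.
Proof.
move=> cx; apply: functional_extensionality_dep => -[m [c t cP]].
rewrite /plus_to_assoc /= /ext_plus /cval /=.
set X := coface_of _ _.
have -> : jpull (cf_incl X) (assoc_to_plus x (PlusSimplex (cf_simp X) (cf_regular X))) =
    ev x t.
  by rewrite -[in RHS](cf_face X) ev_compat.
have {1}-> : t = ff_face (mor_id (join_of c)) t by rewrite ff_id.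
rewrite (ev_face cx t cP).
have -> : (fun p => cvert (fvert (mor_id (join_of c)) p)) = @cvert n m c.
  by apply/funext => -[i p].
exact: spull_cvertK.
Qed.

Lemma plus_to_assocK y s : jplus_compat y ->
  assoc_to_plus (plus_to_assoc y) s = y s.
Proof.
move=> cy; rewrite /assoc_to_plus /ev /plus_to_assoc /=.
rewrite spull_unjoin -ext_plus_compat // -ff_comp ch_toK ff_id.
exact: ext_plus_regular.
Qed.

End AssocPlus.

(** * The blow-up map is a quasi-isomorphism *)

Definition coboundary_in (A : gdalg) (S : submod A) k (x : A) : Prop :=
  if k is k'.+1 then exists2 y, gd_hom A k' y /\ S y & x = gd_diff A y else x = 0.

(* quasi-isomorphism, in terms of homogeneous elements of subspaces *)
Definition qi_in (A C : gdalg) (SA : submod A) (SC : submod C) (f : A -> C) : Prop :=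
  forall k,
    (forall x, gd_hom A k x -> SA x -> gd_diff A x = 0 ->
       coboundary_in SC k (f x) -> coboundary_in SA k x) /\
    (forall y, gd_hom C k y -> SC y -> gd_diff C y = 0 ->
       exists2 x, [/\ gd_hom A k x, SA x & gd_diff A x = 0] &
         coboundary_in SC k (y - f x)).

Section FamilyIg.
Variables (I : Type) (A : I -> igdalg).
Local Notation F := (Defs.family (fun i : I => ig_alg (A i) : qalgType)).

Definition fam_inv (w : F) : F := fun i : I => gi (A i) (w i).
Fact fam_inv_linear : linear fam_inv.
Proof. by move=> a x y; apply: functional_extensionality_dep => i; apply: linearP. Qed.
HB.instance Definition _ :=
  GRing.isLinear.Build rat F F _ fam_inv fam_inv_linear.

Definition fam_ig : igdalg.
Proof.
refine (@Igdalg (fam_gdalg (fun i : I => ig_alg (A i))) fam_inv _ _ _ _ _).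
- by move=> x y; apply: functional_extensionality_dep => i; apply: giM.
- by move=> k x hx; apply: functional_extensionality_dep => i; apply/gi_hom/hx.
- by move=> x y; apply: functional_extensionality_dep => i; apply: gi_leibniz.
- by move=> x; apply: functional_extensionality_dep => i; apply: gi_diff.
- by move=> x; apply: functional_extensionality_dep => i; apply: giK.
Defined.

End FamilyIg.

Section BlowUpQI.
Variables (n : nat) (K : filtered_face_set n).
Hypothesis K_normal : ff_normal K.

Definition apl_ig : igdalg :=
  fam_ig (fun s : fs_simplices (assoc K) => sforms (tag s)).
Definition blow_ig : igdalg :=
  fam_ig (fun s : plus_simplex K => forms_ig (blow (ps_obj s))).

Definition blowup_all (x : apl_families (assoc K)) : blow_families K :=
  fun s => blowup _ (assoc_to_plus x s).

Fact blowup_all_linear : linear blowup_all.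
Proof.
move=> a x y; apply: functional_extensionality_dep => s.
by rewrite /blowup_all /assoc_to_plus /ev !linearP.
Qed.
HB.instance Definition _ := GRing.isLinear.Build rat apl_ig blow_ig _
  blowup_all blowup_all_linear.

Definition blowup_dga : dga_map apl_ig blow_ig.
Proof.
refine (@DgaMap apl_ig blow_ig blowup_all _ _ _ _ _).
- by apply: functional_extensionality_dep => s; rewrite /= /blowup_all /assoc_to_plus /ev !dm1.
- move=> x y; apply: functional_extensionality_dep => s.
  by rewrite /= /blowup_all /assoc_to_plus /ev !dmM.
- move=> x; apply: functional_extensionality_dep => s.
  by rewrite /= /blowup_all /assoc_to_plus /ev !dmd.
- move=> x; apply: functional_extensionality_dep => s.
  by rewrite /= /blowup_all /assoc_to_plus /ev !dmi.
- by move=> k x hx s; apply: dm_hom; apply: dm_hom; exact: (hx (Tagged _ _)).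
Defined.

Lemma blowup_all_pforms x : apl_compatible (assoc K) x -> pforms K (perv0 n) (blowup_dga x).
Proof.
move=> cx; apply/pforms0P; split=> [v v' f s hv hv'|s]; last exact: gcond_blowup.
have := assoc_to_plus_compat cx f s hv hv' => e.
rewrite -[LHS]/(blowup _ (assoc_to_plus x (PlusSimplex (ff_face f s) hv))) e.
rewrite -bpull_blowup; exact: dpullE.
Qed.

Lemma plus_to_assoc_d (x : jplus K) :
  plus_to_assoc K_normal (fun s => dif (jforms (ps_obj s)) (x s)) =
  dif apl_ig (plus_to_assoc K_normal x).
Proof.
apply: functional_extensionality_dep => s.
by rewrite /plus_to_assoc /ext_plus /cval !dmd.
Qed.

Lemma plus_to_assoc_N (x : jplus K) :
  plus_to_assoc K_normal (fun s => - x s) = - plus_to_assoc K_normal x :> apl_ig.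
Proof.
apply: functional_extensionality_dep => s.
by rewrite /plus_to_assoc /ext_plus /cval !linearN.
Qed.

Lemma plus_to_assoc_0 : plus_to_assoc K_normal (fun s : plus_simplex K => 0) = 0 :> apl_ig.
Proof.
apply: functional_extensionality_dep => s.
by rewrite /plus_to_assoc /ext_plus /cval !linear0.
Qed.

Lemma plus_to_assoc_hom k (x : jplus K) :
  (forall s, hom (jforms (ps_obj s)) k (x s)) -> hom apl_ig k (plus_to_assoc K_normal x).
Proof. by move=> hx s; apply: dm_hom; apply: dm_hom; exact: (hx (PlusSimplex _ _)). Qed.

Lemma assoc_to_plus_hom k x : hom apl_ig k x ->
  forall s, hom (jforms (ps_obj s)) k (assoc_to_plus x s).
Proof. move=> hx s; apply: dm_hom; exact: (hx (Tagged _ _)). Qed.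

Lemma assoc_to_plus_d x s :
  assoc_to_plus (dif apl_ig x) s = dif (jforms (ps_obj s)) (assoc_to_plus x s).
Proof. exact: (@dmd (sforms _)). Qed.

Lemma assoc_to_plus0 s : assoc_to_plus (0 : apl_ig) s = 0.
Proof. exact: (linear0 (spull _)). Qed.

(** Cycles of the cone bound by [plus_acyclic]. For injectivity take (x, -y0) with the blow-up of x
    equal to d y0 (y0 being 0 in degree 0); for surjectivity take (0, y). [plus_to_assoc] brings the
    join components back to A_PL. *)
Theorem blowup_qi :
  qi_in (apl_compatible (assoc K)) (pforms K (perv0 n)) blowup_dga.
Proof.
move=> k; split=> [x hx cx dx|y hy /pforms0P[cy gy] dy].
  have cx' := assoc_to_plus_compat cx.
  have hx' := assoc_to_plus_hom hx.
  have dx' s : dif (jforms (ps_obj s)) (assoc_to_plus x s) = 0.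
    by rewrite -assoc_to_plus_d dx assoc_to_plus0.
  case: k hx hx' => [|k] hx hx' bd.
    have bx s : blowup (ps_obj s) (assoc_to_plus x s) = 0.
      by rewrite -[LHS]/(blowup_dga x s) bd.
    have [||||x' [y' [_ _ _ z0 zE]]] := @plus_acyclic n K 0 (assoc_to_plus x) (fun s => 0) cx'.
    - by move=> v v' f s hv hv'; rewrite pull0.
    - by move=> s; apply: gcond0.
    - by move=> s; split; [apply: hx' | apply: smem0].
    - by move=> s; congr pair; rewrite /= ?dx' ?oppr0 // bx linear0 addr0.
    rewrite /= -(assoc_to_plusK K_normal cx) -plus_to_assoc_0.
    congr plus_to_assoc; apply: functional_extensionality_dep => s.
    by have := zE s; rewrite z0 linear0 => -[<-].
  case: bd => y0 [hy0 /pforms0P[cy0 gy0]] bd.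
  have [||||x' [y' [cx1 _ _ hz zE]]] :=
    @plus_acyclic n K k.+1 (assoc_to_plus x) (fun s => - y0 s) cx'.
  - by move=> v v' f s hv hv'; rewrite (cy0 _ _ f s hv hv') -!dpullE linearN.
  - by move=> s; rewrite -scaleN1r; apply: (smemZ (S := gsub _)); apply: gy0.
  - move=> s; split; first exact: hx'.
    by rewrite -[_.2]scaleN1r; apply: smemZ; exact: (hy0 s).
  - move=> s; congr pair; rewrite /= ?dx' ?oppr0 //.
    rewrite -[blowup _ _]/(blowup_dga x s) bd linearN; exact: subrr.
  exists (- plus_to_assoc K_normal x').
    split; rewrite -scaleN1r; apply: smemZ; last exact: plus_to_assoc_compat.
    by apply: plus_to_assoc_hom => s; have [] := hz s.
  rewrite linearN -[dif _ _]plus_to_assoc_d -plus_to_assoc_N.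
  rewrite -[LHS](assoc_to_plusK K_normal cx); congr plus_to_assoc.
  by apply: functional_extensionality_dep => s; have [<-] := zE s.
have [|||||x' [y' [cx1 cy1 gy1 hz zE]]] := @plus_acyclic n K k.+1 (fun s => 0) y.
- by move=> v v' f s hv hv'; rewrite linear0.
- exact: cy.
- exact: gy.
- by move=> s; split; [apply: smem0 | apply: hy].
- move=> s; congr pair; rewrite /= linear0 ?oppr0 // add0r.
  by rewrite -[LHS]/(dif blow_ig y s) dy.
have dx' s : dif (jforms (ps_obj s)) (x' s) = 0.
  by have [/eqP e _] := zE s; move: e; rewrite oppr_eq0 => /eqP.
exists (plus_to_assoc K_normal x').
  split; [| exact: plus_to_assoc_compat |].
    by apply: plus_to_assoc_hom => s; have [] := hz s.
  rewrite -[LHS]plus_to_assoc_d -plus_to_assoc_0; congr plus_to_assoc.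
  exact: functional_extensionality_dep.
have yE : y - blowup_dga (plus_to_assoc K_normal x') = dif blow_ig y'.
  apply: functional_extensionality_dep => s.
  rewrite -[LHS]/(y s - blowup _ (assoc_to_plus (plus_to_assoc K_normal x') s)).
  rewrite plus_to_assocK //; have [_ <-] := zE s.
  by rewrite addrC addKr.
case: k hy hz => [|k] hy hz; rewrite /= yE.
  apply: functional_extensionality_dep => s.
  have [_ /hom_pred0 /= y0] := hz s.
  by rewrite -[LHS]/(dif _ (y' s)) y0 linear0.
exists y' => //; split; first by move=> s; have [] := hz s.
by apply/pforms0P.
Qed.

End BlowUpQI.

(** * Lifting along quasi-isomorphisms *)

Section LinearSelection.

Definition mk_linear (V W : lmodType rat) (f : V -> W) (fP : linear f) : {linear V -> W} :=
  HB.pack f (GRing.isLinear.Build rat V W _ f fP).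

(** Zorn: a maximal subspace meeting U trivially. A vector outside the sum with U could be adjoined
    to it. *)
Lemma complement_exists (V : lmodType rat) (U : submod V) :
  exists2 N : submod V, (forall x, N x -> U x -> x = 0) &
    forall v, exists2 u, U u & N (v - u).
Proof.
(* 0 is not demanded, because the union of the empty chain is empty; a maximal N contains it
   anyway. *)
pose P (N : set V) := (forall (a : rat) x y, N x -> N y -> N (a *: x + y)) /\
  (forall x, N x -> U x -> x = 0).
have [|N [[NL NU] Nmax]] := @Zorn_bigcup V P.
  move=> F FP totF; split=> [a x y [X FX Xx] [Y FY Yy]|x [X FX Xx]].
    by have [XY|YX] := totF _ _ FX FY; [exists Y => //|exists X => //];
      apply: (FP _ _).1 => //; [apply: XY|apply: YX].
  exact: (FP _ FX).2.
have N0 : N 0.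
  apply: contrapT => nN0; apply: (Nmax (fun x => N x \/ x = 0)).
    split=> [x Nx|/(_ 0 (or_intror erefl)) //]; by left.
  split=> [a x y [Nx|->] [Ny|->]|x [Nx|->] //].
  - by left; exact: (NL _ _ _ Nx Ny).
  - by exfalso; apply: nN0; have := NL (-1) _ _ Nx Nx; rewrite scaleN1r addNr.
  - by rewrite scaler0 add0r; left.
  - by rewrite scaler0 addr0; right.
  - exact: NU.
exists (@Submod V N N0 NL) => // v; apply: contrapT => nv.
apply: (Nmax (fun x => exists a z, N z /\ x = z + a *: v)).
  split=> [x Nx|sub]; first by exists 0, x; rewrite scale0r addr0.
  have Nv : N v by apply: sub; exists 1, 0; rewrite scale1r add0r.
  by apply: nv; exists 0; [apply: smem0 | rewrite /= subr0].
split=> [b x y [a [z [Nz ->]]] [a' [z' [Nz' ->]]]|x [a [z [Nz ->]]] Ux].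
  exists (b * a + a'), (b *: z + z'); split; first exact: (NL _ _ _ Nz Nz').
  by rewrite scalerDr scalerDl scalerA addrACA.
have [a0|a0] := eqVneq a 0; first by move: Ux; rewrite a0 scale0r addr0; apply: NU.
exfalso; apply: nv; exists (a^-1 *: (z + a *: v)); first exact: smemZ.
rewrite scalerDr scalerA mulVf // scale1r opprD addrCA subrr addr0 /=.
by rewrite -scalerN -scaleN1r scalerA -[_ *: z]addr0; exact: (NL _ _ _ Nz N0).
Qed.

Lemma projection_exists (V : lmodType rat) (U : submod V) :
  exists2 p : {linear V -> V}, (forall v, U (p v)) & forall u, U u -> p u = u.
Proof.
have [N NU UN] := complement_exists U.
pose p v := proj1_sig (cid2 (UN v)).
have Up v : U (p v) by rewrite /p; case: cid2.
have Np v : N (v - p v) by rewrite /p; case: cid2.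
have pE v u : U u -> N (v - u) -> p v = u.
  move=> Uu Nvu; apply/eqP; rewrite -subr_eq0; apply/eqP; apply: NU; last first.
    by rewrite addrC -scaleN1r; apply: smemP.
  have -> : p v - u = -1 *: (v - p v) + (v - u).
    by rewrite scaleN1r opprB addrA subrK.
  exact: smemP.
have pL : linear p.
  move=> a x y; apply: pE; first exact: smemP.
  have -> : a *: x + y - (a *: p x + p y) = a *: (x - p x) + (y - p y).
    by rewrite scalerBr opprD addrACA.
  exact: smemP.
exists (mk_linear pL) => // u Uu; apply: pE => //.
by rewrite subrr; apply: smem0.
Qed.

(** Extends a linear selection of the linear relation R from U to its whole domain D. Removing from
    w the projection of (v, w) to the vertical part K of R gives a value depending on v alone, hence
    linear in v; projecting to D first makes l total with values in Q. *)
Lemma linear_selection (V W : lmodType rat) (R : submod (V * W)%type) (U : submod V)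
    (Q : submod W) (l0 : {linear V -> W}) :
  (forall u, U u -> R (u, l0 u)) -> (forall v w, R (v, w) -> Q w) ->
  exists l : {linear V -> W}, [/\ forall u, U u -> l u = l0 u,
    forall v w, R (v, w) -> R (v, l v) & forall v, Q (l v)].
Proof.
move=> RU RQ.
have D : { D : submod V | forall v, D v <-> exists w, R (v, w) }.
  have D0 : exists w, R (0, w) by exists 0; apply: (smem0 R).
  have DP (a : rat) x y : (exists w, R (x, w)) -> (exists w, R (y, w)) ->
      exists w, R (a *: x + y, w).
    by move=> [w rw] [w' rw']; exists (a *: w + w'); apply: (smemP a rw rw').
  by exists (@Submod V (fun v => exists w, R (v, w)) D0 DP).
case: D => D DE.
have K0 : R 0 /\ (0 : V * W).1 = 0 by split=> //; apply: smem0.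
have KP (a : rat) (z z' : V * W) : R z /\ z.1 = 0 -> R z' /\ z'.1 = 0 ->
    R (a *: z + z') /\ (a *: z + z').1 = 0.
  move=> [Rz z0] [Rz' z0']; split; first exact: smemP.
  by rewrite /= z0 z0' scaler0 addr0.
pose K := @Submod (V * W)%type (fun z => R z /\ z.1 = 0) K0 KP.
have [pK pKK pK_id] := projection_exists K.
have [pU pUU pU_id] := projection_exists U.
have [pD pDD pD_id] := projection_exists D.
have sel v : exists w, D v -> R (v, w).
  have [/DE[w rw]|nDv] := pselect (D v); first by exists w.
  by exists 0.
pose s v w : W := w - (pK (v, w)).2.
have sR v w : R (v, w) -> R (v, s v w).
  move=> rw; have [rk k0] := pKK (v, w).
  have := smemP (-1) rk rw; rewrite scaleN1r /s; congr (R _).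
  case: (pK (v, w)) k0 => /= x y ->; congr pair; first by rewrite /= oppr0 add0r.
  by rewrite /= addrC.
have s_indep v w w' : R (v, w) -> R (v, w') -> s v w = s v w'.
  move=> rw rw'; have e : (0, w - w') = (-1) *: (v, w') + (v, w) :> (V * W)%type.
    by congr pair; rewrite /= scaleN1r ?addNr // addrC.
  have Kd : K (0, w - w') by split=> //; rewrite e; apply: smemP.
  have := pK_id _ Kd; rewrite {1}e linearP scaleN1r => /(congr1 snd) /= h.
  by apply/eqP; rewrite /s subr_eq -addrA h addrC subrK.
pose sv v := s v (proj1_sig (cid (sel v))).
have svE v w : R (v, w) -> sv v = s v w.
  move=> rw; apply: (s_indep _ _ _ _ rw); case: (cid (sel v)) => w' /= h; apply: h.
  by apply/DE; exists w.
have svL a x y : D x -> D y -> sv (a *: x + y) = a *: sv x + sv y.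
  move=> /DE[w rw] /DE[w' rw'].
  have rww := smemP a rw rw'.
  rewrite (svE _ _ rww) (svE _ _ rw) (svE _ _ rw') /s.
  have -> : (a *: x + y, a *: w + w') = a *: (x, w) + (y, w') :> (V * W)%type by [].
  by rewrite linearP /= scalerBr opprD addrACA.
have svR v : D v -> R (v, sv v) by move=> /DE[w rw]; rewrite (svE _ _ rw); apply: sR.
have DU u : U u -> D u by move=> Uu; apply/DE; exists (l0 u); apply: RU.
(* The prescribed value on the U-component and the normalised value on the rest, so that l extends
   [l0]. *)
pose l v := l0 (pU (pD v)) + sv (pD v - pU (pD v)).
have Dd v : D (pD v - pU (pD v)).
  by rewrite addrC -scaleN1r; apply: smemP; [apply: DU | apply: pDD].
have lL : linear l.
  move=> a x y; rewrite /l (linearP pD) (linearP pU) (linearP l0) /=.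
  have -> : a *: pD x + pD y - (a *: pU (pD x) + pU (pD y)) =
      a *: (pD x - pU (pD x)) + (pD y - pU (pD y)) by rewrite scalerBr opprD addrACA.
  by rewrite (svL _ _ _ (Dd x) (Dd y)) [a *: (l0 _ + _)]scalerDr addrACA.
have lR v : R (pD v, l v).
  have := smemD (RU _ (pUU (pD v))) (svR _ (Dd v)); congr (R _).
  by congr pair; rewrite /= addrC subrK.
exists (mk_linear lL); split=> [u Uu|v w rw|v]; last exact: RQ (lR v).
  rewrite /= /l pD_id; last exact: DU.
  have sv0 : sv 0 = 0.
    by have := svL (-1) 0 0 (smem0 D) (smem0 D); rewrite scaler0 addr0 scaleN1r addNr.
  by rewrite pU_id // subrr sv0 addr0.
have Dv : D v by apply/DE; exists w.
by have := lR v; rewrite (pD_id _ Dv).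
Qed.

End LinearSelection.

Section FreeMaps.
Variables (J : Type) (dgJ : J -> nat) (V : J -> lmodType rat).
Local Notation L := (free_cga dgJ V).
Local Notation fh := (homog (fdeg dgJ (V := V)) (@flin _ V)).

Lemma fvec_linear j : linear (@fvec J dgJ V j).
Proof.
move=> a v w; have := cga_rel (fdeg dgJ (V := V)) (@Flin J V j a v w).
by rewrite !cga_piE => /eqP; rewrite subr_eq0 => /eqP.
Qed.

Lemma fvec0 j : @fvec J dgJ V j 0 = 0.
Proof. by have := @fvec_linear j (-1) 0 0; rewrite scaler0 addr0 scaleN1r addNr. Qed.

Lemma fvec_hom j (v : V j) : fh (dgJ j) (fvec dgJ v).
Proof. exact: (homog_gen _ _ (Tagged V v)). Qed.

Lemma free_ind (Q : L -> Prop) :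
  Q 0 -> (forall a x y, Q x -> Q y -> Q (a *: x + y)) -> Q qone ->
  (forall j (v : V j) y, Q y -> Q (fvec dgJ v ** y)) -> forall x, Q x.
Proof. by move=> Q0 QL Q1 QM; apply: cga_ind => // -[j v] y; apply: QM. Qed.

Variables (B : gdalg) (l : forall j, {linear V j -> B}).
Hypothesis l_hom : forall j v, gd_hom B (dgJ j) (l j v).

Definition free_map (x : L) : B := cga_map (fun g : fgen V => l (tag g) (tagged g)) x.

Lemma free_map_respects :
  respects_rel (fdeg dgJ (V := V)) (@flin _ V) (fun g : fgen V => l (tag g) (tagged g)).
Proof.
split=> [x y|_ [j a v w] /=]; first by apply: gd_comm; apply: l_hom.
by rewrite linearP subrr.
Qed.

Fact free_map_linear : linear free_map.
Proof. exact: cga_map_linear free_map_respects. Qed.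
HB.instance Definition _ := GRing.isLinear.Build rat L B _ free_map free_map_linear.
Lemma free_map1 : free_map qone = qone.
Proof. exact: cga_map1 free_map_respects. Qed.
Lemma free_mapM x y : free_map (x ** y) = free_map x ** free_map y.
Proof. exact: cga_mapM free_map_respects x y. Qed.
Lemma free_map_vec j (v : V j) : free_map (fvec dgJ v) = l j v.
Proof. exact: cga_map_gen free_map_respects (Tagged V v). Qed.

Lemma free_map_hom k x : fh k x -> gd_hom B k (free_map x).
Proof.
move: x; apply: mspan_ind => [|a x y hx hy|s <-].
- by rewrite linear0; apply: smem0.
- by rewrite linearP; apply: smemP.
elim: s => [|[j v] s IH]; first by rewrite monom_nil wt_nil free_map1; apply: gd_hom1.
rewrite monom_cons wt_cons free_mapM; apply: gd_homM => //.
by rewrite -/(fvec dgJ v) free_map_vec; exact: l_hom.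
Qed.

End FreeMaps.

Section Lifting.
Variables (V : nat -> lmodType rat) (d0 : differential id V).
Local Notation L := (free_cga id V).
Local Notation fh := (homog (fdeg id (V := V)) (@flin _ V)).

Definition gen_in (F : forall m, submod (V m)) : submod L :=
  mspan (fdeg id (V := V)) (@flin _ V) (List.Forall (fun g => F (tag g) (tagged g))).

Lemma gen_in_ind (F : forall m, submod (V m)) (Q : L -> Prop) :
  Q 0 -> (forall a x y, Q x -> Q y -> Q (a *: x + y)) -> Q qone ->
  (forall m (v : V m) y, F m v -> gen_in F y -> Q y -> Q (fvec id v ** y)) ->
  forall x, gen_in F x -> Q x.
Proof.
move=> Q0 QL Q1 QM; apply: mspan_ind => // s.
elim=> [|[m v] s' Fg Fs IH]; first by rewrite monom_nil.
by rewrite monom_cons; apply: QM => //; apply: mspan_monom.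
Qed.

Variables (A C : igdalg) (SA : submod A) (SC : submod C) (f : dga_map A C).
Hypothesis SA1 : SA qone.
Hypothesis SAM : forall i j x y, hom A i x -> hom A j y -> SA x -> SA y -> SA (x ** y).
Hypothesis SC1 : SC qone.
Hypothesis SCM : forall i j x y, hom C i x -> hom C j y -> SC x -> SC y -> SC (x ** y).
Hypothesis SCd : forall x, SC x -> SC (dif C x).
Hypothesis fS : forall x, SA x -> SC (f x).
Hypothesis f_qi : qi_in SA SC f.
Local Notation P := (path_ig C).

(* the homotopy pullback of f *)
Definition path_to (m : nat) (a : A) (w : P) : Prop :=
  [/\ hom A m a /\ SA a, hom P m w /\ path_fin C w,
      (forall k, SC (w.1 k)) /\ (forall k, SC (w.2 k)) & path_ev1 w = f a].

Definition pull_path (m : nat) : submod (A * P)%type.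
Proof.
exists (fun z => path_to m z.1 z.2).
  split; [by split; apply: smem0 | by split; apply: smem0 |
    by split=> k; apply: smem0 |].
  rewrite -[RHS]/(f 0) (linear0 f).
  exact: etrans (congr1 (@path_ev1 C) (esym (linear0 (path_cst C)))) (path_ev1_cst 0).
move=> a z z' [[h1 h2] [h3 h4] [h5 h6] h7] [[k1 k2] [k3 k4] [k5 k6] k7].
split; [by split; apply: smemP | by split; apply: smemP |
  by split=> k; apply: smemP |].
by rewrite [LHS]path_ev1_linear // linearP h7 k7.
Defined.

Lemma path_to1 : path_to 0 qone qone.
Proof.
split; [split|split|split|].
- exact: gd_hom1.
- exact: SA1.
- exact: gd_hom1.
- exact: path_fin1.
- by case=> [|k]; [apply: SC1 | apply: smem0].
- by move=> k; apply: smem0.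
by rewrite /= dm1; apply: path_ev1_cst.
Qed.

Lemma SC_gi k x : hom C k x -> SC x -> SC (gi C x).
Proof. by move=> hx Sx; rewrite (gi_hom hx); apply: smemZ. Qed.

Lemma hom_pred_SCM i j x y : hom C i x -> hom_pred C j y -> SC x -> SC y ->
  SC (x ** y) /\ SC (y ** x).
Proof.
case: j => [|j] hx hy Sx Sy.
  by rewrite (hom_pred0 hy) qmulr0 qmul0r; split; apply: smem0.
by split; [apply: SCM hx hy Sx Sy | apply: SCM hy hx Sy Sx].
Qed.

Lemma path_toM i j a w a' w' : path_to i a w -> path_to j a' w' ->
  path_to (i + j) (a ** a') (w ** w').
Proof.
move=> [[h1 h2] [h3 h4] [h5 h6] h7] [[k1 k2] [k3 k4] [k5 k6] k7].
have [h3a h3b] := h3; have [k3a k3b] := k3.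
split; [split|split|split|].
- exact: gd_homM.
- exact: SAM h1 k1 h2 k2.
- exact: (@gd_homM P i j).
- exact: path_finM.
- by move=> k; apply: smem_sum => e; apply: SCM (h3a _) (k3a _) _ _.
- move=> k; apply: smemD; apply: smem_sum => e.
    by have [] := hom_pred_SCM (h3a e) (k3b (k - e)%N) (h5 e) (k6 (k - e)%N).
  have := hom_pred_SCM (gi_hom_hom (k3a (k - e)%N)) (h3b e)
    (SC_gi (k3a (k - e)%N) (k5 (k - e)%N)) (h6 e).
  by case.
by rewrite path_ev1M // dmM h7 k7.
Qed.

(* extension of a lift over a cell *)
Lemma path_to_fill m (b : A) (y : P) (c : C) :
  path_to m.+2 b y -> dif A b = 0 -> dif P y = 0 -> hom C m.+1 c -> SC c ->
  path_ev0 C y = dif C c ->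
  exists a w, [/\ path_to m.+1 a w, dif A a = b, dif P w = y & path_ev0 C w = c].
Proof.
move=> [[hb Sb] [hy yfin] [Sy1 Sy2] yb] db dy hc Sc yc.
have [hy1 hy2] := hy.
have prim_S k : SC ((path_prim y).1 k).
  by case: k => [|k] /=; [apply: smem0 | apply/smemZ/(SC_gi (hy2 k))].
have Ky : SC (path_int y) by apply: path_ev1_sub.
have hKy : hom C m.+1 (path_int y) by apply: path_int_hom.
(* y runs from dc to f b, and its integral K satisfies d K = f b - dc; so f b is exact, and b is
   exact by injectivity of f in cohomology. *)
have fb : f b = dif C (c + path_int y).
  have := path_int_homotopy yfin.
  have -> : path_int (dif P y) = 0.
    have := path_int_linear (-1) (path_fin1 C) (path_fin1 C).
    rewrite !scaleN1r !addNr => e.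
    exact: etrans (congr1 (@path_int C) dy) e.
  by rewrite addr0 yb yc linearD => ->; rewrite addrC subrK.
have [[f_inj _] [_ f_surj]] := (f_qi m.+2, f_qi m.+1).
have [|a0 [ha0 Sa0] bE] := f_inj b hb Sb db.
  by exists (c + path_int y) => //; split; apply: smemD.
(* The endpoint of the primitive of y starting at c need not be f a0. The difference u is a cycle,
   and surjectivity in cohomology corrects a0 by a cycle z up to a boundary d e. *)
pose u := f a0 - (c + path_int y).
have hu : hom C m.+1 u.
  by rewrite /u addrC -scaleN1r; apply: smemP; [apply: smemD | apply: dm_hom].
have Su : SC u.
  by rewrite /u addrC -scaleN1r; apply: smemP; [apply: smemD | apply: fS].
have [|z [hz Sz dz] [e [he Se] ue]] := f_surj u hu Su.
  by rewrite /u linearB /= -fb -dmd -bE subrr.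
have hzS : hom A m.+1 (a0 - z) /\ SA (a0 - z).
  by rewrite addrC -scaleN1r; split; apply: smemP.
(* A primitive of y starting at c; the exact path d (l e) adds d e to the endpoint, which becomes f
   (a0 - z). *)
pose w : P := path_prim y + (path_cst C c + dif P (aff 0 e)).
have haff : hom P m (aff 0 e).
  split=> [|k]; last exact: smem0.
  by case=> [|[|k]]; rewrite /= ?subr0; [apply: smem0|apply: he|apply: smem0].
have hw : hom P m.+1 w.
  apply: smemD; first exact: path_prim_hom.
  by apply: smemD; [apply: dm_hom | apply: gd_hom_diff].
have wfin : path_fin C w.
  apply: smemD; first exact: path_fin_prim.
  by apply: smemD; [apply: path_fin_cst | apply/path_fin_diff/aff_fin].
exists (a0 - z), w; split.
- split=> //; [split=> k|].
  + apply: smemD; first exact: prim_S.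
    apply: smemD; first by case: k => [|k]; [apply: Sc | apply: smem0].
    by apply: SCd; case: k => [|[|k]]; rewrite /= ?subr0; [apply: smem0|apply: Se|apply: smem0].
  + apply: smemD; first exact: smem0.
    apply: smemD; first exact: smem0.
    apply: smemD; first by rewrite /pmap_ser linear0; apply: smem0.
    apply: (@SC_gi m); case: k => [|k]; rewrite /pderiv /=.
    * by apply: smemZ; rewrite subr0.
    * by rewrite scaler0; apply: smem0.
    * by apply: smemZ; rewrite subr0.
    * by rewrite scaler0; apply: smem0.
  + rewrite /w.
    have E1 := path_ev1_linear 1 (path_fin_prim yfin)
      (smemD (path_fin_cst c) (path_fin_diff (aff_fin 0 e))).
    have E2 := path_ev1_linear 1 (path_fin_cst c) (path_fin_diff (aff_fin 0 e)).
    rewrite !scale1r in E1 E2; rewrite E1 E2 path_ev1_cst path_ev1d; last exact: aff_fin.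
    rewrite aff_ev1 -[path_ev1 (path_prim y)]/(path_int y) -[RHS]/(f (a0 - z)).
    rewrite (linearB f) -[dif C e](ue) /u addrA [path_int y + c]addrC.
    by rewrite [f a0 - _]addrC !addrA subrr add0r.
- by rewrite linearB /= dz subr0.
- rewrite /w linearD linearD gd_diffK addr0 -dmd -yc.
  have := path_prim_homotopy y; rewrite dy linear0 addr0 => ->.
  by rewrite subrK.
rewrite /w linearD linearD dmd aff_ev0 linear0 addr0.
exact: add0r.
Qed.

End Lifting.

Lemma coboundary_inP (A : gdalg) (S : submod A) k a (x y : A) :
  coboundary_in S k x -> coboundary_in S k y -> coboundary_in S k (a *: x + y).
Proof.
case: k => [-> ->|k [u [hu Su] ->] [v [hv Sv] ->]] /=; first by rewrite scaler0 addr0.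
by exists (a *: u + v); [split; apply: smemP | rewrite linearP].
Qed.

Lemma path_int0 (A : igdalg) : path_int (0 : path_ig A) = 0.
Proof.
have := path_int_linear (-1) (path_fin1 A) (path_fin1 A).
by rewrite !scaleN1r !addNr.
Qed.

Section LiftQI.
Variables (V : nat -> lmodType rat) (d0 : differential id V).
Local Notation L := (free_cga id V).
Local Notation fh := (homog (fdeg id (V := V)) (@flin _ V)).

Variables (A C : igdalg) (SA : submod A) (SC : submod C) (f : dga_map A C).
Hypothesis SA1 : SA qone.
Hypothesis SAM : forall i j x y, hom A i x -> hom A j y -> SA x -> SA y -> SA (x ** y).
Hypothesis SC1 : SC qone.
Hypothesis SCM : forall i j x y, hom C i x -> hom C j y -> SC x -> SC y -> SC (x ** y).
Hypothesis SCd : forall x, SC x -> SC (dif C x).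
Hypothesis fS : forall x, SA x -> SC (f x).
Hypothesis f_qi : qi_in SA SC f.
Local Notation P := (path_ig C).
Local Notation pull_path := (pull_path SA SC f).
Local Notation path_to := (path_to SA SC f).

Variable gl : forall m, {linear V m -> C}.
Hypothesis gl_hom : forall m v, hom C m (gl m v).
Hypothesis glS : forall m v, SC (gl m v).
Local Notation g := (free_map (dgJ := id) gl).
Hypothesis gd : forall x, dif C (g x) = g (d0 x).
Hypothesis V0 : forall v : V 0, v = 0.

Local Notation lifts := (forall m, {linear V m -> (A * P)%type}).

Fact lift_fst_linear (l : lifts) m : linear (fun v => (l m v).1).
Proof. by move=> a v w; rewrite linearP. Qed.
Fact lift_snd_linear (l : lifts) m : linear (fun v => (l m v).2).
Proof. by move=> a v w; rewrite linearP. Qed.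
Definition lift_fst (l : lifts) m : {linear V m -> A} := mk_linear (@lift_fst_linear l m).
Definition lift_snd (l : lifts) m : {linear V m -> P} := mk_linear (@lift_snd_linear l m).
Definition mapA (l : lifts) : L -> A := free_map (dgJ := id) (lift_fst l).
Definition mapP (l : lifts) : L -> P := free_map (dgJ := id) (lift_snd l).

Definition lift_ok (l : lifts) : Prop := forall m v, pull_path m (l m v).

(** Lifts are linear maps on all of V with values in the homotopy pullback. Only on F must the path
    start at the given map and the differentials match, which lets F grow along the filtration. *)
Definition lift_on (F : forall m, submod (V m)) (l : lifts) : Prop :=
  forall m v, F m v ->
    [/\ path_ev0 C (l m v).2 = gl m v, dif A (l m v).1 = mapA l (d0 (fvec id v)) &
        dif P (l m v).2 = mapP l (d0 (fvec id v))].

Section OneLift.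
Variables (l : lifts).
Hypothesis l_ok : lift_ok l.

Lemma lift_fst_hom m v : hom A (id m) (lift_fst l m v).
Proof. by have [[h _] _ _ _] := l_ok v. Qed.
Lemma lift_snd_hom m v : hom P (id m) (lift_snd l m v).
Proof. by have [_ [h _] _ _] := l_ok v. Qed.

Lemma mapA_linear : linear (mapA l).
Proof. exact: free_map_linear lift_fst_hom. Qed.
Lemma mapP_linear : linear (mapP l).
Proof. exact: free_map_linear lift_snd_hom. Qed.
Lemma mapAM x y : mapA l (x ** y) = mapA l x ** mapA l y.
Proof. exact: free_mapM lift_fst_hom x y. Qed.
Lemma mapPM x y : mapP l (x ** y) = mapP l x ** mapP l y.
Proof. exact: free_mapM lift_snd_hom x y. Qed.
Lemma mapA1 : mapA l qone = qone. Proof. exact: free_map1 lift_fst_hom. Qed.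
Lemma mapP1 : mapP l qone = qone. Proof. exact: free_map1 lift_snd_hom. Qed.
Lemma mapA_vec m (v : V m) : mapA l (fvec id v) = (l m v).1.
Proof. exact: free_map_vec lift_fst_hom m v. Qed.
Lemma mapP_vec m (v : V m) : mapP l (fvec id v) = (l m v).2.
Proof. exact: free_map_vec lift_snd_hom m v. Qed.
Lemma mapA0 : mapA l 0 = 0.
Proof. exact: (linear0 (mk_linear mapA_linear)). Qed.
Lemma mapP0 : mapP l 0 = 0.
Proof. exact: (linear0 (mk_linear mapP_linear)). Qed.
Lemma g_linear : linear g.
Proof. exact: free_map_linear gl_hom. Qed.
Lemma g0 : g 0 = 0.
Proof. exact: (linear0 (mk_linear g_linear)). Qed.

Lemma map_path_to k x : fh k x -> path_to k (mapA l x) (mapP l x).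
Proof.
move: x; apply: mspan_ind => [|a x y hx hy|s <-].
- by rewrite mapA0 mapP0; exact: (smem0 (pull_path k)).
- by rewrite mapA_linear mapP_linear; exact: (@smemP _ (pull_path k) a (_, _) (_, _) hx hy).
elim: s => [|[m v] s IH].
  by rewrite monom_nil wt_nil mapA1 mapP1; apply: path_to1.
rewrite monom_cons wt_cons mapAM mapPM; apply: path_toM => //.
by rewrite -[gen _ _ _]/(fvec id v) mapA_vec mapP_vec; exact: l_ok.
Qed.

Variable F : forall m, submod (V m).
Hypothesis l_on : lift_on F l.

Lemma lift_on_gen x : gen_in F x ->
  [/\ path_ev0 C (mapP l x) = g x, dif A (mapA l x) = mapA l (d0 x) &
      dif P (mapP l x) = mapP l (d0 x)].
Proof.
have d01 : d0 qone = 0 by exact: (gd_diff1 (free_gdalg d0)).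
move: x; apply: gen_in_ind.
- by rewrite mapA0 mapP0 g0 !linear0 mapA0 mapP0.
- move=> a x y [h1 h2 h3] [k1 k2 k3].
  rewrite mapA_linear mapP_linear g_linear !linearP mapA_linear mapP_linear.
  by rewrite h1 h2 h3 k1 k2 k3.
- by rewrite mapA1 mapP1 (free_map1 gl_hom) dm1 !gd_diff1 d01 mapA0 mapP0.
move=> m v y Fv Fy [h1 h2 h3].
have [e1 e2 e3] := l_on Fv.
rewrite mapAM mapPM dmM (free_mapM gl_hom) h1 mapA_vec mapP_vec (free_map_vec gl_hom) e1.
rewrite (gd_leibniz _ (lift_fst_hom v)) (gd_leibniz _ (lift_snd_hom v)).
rewrite (dfun_leibniz d0 _ (fvec_hom id v)) [d0 _ ** _ + _]addrC.
rewrite mapA_linear mapP_linear !mapAM !mapPM mapA_vec mapP_vec e2 e3 h2 h3.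
by split=> //; rewrite addrC.
Qed.

End OneLift.

Lemma map_agree (F : forall m, submod (V m)) (l l' : lifts) :
  lift_ok l -> lift_ok l' -> (forall m v, F m v -> l m v = l' m v) ->
  forall x, gen_in F x -> mapA l x = mapA l' x /\ mapP l x = mapP l' x.
Proof.
move=> ol ol' E x; move: x; apply: gen_in_ind.
- by rewrite !mapA0 // !mapP0.
- by move=> a x y [h1 h2] [k1 k2]; rewrite !mapA_linear // !mapP_linear // h1 h2 k1 k2.
- by rewrite !mapA1 // !mapP1.
move=> m v y Fv Fy [h1 h2].
by rewrite !mapAM // !mapPM // !mapA_vec // !mapP_vec // h1 h2 (E _ _ Fv).
Qed.

(** On F' the differential lands in the algebra generated by F, where l is already a chain map. The
    possible values at v thus form a linear relation, inhabited by [path_to_fill], and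
    [linear_selection] extends the old lift. *)
Lemma lift_step (F F' : forall m, submod (V m)) (l : lifts) :
  (forall m v, F m v -> F' m v) ->
  (forall m v, F' m v -> gen_in F (d0 (fvec id v))) ->
  lift_ok l -> lift_on F l ->
  exists l' : lifts, [/\ lift_ok l', lift_on F' l' &
    forall m v, F m v -> l' m v = l m v].
Proof.
move=> FF' dF ol on.
have fv0 m : fvec id (0 : V m) = 0 := fvec0 id V m.
have Rm m : exists R : submod (V m * (A * P))%type, forall v w, R (v, w) <->
    [/\ F' m v, pull_path m w, path_ev0 C w.2 = gl m v,
      dif A w.1 = mapA l (d0 (fvec id v)) & dif P w.2 = mapP l (d0 (fvec id v))].
  unshelve eexists.
    exists (fun z => [/\ F' m z.1, pull_path m z.2, path_ev0 C z.2.2 = gl m z.1,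
      dif A z.2.1 = mapA l (d0 (fvec id z.1)) & dif P z.2.2 = mapP l (d0 (fvec id z.1))]).
      split; [exact: smem0 | exact: smem0 | by rewrite !linear0 | |].
        by rewrite fv0 !linear0 mapA0.
      by rewrite fv0 !linear0 mapP0.
    move=> a [v [b w]] [v' [b' w']] [h1 h2 h3 h4 h5] [k1 k2 k3 k4 k5].
    split; [exact: smemP | exact: smemP | | |].
    - by rewrite [LHS](linearP (path_ev0 C)) h3 k3 [RHS]linearP.
    - rewrite [LHS](linearP (dif A)) h4 k4; symmetry.
      change (mapA l (d0 (fvec id (a *: v + v'))) = a *: mapA l (d0 (fvec id v)) +
        mapA l (d0 (fvec id v'))).
      by rewrite fvec_linear linearP mapA_linear.
    - rewrite [LHS](linearP (dif P)) h5 k5; symmetry.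
      change (mapP l (d0 (fvec id (a *: v + v'))) = a *: mapP l (d0 (fvec id v)) +
        mapP l (d0 (fvec id v'))).
      by rewrite fvec_linear linearP mapP_linear.
  by [].
have lm m : exists l' : {linear V m -> (A * P)%type}, [/\ forall v, pull_path m (l' v),
    forall v, F m v -> l' v = l m v & forall v, F' m v ->
    [/\ path_ev0 C (l' v).2 = gl m v, dif A (l' v).1 = mapA l (d0 (fvec id v)) &
        dif P (l' v).2 = mapP l (d0 (fvec id v))]].
  have [R RP] := Rm m.
  have [|v w /RP[] //|l' [e1 e2 e3]] :=
      @linear_selection _ _ R (F m) (pull_path m) (l m).
    move=> u Fu; have [h1 h2 h3] := on _ _ Fu.
    by apply/RP; split=> //; [apply: FF' | apply: ol].
  exists l'; split=> // v F'v.
  suff [w Rw] : exists w, R (v, w) by have /RP[] := e2 _ _ Rw.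
  (* [path_to_fill] fills in degrees at least 1; in degree 0 the only vector is 0, with lift 0. *)
  case: m v F'v {Rm} R RP l' e1 e2 e3 => [|m] v F'v R RP _ _ _ _.
    by exists 0; rewrite (V0 v); apply: smem0.
  have hd : fh m.+2 (d0 (fvec id v)) by apply/dfun_deg/fvec_hom.
  have [k1 k2 k3] := lift_on_gen ol on (dF _ _ F'v).
  have [|||b [w [h1 h2 h3 h4]]] := path_to_fill SCd fS f_qi
    (map_path_to ol hd) _ _ (gl_hom v) (glS v) _.
  - by rewrite k2 dfun_K mapA0.
  - by rewrite k3 dfun_K mapP0.
  - by rewrite k1 -gd (free_map_vec gl_hom).
  by exists (b, w); apply/RP.
pose l' m := proj1_sig (cid (lm m)); have l'P m := proj2_sig (cid (lm m)).
exists l'; split=> [m v|m v F'v|m v Fv]; first by have [] := l'P m.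
- have [o e h] := l'P m; have [h1 h2 h3] := h _ F'v.
  have ol' : lift_ok l' by move=> j u; have [] := l'P j.
  have agree j u : F j u -> l' j u = l j u by move=> Fu; have [_ -> //] := l'P j.
  have [E1 E2] := map_agree ol' ol agree (dF _ _ F'v).
  by rewrite E1 E2.
by have [_ -> //] := l'P m.
Qed.

Variable F : nat -> forall m, submod (V m).
Hypothesis F_incr : forall k m v, F k m v -> F k.+1 m v.
Hypothesis F_exh : forall m v, exists k, F k m v.
Hypothesis F_start : forall m v, F 0 m v -> v = 0.
Hypothesis F_diff : forall k m v, F k.+1 m v -> gen_in (F k) (d0 (fvec id v)).

(** Successive lifts agree on the earlier steps of the filtration, so the limit may be evaluated at
    v in any step containing v. *)
Lemma lift_all : exists2 l : lifts, lift_ok l & lift_on (fun m => sub_full (V m)) l.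
Proof.
pose good (k : nat) (l : lifts) := lift_ok l /\ lift_on (F k) l.
have next_ex (z : nat * lifts) : exists l', good z.1 z.2 ->
    good z.1.+1 l' /\ forall m v, F z.1 m v -> l' m v = z.2 m v.
  case: z => k l; have [[ol on]|nl] := pselect (good k l); last by exists l.
  have [l' [ol' on' e]] := lift_step (@F_incr k) (@F_diff k) ol on.
  by exists l'.
have [next nextP] := choice next_ex.
have Z m : linear (fun _ : V m => 0 : (A * P)%type) by move=> a v w; rewrite scaler0 addr0.
pose ls := fix ls k : lifts := if k is k'.+1 then next (k', ls k') else fun m => mk_linear (@Z m).
have ls_good k : good k (ls k).
  elim: k => [|k IH]; last by have [] := nextP (k, ls k) IH.
  have ol0 : lift_ok (ls 0) by move=> m v; exact: smem0.
  split=> // m v /F_start ->; rewrite (fvec0 id V m) !linear0.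
  by rewrite mapA0 // mapP0.
have lsS k m v : F k m v -> ls k.+1 m v = ls k m v.
  by move=> Fv; have [_ h] := nextP (k, ls k) (ls_good k); apply: h.
have F_le k k' m v : (k <= k')%N -> F k m v -> F k' m v.
  by move=> /subnKC <-; elim: (k' - k)%N => [|j IH] Fv; rewrite ?addn0 // addnS; apply/F_incr/IH.
have ls_le k k' m v : (k <= k')%N -> F k m v -> ls k' m v = ls k m v.
  move=> /subnKC <- Fv; elim: (k' - k)%N => [|j IH]; rewrite ?addn0 // addnS lsS //.
  by apply: F_le Fv; apply: leq_addr.
pose kk m v := proj1_sig (cid (@F_exh m v)).
have kkP m v : F (kk m v) m v := proj2_sig (cid (@F_exh m v)).
pose lf m v := ls (kk m v) m v.
have lfE k m v : F k m v -> lf m v = ls k m v.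
  move=> Fv; rewrite /lf; have [h|h] := leqP k (kk m v); first exact: ls_le.
  by apply/esym/ls_le; [apply: ltnW | apply: kkP].
have lf_lin m : linear (lf m).
  move=> a v w; pose k := maxn (kk m v) (kk m w).
  have [kv kw] : F k m v /\ F k m w.
    by split; [apply: F_le (kkP m v); apply: leq_maxl | apply: F_le (kkP m w); apply: leq_maxr].
  by rewrite (lfE k) ?(lfE k m v) ?(lfE k m w) ?linearP //; apply: smemP.
pose l m := mk_linear (@lf_lin m).
have ol : lift_ok l by move=> m v; have [h _] := ls_good (kk m v); apply: h.
exists l => // m v _.
(* One step further than needed for v: then d v lies in the algebra generated by F at step [kk m v],
   where the limit and this lift agree. *)
have [olk onk] := ls_good (kk m v).+1.
have Fv : F (kk m v).+1 m v by apply/F_incr/kkP.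
have [h1 h2 h3] := onk m v Fv.
have -> : l m v = ls (kk m v).+1 m v by apply: lfE.
have agree j u : F (kk m v) j u -> l j u = ls (kk m v).+1 j u.
  by move=> Fu; rewrite lsS //; apply: lfE.
by have [-> ->] := map_agree ol olk agree (F_diff Fv).
Qed.

Hypothesis g_qi : qi_in (A := free_gdalg d0) (sub_full _) SC g.

(** The paths of the lift are a homotopy from g to f composed with [mapA l], by integration. Both f
    and g being quasi-isomorphisms, so is [mapA l]. *)
Theorem lift_qi : exists fA : L -> A,
  [/\ linear fA, fA qone = qone, forall x y, fA (x ** y) = fA x ** fA y &
    forall x, fA (d0 x) = dif A (fA x)] /\
  (forall k x, fh k x -> hom A k (fA x) /\ SA (fA x)) /\
  qi_in (A := free_gdalg d0) (sub_full _) SA fA.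
Proof.
have [l ol on] := lift_all; exists (mapA l).
have gen_all x : gen_in (fun m => sub_full (V m)) x.
  by apply: mspan_sub (mspan_all x) => s _; elim: s => [|y s IH]; constructor.
have onx x := lift_on_gen ol on (gen_all x).
split; first split=> [||x y|x].
- exact: mapA_linear.
- exact: mapA1.
- exact: mapAM.
- by have [_ ->] := onx x.
have hS k x : fh k x -> path_to k (mapA l x) (mapP l x) by apply: map_path_to.
split=> [k x /hS[] //|k].
have homotopy x : fh k x -> d0 x = 0 -> coboundary_in SC k (f (mapA l x) - g x).
  move=> hx dx; have [_ [hw fw] [_ Sw] ev1] := hS _ _ hx.
  have [ev0 _ dw] := onx x.
  have := path_int_homotopy fw; rewrite dw dx mapP0 // ev0 ev1.
  rewrite path_int0 addr0 => <-.
  case: k hx hw {ev1 dw fw} => [|k] hx hw; first by rewrite (path_int_hom0 hw) linear0.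
  exists (path_int (mapP l x)) => //; split; first exact: path_int_hom.
  by apply: path_ev1_sub => -[|i] /=; [apply: smem0 | apply/smemZ/(SC_gi (hw.2 i))].
have lin0 m : mapA l 0 = 0 by exact: mapA0.
split=> [x hx _ dx cx|y hy Sy dy].
  have [g_inj _] := g_qi k; apply: g_inj => //.
  have cfx : coboundary_in SC k (f (mapA l x)).
    case: {hx homotopy} k cx => [->|k [y [hy Sy] ->]]; first exact: linear0.
    by exists (f y); [split; [apply: dm_hom | apply: fS] | rewrite dmd].
  have := coboundary_inP (-1) (homotopy x hx dx) cfx.
  by rewrite scaleN1r opprB subrK.
have [_ g_surj] := g_qi k; have [f_inj _] := f_qi k.
have [|x [hx _ dx] cx] := g_surj (f y) (dm_hom f hy) (fS Sy).
  by rewrite -dmd dy linear0.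
exists x => //.
have [[hax Sax] _ _ _] := hS _ _ hx.
have [_ dax _] := onx x.
apply: f_inj.
- by rewrite addrC -scaleN1r; apply: smemP.
- by rewrite addrC -scaleN1r; apply: smemP.
- by rewrite linearB /= dy dax dx mapA0 // subrr.
have := coboundary_inP (-1) (homotopy x hx dx) cx.
by rewrite scaleN1r opprB addrC addrA subrK linearB.
Qed.

End LiftQI.

(** * The part of perversity 0 *)

Section Weights.
Variables (J : Type) (dgJ : J -> nat) (V : J -> lmodType rat).
Local Notation L := (free_cga dgJ V).
Local Notation fh := (homog (fdeg dgJ (V := V)) (@flin _ V)).
Local Notation mono := (monom (fdeg dgJ (V := V)) (@flin _ V)).

Let wgen (g : fgen V) : pser L := pser_mono (fdeg dgJ g) (gen (fdeg dgJ (V := V)) (@flin _ V) g).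

Lemma wgen_respects : respects_rel (fdeg dgJ (V := V)) (@flin _ V) wgen.
Proof.
split=> [x y|_ [j a v w] /=]; first by rewrite !pser_monoM addnC gen_comm pser_monoZ.
apply/funext => k; rewrite /wgen /fdeg /=.
rewrite pserD pserN pserD pserZ /pser_mono.
by case: eqP => _; rewrite ?scaler0 ?addr0 ?subrr // -/(fvec dgJ _) fvec_linear subrr.
Qed.

Lemma wgen_monom s : cga_map wgen (mono s) = pser_mono (wt (fdeg dgJ (V := V)) s) (mono s).
Proof.
elim: s => [|g s IH].
  by rewrite monom_nil wt_nil (cga_map1 wgen_respects); apply/funext => -[|k].
by rewrite monom_cons wt_cons (cga_mapM wgen_respects) IH (cga_map_gen wgen_respects) pser_monoM.
Qed.

(** Multiplying each generator by T to the power of its degree defines an algebra map to power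
    series, which separates monomials by degree. Its coefficient of T^k fixes x and keeps only the
    monomials of degree k; no basis of monomials is involved. *)
Lemma mspan_homog (Q : seq (fgen V) -> Prop) k x :
  fh k x -> mspan (fdeg dgJ (V := V)) (@flin _ V) Q x ->
  mspan (fdeg dgJ (V := V)) (@flin _ V) (fun s => Q s /\ wt (fdeg dgJ (V := V)) s = k) x.
Proof.
move=> hx Qx.
have <- : cga_map wgen x k = x.
  move: x hx {Qx}; apply: mspan_ind => [|a x y hx hy|s ws].
  - by rewrite (cga_map0 wgen_respects).
  - by rewrite (cga_map_linear wgen_respects) pserD pserZ hx hy.
  by rewrite wgen_monom /pser_mono ws eqxx.
move: x Qx {hx}; apply: mspan_ind => [|a x y h1 h2|s Qs].
- by rewrite (cga_map0 wgen_respects); exact: smem0.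
- by rewrite (cga_map_linear wgen_respects); apply: smemP.
rewrite wgen_monom /pser_mono; case: eqP => [->|_]; last exact: smem0.
exact: mspan_monom.
Qed.

End Weights.

Section PervZero.
Variable n : nat.

Lemma perv_le0 (p : perv n) : perv_le p (perv0 n) -> p = perv0 n.
Proof.
case: p => [q|] /perv_leE h; last by have := h ord0.
congr Some; apply: val_inj; apply/ffunP => i; rewrite ffunE.
by have := h i; rewrite lee_fin ffunE lez_nat leqn0 => /eqP.
Qed.

Lemma perv_sum_le0 (s : seq (perv n)) : perv_sum_le s (perv0 n) ->
  forall p, p \in s -> p = perv0 n.
Proof.
move=> /forallP h p ps; apply: perv_le0; apply/forallP => i; rewrite big_seq1.
apply: le_trans (h i); rewrite (big_rem p) //=.
by rewrite leeDl // sume_ge0 // => q _; apply: perv_val_ge0.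
Qed.

End PervZero.

Section ZeroPart.
Variables (n : nat) (V : perv n * nat -> lmodType rat) (d : differential (@pdeg n) V).
Hypothesis dP : perverse_minimal d.
Local Notation W := (zero_part V).
Local Notation B := (free_cga (@pdeg n) V).
Local Notation L := (free_cga id W).
Local Notation fhB := (homog (fdeg (@pdeg n) (V := V)) (@flin _ V)).
Local Notation fhL := (homog (fdeg id (V := W)) (@flin _ W)).

Fact zero_differential_proof : linear (fun _ : L => 0 : L).
Proof. by move=> a x y; rewrite scaler0 addr0. Qed.

(** Turns the free algebra on V_[0] into a [gdalg], the kind of target [free_map] expects; the true
    differential is constructed afterwards by means of [retract]. *)
Definition zero_differential : differential id W.
Proof.
refine (@Differential _ id W (mk_linear zero_differential_proof) _ _ _) => //.
- by move=> k x _; exact: smem0.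
by move=> k x y _; rewrite -[LHS]/(0 : L) qmul0r qmulr0 scaler0 addr0.
Defined.

(** By cases on whether the perversity of j is 0; the transport expresses the value on V_[0] for an
    index j not syntactically of that form. *)
Lemma retract_gen_exists (j : perv n * nat) : exists l : {linear V j -> L},
  (forall v, fhL (pdeg j) (l v)) /\
  forall m (e : (perv0 n, m) = j) (v : W m),
    l (eq_rect _ (fun j => V j : Type) v _ e) = fvec id v.
Proof.
case: j => p m; have [->|np] := pselect (p = perv0 n).
  exists (mk_linear (@fvec_linear _ id W m)); split=> [v|k e v].
    exact: fvec_hom.
  case: (e) => km; case: m / km e => e.
  by rewrite (Prop_irrelevance e erefl).
have Z : linear (fun _ : V (p, m) => 0 : L) by move=> a v w; rewrite scaler0 addr0.
exists (mk_linear Z); split=> [v|k e v]; first exact: smem0.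
by case: np; case: e.
Qed.

Definition retract_gen j : {linear V j -> L} := proj1_sig (cid (retract_gen_exists j)).

Lemma retract_gen_hom j v : hom (free_gdalg zero_differential) (pdeg j) (retract_gen j v).
Proof. by have [h _] := proj2_sig (cid (retract_gen_exists j)); apply: h. Qed.

Lemma retract_genE m (v : W m) : retract_gen (perv0 n, m) v = fvec id v.
Proof. by have [_ h] := proj2_sig (cid (retract_gen_exists (perv0 n, m))); apply: (h m erefl). Qed.

(* kills the generators of non-zero perversity *)
Definition retract (x : B) : L :=
  free_map (B := free_gdalg zero_differential) (dgJ := @pdeg n) retract_gen x.

Lemma retract_linear : linear retract.
Proof. exact: free_map_linear retract_gen_hom. Qed.
Lemma retractM x y : retract (x ** y) = retract x ** retract y.
Proof. exact: free_mapM retract_gen_hom x y. Qed.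
Lemma retract1 : retract qone = qone.
Proof. exact: free_map1 retract_gen_hom. Qed.
Lemma retract_vec j (v : V j) : retract (fvec (@pdeg n) v) = retract_gen j v.
Proof. exact: free_map_vec retract_gen_hom j v. Qed.
Lemma retract_vec0 m (v : W m) : retract (@fvec _ (@pdeg n) V (perv0 n, m) v) = fvec id v.
Proof. by rewrite retract_vec retract_genE. Qed.
Lemma retract_hom k x : fhB k x -> fhL k (retract x).
Proof. exact: free_map_hom retract_gen_hom k x. Qed.
Lemma retract0 : retract 0 = 0.
Proof. exact: (linear0 (mk_linear retract_linear)). Qed.

Definition incl_gen m : {linear W m -> B} :=
  mk_linear (@fvec_linear _ (@pdeg n) V (perv0 n, m)).
Lemma incl_gen_hom m v : hom (free_gdalg d) (id m) (incl_gen m v).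
Proof. exact: (@fvec_hom _ (@pdeg n) V (perv0 n, m)). Qed.

Local Notation zi := (@zero_incl n V).
Lemma zero_incl_linear : linear zi.
Proof. exact: (free_map_linear (B := free_gdalg d) incl_gen_hom). Qed.
Lemma zero_inclM x y : zi (x ** y) = zi x ** zi y.
Proof. exact: (free_mapM (B := free_gdalg d) incl_gen_hom x y). Qed.
Lemma zero_incl1 : zi qone = qone.
Proof. exact: (free_map1 (B := free_gdalg d) incl_gen_hom). Qed.
Lemma zero_incl_vec m (v : W m) : zi (fvec id v) = @fvec _ (@pdeg n) V (perv0 n, m) v.
Proof. exact: (free_map_vec (B := free_gdalg d) incl_gen_hom v). Qed.
Lemma zero_incl_hom k x : fhL k x -> fhB k (zi x).
Proof. exact: (free_map_hom (B := free_gdalg d) incl_gen_hom). Qed.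
Lemma zero_incl0 : zi 0 = 0.
Proof. exact: (linear0 (mk_linear zero_incl_linear)). Qed.

Lemma zero_inclK x : retract (zi x) = x.
Proof.
apply: (@free_ind _ id W (fun x => retract (zi x) = x)).
- by rewrite zero_incl0 retract0.
- by move=> a u v hu hv; rewrite zero_incl_linear retract_linear hu hv.
- by rewrite zero_incl1 retract1.
by move=> m v y hy; rewrite zero_inclM retractM hy zero_incl_vec retract_vec0.
Qed.

Lemma perv_add_le00 : perv_add_le (perv0 n) (perv0 n) (perv0 n).
Proof.
apply/forallP => i; rewrite big_cons big_seq1 /= -EFinD lee_fin.
by rewrite ffunE.
Qed.

Lemma zero_incl_part x : perv_part V (perv0 n) (zi x).
Proof.
apply: (@free_ind _ id W (fun x => perv_part V (perv0 n) (zi x))).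
- by rewrite zero_incl0; apply: smem0.
- by move=> a u v hu hv; rewrite zero_incl_linear; apply: smemP.
- by rewrite zero_incl1; apply: perv_part1.
move=> m v y hy; rewrite zero_inclM; apply: (perv_partM perv_add_le00) => //.
rewrite zero_incl_vec /fvec -monom_seq1; apply: mspan_monom.
by apply/forallP => i; rewrite big_seq1.
Qed.

(** Perversities being non-negative, a product of total perversity at most 0 has all its factors in
    V_[0]. So perversity 0 is exactly the free algebra on V_[0]. *)
Lemma perv_part_incl x : perv_part V (perv0 n) x -> zi (retract x) = x.
Proof.
move: x; apply: mspan_ind => [|a x y hx hy|s].
- by rewrite retract0 zero_incl0.
- by rewrite retract_linear zero_incl_linear hx hy.
move=> /perv_sum_le0; elim: s => [|[[p m] v] s IH] h.
  by rewrite monom_nil retract1 zero_incl1.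
rewrite monom_cons retractM zero_inclM IH => [|q qs]; last first.
  by apply: h; rewrite inE qs orbT.
congr (_ ** _); have := h p; rewrite inE eqxx => /(_ isT) e.
by subst p; rewrite -[gen _ _ _]/(fvec _ v) retract_vec0 zero_incl_vec.
Qed.

Definition zero_diff_fun (x : L) : L := retract (d (zi x)).

Lemma zero_diff_incl x : zi (zero_diff_fun x) = d (zi x).
Proof. by apply: perv_part_incl; apply: pm_part => //; apply: zero_incl_part. Qed.

Fact zero_diff_linear : linear zero_diff_fun.
Proof.
by move=> a x y; rewrite /zero_diff_fun zero_incl_linear linearP retract_linear.
Qed.

Definition zero_diff : differential id W.
Proof.
refine (@Differential _ id W (mk_linear zero_diff_linear) _ _ _).
- by move=> k x hx; apply/retract_hom/dfun_deg/zero_incl_hom.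
- move=> k x y hx; rewrite -[LHS]/(retract (d (zi (x ** y)))).
  rewrite zero_inclM (dfun_leibniz d _ (zero_incl_hom hx)) addrC retract_linear !retractM.
  by rewrite !zero_inclK addrC.
move=> x; rewrite -[LHS]/(retract (d (zi (zero_diff_fun x)))).
by rewrite zero_diff_incl dfun_K retract0.
Defined.

Lemma zero_diffE x : zero_diff x = retract (d (zi x)). Proof. by []. Qed.
Lemma zero_diff_vec m (v : W m) :
  zero_diff (fvec id v) = retract (d (@fvec _ (@pdeg n) V (perv0 n, m) v)).
Proof. by rewrite zero_diffE zero_incl_vec. Qed.

End ZeroPart.

Section ZeroMinimal.
Variables (n : nat) (V : perv n * nat -> lmodType rat) (d : differential (@pdeg n) V).
Hypothesis dP : perverse_minimal d.
Local Notation W := (zero_part V).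
Local Notation L := (free_cga id W).
Local Notation d0 := (zero_diff dP).
Local Notation fv0 m v := (@fvec _ (@pdeg n) V (perv0 n, m) v).

Definition diff_in (m : nat) (S : submod L) : submod (W m).
Proof.
exists (fun v => S (d0 (fvec id v))) => [|a v w hv hw].
  by rewrite fvec0 linear0; apply: smem0.
by rewrite fvec_linear linearP; apply: smemP.
Defined.

Definition trivial_submod (U : lmodType rat) : submod U.
Proof.
exists (fun x => x = 0) => // a x y -> ->; by rewrite scaler0 addr0.
Defined.

(** Each step takes every vector whose differential lies in the algebra generated by the previous
    one. The conditions on d hold by construction, and what remains to be proved is that the
    filtration is increasing and exhausts V_[0]. *)
Fixpoint zero_filtration (k m : nat) : submod (W m) :=
  if k is k'.+1 then diff_in m (gen_in (zero_filtration k'))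
  else diff_in m (trivial_submod L).
Local Notation G := zero_filtration.

Lemma gen_in_sub (F F' : forall m, submod (W m)) : (forall m v, F m v -> F' m v) ->
  forall x, gen_in F x -> gen_in F' x.
Proof.
move=> FF'; apply: mspan_sub => s.
by apply: List.Forall_impl => -[m v]; apply: FF'.
Qed.

Lemma gen_in_vec (F : forall m, submod (W m)) m (v : W m) : F m v -> gen_in F (fvec id v).
Proof. by move=> Fv; rewrite /fvec -monom_seq1; apply: mspan_monom; constructor. Qed.

Lemma gen_in1 (F : forall m, submod (W m)) : gen_in F qone.
Proof. by rewrite -monom_nil; apply: mspan_monom; constructor. Qed.

Lemma gen_inM (F : forall m, submod (W m)) x y : gen_in F x -> gen_in F y -> gen_in F (x ** y).
Proof. by apply: mspan_mul => s s' hs hs'; apply/List.Forall_app. Qed.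

Lemma filtrationS k m v : G k m v -> G k.+1 m v.
Proof.
elim: k m v => [|k IH] m v h.
  change (gen_in (G 0) (d0 (fvec id v))).
  by have -> : d0 (fvec id v) = 0 := h; apply: smem0.
change (gen_in (G k.+1) (d0 (fvec id v))).
exact: (gen_in_sub IH h).
Qed.

Lemma filtration_le k k' m v : (k <= k')%N -> G k m v -> G k' m v.
Proof.
by move=> /subnKC <-; elim: (k' - k)%N => [|j IH] Fv; rewrite ?addn0 // addnS; apply/filtrationS/IH.
Qed.

Lemma gen_filtration_le k k' x : (k <= k')%N -> gen_in (G k) x -> gen_in (G k') x.
Proof. by move=> kk'; apply: gen_in_sub => m v; apply: filtration_le. Qed.

Lemma lower_zero m (F : submod (V (perv0 n, m))) (g : fgen V) : lower_gen F g ->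
  exists2 h : fgen W, ((tag h < m)%N \/ exists2 v : W m, F v & h = Tagged W v) &
    g = Tagged V (tagged h : V (perv0 n, tag h)).
Proof.
case: g => [[p k] v] [/andP[/= np /perv_le0 e]|[/= [e km]|[u Fu e]]].
- by rewrite e eqxx in np.
- by subst p; exists (Tagged W (v : W k)); [left|].
by exists (Tagged W (u : W m)); [right; exists u|].
Qed.

(** Induction on the degree and then on the index of the filtration given by perverse minimality. No
    perversity is strictly below 0, so d of a vector of V_[0][i] involves only generators of V_[0]
    of lower degree, or of the same degree and lower index. *)
Lemma zero_part_ind (Q : forall m, W m -> Prop) :
  (forall m v w, Q m v -> Q m w -> Q m (v + w)) ->
  (forall m v, mspan (fdeg id (V := W)) (@flin _ W)
     (List.Forall (fun g => (tag g <= m)%N /\ Q (tag g) (tagged g))) (d0 (fvec id v)) ->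
   Q m v) -> forall m v, Q m v.
Proof.
move=> QD Qd m; have [m' le_m] := ubnP m; elim: m' => // m' IHm in m le_m *.
have [F [Wf [F0 FS _ Fex Wd]]] := pm_filtration dP.
move=> v; have [i Fv] := Fex _ _ v; elim: i v Fv => [|i IHi] v.
  by move=> /F0 ->; apply: Qd; rewrite fvec0 linear0; apply: smem0.
move=> /FS[x [y [Fx Wy ->]]]; apply: QD; first exact: IHi.
apply: Qd; rewrite zero_diff_vec.
have := Wd _ _ _ _ Wy; move: (d _) => z {y Wy}; move: z.
apply: mspan_ind => [|a u w hu hw|s [hs _]].
- by rewrite retract0; apply: smem0.
- by rewrite retract_linear; apply: smemP.
suff [s' hs' ->] : exists2 s' : seq (fgen W),
    List.Forall (fun g => (tag g <= m)%N /\ Q (tag g) (tagged g)) s' &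
    retract (monom (fdeg (@pdeg n) (V := V)) (@flin _ V) s) =
      monom (fdeg id (V := W)) (@flin _ W) s'.
  exact: mspan_monom.
elim: hs => [|g {}s lg _ [s' hs' e]]; first by exists [::]; rewrite ?monom_nil ?retract1.
have [h hg gE] := lower_zero lg; exists (h :: s').
  constructor=> //; case: hg => [hm|[u Fu ->]]; last by split=> //=; apply: IHi.
  by split; [apply: ltnW | apply: IHm; apply: leq_trans hm _].
rewrite !monom_cons retractM e gE; congr (_ ** _).
by case: h {hg gE} => k u; apply: retract_vec0.
Qed.

Lemma filtration_exhaustive m v : exists k, G k m v.
Proof.
apply: (zero_part_ind (Q := fun m v => exists k, G k m v)) => {m v} [m v w [k kv] [k' kw]|m v].
  exists (maxn k k'); apply: smemD.
    by apply: filtration_le kv; apply: leq_maxl.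
  by apply: filtration_le kw; apply: leq_maxr.
move=> h; suff [k hk] : exists k, gen_in (G k) (d0 (fvec id v)) by exists k.+1.
move: (d0 _) h; apply: mspan_ind => [|a x y [k kx] [k' ky]|s].
- by exists 0%N; apply: smem0.
- exists (maxn k k'); apply: smemP.
    by apply: gen_filtration_le kx; apply: leq_maxl.
  by apply: gen_filtration_le ky; apply: leq_maxr.
elim=> [|[j u] {}s [_ [k Gu]] _ [k' hs]].
  by exists 0%N; rewrite monom_nil; apply: gen_in1.
exists (maxn k k'); rewrite monom_cons; apply: gen_inM.
  by apply: gen_in_vec; apply: filtration_le Gu; apply: leq_maxl.
by apply: gen_filtration_le hs; apply: leq_maxr.
Qed.

(** d v has degree m+1 while its monomials only use generators of degree at most m, so none of them
    has length 0 or 1. *)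
Lemma zero_decomposable m (v : W m) :
  mspan (fdeg id (V := W)) (@flin _ W) (fun s => 2 <= size s)%N (d0 (fvec id v)).
Proof.
apply: (zero_part_ind (Q := fun m v => mspan (fdeg id (V := W)) (@flin _ W)
    (fun s => 2 <= size s)%N (d0 (fvec id v)))) => {m v} [m v w hv hw|m v h].
  have -> : fvec id (v + w) = fvec id v + fvec id w.
    by have := @fvec_linear _ id W m 1 v w; rewrite !scale1r.
  by rewrite linearD; apply: smemD.
have hd : homog (fdeg id (V := W)) (@flin _ W) m.+1 (d0 (fvec id v)).
  by apply/dfun_deg/fvec_hom.
apply: mspan_sub (mspan_homog hd h) => -[|g [|g' s]] [hs ws] //.
  by rewrite wt_nil in ws.
move: ws; rewrite wt_cons wt_nil addn0 => gm.
inversion_clear hs as [|? ? [gle _] _].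
by rewrite -[tag g]/(fdeg id g) gm ltnn in gle.
Qed.

Theorem zero_minimal : sullivan_minimal d0.
Proof.
split; first by move=> v; apply: pm_deg0 dP _ v.
split; last exact: zero_decomposable.
exists zero_filtration; split.
- exact: filtrationS.
- exact: filtration_exhaustive.
- by [].
by [].
Qed.

End ZeroMinimal.

(** * The comparison map on the free algebra on V_[0] *)

Section ModelMap.
Variables (n : nat) (K : filtered_face_set n).
Variables (V : perv n * nat -> lmodType rat) (d : differential (@pdeg n) V).
Variables (dP : perverse_minimal d).
Variable f : perverse_map (perverse_model dP) (perverse_forms K).
Local Notation W := (zero_part V).
Local Notation L := (free_cga id W).
Local Notation fhL := (homog (fdeg id (V := W)) (@flin _ W)).
Local Notation d0 := (zero_diff dP).
Local Notation p0 := (perv0 n).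
Local Notation C := (blow_ig K).

Lemma model_elt_subproof k x : fhL k x ->
  sub_cap (gd_hom (free_gdalg d) k) (perv_part V p0) (zero_incl x).
Proof. by move=> hx; split; [apply: zero_incl_hom | apply: zero_incl_part]. Qed.

Definition model_elt k x (hx : fhL k x) : perverse_model dP p0 k :=
  in_subspace (model_elt_subproof hx).

Lemma model_elt_eq k x y (hx : fhL k x) (hy : fhL k y) :
  x = y -> model_elt hx = model_elt hy.
Proof. by move=> xy; apply: val_inj; rewrite /= xy. Qed.

Definition model_vec m (v : W m) : blow_families K :=
  val (f p0 m (model_elt (fvec_hom id v))).

Fact model_vec_linear m : linear (@model_vec m).
Proof.
move=> a v w; rewrite /model_vec.
have -> : model_elt (fvec_hom id (a *: v + w)) =
    a *: model_elt (fvec_hom id v) + model_elt (fvec_hom id w).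
  by apply: val_inj; rewrite /= fvec_linear zero_incl_linear.
by rewrite linearP.
Qed.

Definition model_gen m : {linear W m -> C} := mk_linear (@model_vec_linear m).

Lemma model_gen_hom m v : hom C m (model_gen m v).
Proof. by have [] := subspaceP (f p0 m (model_elt (fvec_hom id v))). Qed.
Lemma model_gen_pforms m v : pforms K p0 (model_gen m v).
Proof. by have [] := subspaceP (f p0 m (model_elt (fvec_hom id v))). Qed.

Local Notation g := (free_map (dgJ := id) model_gen).

Lemma model_map0 : g 0 = 0.
Proof. exact: (linear0 (mk_linear (free_map_linear model_gen_hom))). Qed.

(** f is given separately in each degree. The algebra map rebuilt from its values on generators
    agrees with it, and applies to non-homogeneous elements as the lifting requires. *)
Lemma model_mapE k x (hx : fhL k x) : g x = val (f p0 k (model_elt hx)).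
Proof.
(* The proof of homogeneity is quantified existentially so that the induction on x can build it. *)
suff [hx' ->] : exists hx' : fhL k x, g x = val (f p0 k (model_elt hx')).
  by rewrite (model_elt_eq hx' hx).
move: x hx; apply: mspan_ind => [|a x y [hx ex] [hy ey]|s <-].
- exists (smem0 _).
  have -> : model_elt (smem0 (fhL k)) = 0 by apply: val_inj; apply: zero_incl0.
  by rewrite (linear0 (f p0 k)) model_map0.
- exists (smemP a hx hy); rewrite (free_map_linear model_gen_hom) ex ey.
  have -> : model_elt (smemP a hx hy) = a *: model_elt hx + model_elt hy.
    by apply: val_inj; apply: zero_incl_linear.
  by rewrite linearP.
elim: s => [|[m v] s [hs es]].
  rewrite monom_nil wt_nil; exists (homog1 _ _).
  have -> : model_elt (homog1 (fdeg id (V := W)) (@flin _ W)) = pone (perverse_model dP).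
    by apply: val_inj; apply: zero_incl1.
  by rewrite (free_map1 model_gen_hom) pfun1.
rewrite monom_cons wt_cons -[gen _ _ _]/(fvec id v) -[fdeg id _]/m.
have hx := homogM (fvec_hom id v) hs; exists hx.
rewrite (free_mapM model_gen_hom) es (free_map_vec model_gen_hom).
have -> : model_elt hx = pmul (perv_add_le00 n) (erefl _)
    (model_elt (fvec_hom id v)) (model_elt hs).
  by apply: val_inj; apply: zero_inclM.
by rewrite pfunM.
Qed.

Lemma model_map_d x : dif C (g x) = g (d0 x).
Proof.
move: x (mspan_all x); apply: mspan_ind => [|a x y hx hy|s _].
- by rewrite (linear0 d0) model_map0 (linear0 (dif C)).
- by rewrite (linearP d0) !(free_map_linear model_gen_hom) (linearP (dif C)) hx hy.
have hs : fhL (wt (fdeg id (V := W)) s) (monom (fdeg id (V := W)) (@flin _ W) s).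
  exact: mspan_monom.
rewrite (model_mapE hs) (model_mapE (dfun_deg d0 hs)).
have -> : model_elt (dfun_deg d0 hs) = cdiff _ _ (model_elt hs).
  by apply: val_inj; apply: zero_diff_incl.
by rewrite cmap_diff.
Qed.

Hypothesis f_qi : perverse_quasi_iso f.

Lemma model_map_qi : qi_in (A := free_gdalg d0) (sub_full _) (pforms K p0) g.
Proof.
move=> k; have [f_inj f_surj] := f_qi p0 k; split=> [x hx _ dx cx|y hy Sy dy].
  have /f_inj : cdiff _ _ (model_elt hx) = 0.
    by apply: val_inj; rewrite /= -[RHS](zero_incl0 d) -dx; apply/esym/zero_diff_incl.
  rewrite (model_mapE hx) in cx.
  case: {f_inj f_surj} k x hx dx cx => [|k] x hx dx cx.
    have {}cx : val (f p0 0%N (model_elt hx)) = val (0 : perverse_forms K p0 0) := cx.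
    by move=> /(_ (val_inj cx)) /(congr1 val) /= e; rewrite -[x](zero_inclK d) e retract0.
  case: cx => z [hz Sz] e inj_x.
  have zz : sub_cap (gd_hom (blow_families K) k) (pforms K p0) z by split.
  have [|y] := inj_x; first by exists (in_subspace zz); apply: val_inj.
  move=> /(congr1 val) /= ey; have [hy Sy] := subspaceP y.
  exists (retract (val y)); first by split=> //; apply: retract_hom.
  by rewrite -[RHS]/(retract (d (zero_incl _))) perv_part_incl // -ey zero_inclK.
have yy : sub_cap (gd_hom (blow_families K) k) (pforms K p0) y by split.
have [|X dX cX] := f_surj (in_subspace yy).
  by apply: val_inj.
have [hX SX] := subspaceP X; have hx := retract_hom hX.
exists (retract (val X)).
  split=> //; rewrite -[LHS]/(retract (d (zero_incl _))) perv_part_incl //.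
  by have /(congr1 val) /= -> := dX; rewrite retract0.
rewrite (model_mapE hx).
have -> : model_elt hx = X by apply: val_inj; apply: perv_part_incl.
clear f_inj f_surj hX hx dX; case: k hy yy X cX SX => [|k] hy yy X cX SX.
  by have := congr1 val cX.
case: cX => z /(congr1 val) /= ->; have [hz Sz] := subspaceP z.
by exists (val z).
Qed.

End ModelMap.

(** * Assembling the minimal model *)

Section CdgaMap.
Variables (V : nat -> lmodType rat) (d0 : differential id V) (T : face_set).
Local Notation L := (free_cga id V).
Local Notation fhL := (homog (fdeg id (V := V)) (@flin _ V)).
Variable h : L -> apl_families T.
Hypothesis h_linear : linear h.
Hypothesis h1 : h qone = qone.
Hypothesis hM : forall x y, h (x ** y) = h x ** h y.
Hypothesis hd : forall x, h (d0 x) = dif (apl_families T) (h x).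
Hypothesis h_sub : forall k x, fhL k x ->
  hom (apl_families T) k (h x) /\ apl_compatible T (h x).

Fact apl_map_subproof k (x : free_cdga d0 k) :
  sub_cap (gd_hom (apl_families T) k) (apl_compatible T) (h (val x)).
Proof. by have [hx _] := subspaceP x; apply: h_sub. Qed.

Definition apl_map_fun k (x : free_cdga d0 k) : APL T k := in_subspace (apl_map_subproof x).

Fact apl_map_linear k : linear (@apl_map_fun k).
Proof. by move=> a x y; apply: val_inj; apply: h_linear. Qed.

Definition apl_cochain_map : cochain_map (free_cdga d0) (APL T).
Proof.
refine (@CochainMap (free_cdga d0) (APL T) (fun k => mk_linear (@apl_map_linear k)) _).
by move=> k x; apply: val_inj; apply: hd.
Defined.

Definition apl_cdga_map : cdga_map (free_cdga d0) (APL T).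
Proof.
refine (@CdgaMap (free_cdga d0) (APL T) apl_cochain_map _ _).
  by apply: val_inj; apply: h1.
by move=> i j k e x y; apply: val_inj; apply: hM.
Defined.

Lemma apl_cdga_map_qi : qi_in (A := free_gdalg d0) (sub_full _) (apl_compatible T) h ->
  quasi_iso apl_cdga_map.
Proof.
move=> qi k; have [h_inj h_surj] := qi k; split=> [x dx cx|y dy].
  have [hx _] := subspaceP x.
  have dx' : d0 (val x) = 0 by have := congr1 val dx.
  have cx' : coboundary_in (apl_compatible T) k (h (val x)).
    clear h_inj h_surj hx dx dx'; case: k x cx => [|k] x; first by move=> /(congr1 val).
    by case=> z /(congr1 val) /= ->; have [hz Sz] := subspaceP z; exists (val z).
  have := h_inj (val x) hx I dx' cx'.
  clear h_inj h_surj hx dx dx' cx cx'; case: k x => [|k] x.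
    by move=> e; apply: val_inj.
  case=> z [hz _] e.
  have zz : sub_cap (gd_hom (free_gdalg d0) k) (sub_full _) z by split.
  by exists (in_subspace zz); apply: val_inj.
have [hy Sy] := subspaceP y.
have dy' : dif (apl_families T) (val y) = 0 by have := congr1 val dy.
have [x [hx _ dx] cx] := h_surj (val y) hy Sy dy'.
have xx : sub_cap (gd_hom (free_gdalg d0) k) (sub_full _) x by split.
exists (in_subspace xx); first exact: val_inj.
clear h_inj h_surj dy hy Sy dy' dx hx; case: k y x xx cx => [|k] y x xx.
  by move=> e; apply: val_inj.
case=> z [hz Sz] e.
have zz : sub_cap (gd_hom (apl_families T) k) (apl_compatible T) z by split.
by exists (in_subspace zz); apply: val_inj.
Qed.

End CdgaMap.

Theorem proposition2p31 (n : nat) (K : filtered_face_set n)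
    (V : perv n * nat -> lmodType rat) (d : differential (@pdeg n) V)
    (dP : perverse_minimal d)
    (f : perverse_map (perverse_model dP) (perverse_forms K)) :
  ff_connected K -> ff_normal K -> perverse_quasi_iso f ->
  exists d0 : differential id (zero_part V),
    (forall x : free_cga id (zero_part V),
       zero_incl (d0 x) = d (zero_incl x)) /\
    is_minimal_model d0 (APL (assoc K)).
Proof.
move=> _ K_normal f_qi; exists (zero_diff dP); split; first exact: zero_diff_incl.
split; first exact: zero_minimal.
have [V0 [[F [F_incr F_exh F_start F_diff]] _]] := zero_minimal dP.
(* Sullivan filtrations start with d = 0, the lifting with the zero subspace; the shift by one
   accounts for this. *)
pose G k m := if k is k'.+1 then F k' m else trivial_submod (zero_part V m).
have [||||h [[h_lin h1 hM hd] [h_sub h_qi]]] :=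
  @lift_qi _ (zero_diff dP) (apl_ig K) (blow_ig K) (apl_compatible (assoc K))
    (pforms K (perv0 n)) (blowup_dga K)
    (@apl_compatible1 _) (fun _ _ x y _ _ => @apl_compatibleM _ x y)
    (pforms1 K) (pformsM (perv_add_le00 n)) (@pforms_diff _ K _)
    (@blowup_all_pforms _ K) (blowup_qi K_normal) _
    (model_gen_hom f) (model_gen_pforms f) (model_map_d f) V0 G _ _ _ _
    (model_map_qi f_qi).
- by move=> [|k] m v; [move=> ->; apply: smem0 | apply: F_incr].
- by move=> m v; have [k kv] := F_exh m v; exists k.+1.
- by [].
- move=> [|k] m v; last exact: F_diff.
  by move=> /F_start ->; apply: smem0.
by exists (apl_cdga_map h_lin h1 hM hd h_sub); apply: apl_cdga_map_qi.
Qed.
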